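(* Assume: (A1) $(\epsilon_t)$ is a strictly stationary, ergodic and nonanticipative process; (A2) the parameter set $\Theta\subset\mathbb{R}^d$ is convex and not necessarily compact; (A3) for any $(\epsilon_t)$, $\theta\mapsto l(\epsilon_t;\theta)$ is strictly convex and $C^\infty$ on $\Theta$; (A4) $\theta\mapsto\mathbb{E}[l(\epsilon_t;\theta)]$ is uniquely minimized at $\theta_0$, and $(\nabla_\theta l(\epsilon_t;\theta_0))$ is a square integrable martingale difference; (A5) $\mathbb{H}:=\mathbb{E}[\nabla^2_{\theta\theta'}l(\epsilon_t;\theta_0)]$ and $\mathbb{M}:=\mathbb{E}[\nabla_\theta l(\epsilon_t;\theta_0)\nabla_{\theta'}l(\epsilon_t;\theta_0)]$ exist and are positive definite; (A6) for every fixed constant $C>0$, with $\upsilon_t(C)=\sup_{k,l,m=1,\dots,d}\ \sup_{\theta:\|\theta-\theta_0\|_2\le\nu_TC}|\partial^3_{\theta_k\theta_l\theta_m}l(\epsilon_t;\theta)|$, the quantity $\frac1{T^2}\sum_{t,t'=1}^T\mathbb{E}[\upsilon_t(C)\upsilon_{t'}(C)]$ is finite, uniformly in $T$, where $\nu_T:=T^{-1/2}+\lambda_TT^{-1}a_T+\gamma_TT^{-1}b_T$, $a_T:=\mathrm{card}(\mathcal{A})\cdot\max_{k\in\mathcal{S}}\max_{i\in\mathcal{A}_k}\alpha^{(k)}_{T,i}$, $b_T:=\mathrm{card}(\mathcal{A})\cdot\max_{l\in\mathcal{S}}\xi_{T,l}$. If $\lambda_TT^{-1/2}\to0$, $\gamma_TT^{-1/2}\to0$,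 $T^{(\eta-1)/2}\lambda_T\to\infty$ and $T^{(\mu-1)/2}\gamma_T\to\infty$, then the adaptive Sparse Group LASSO estimator $\hat\theta$ satisfies $$\lim_{T\to\infty}\mathbb{P}(\hat{\mathcal{A}}=\mathcal{A})=1,\qquad\text{and}\qquad\sqrt{T}(\hat\theta_{\mathcal{A}}-\theta_{0,\mathcal{A}})\overset{d}{\longrightarrow}\mathcal{N}\big(0,\mathbb{H}_{\mathcal{A}\mathcal{A}}^{-1}\mathbb{M}_{\mathcal{A}\mathcal{A}}\mathbb{H}_{\mathcal{A}\mathcal{A}}^{-1}\big).$$
   Context: Setting. $(\epsilon_t)$ is a process in $\mathbb{R}^N$ and $\theta\in\Theta\subset\mathbb{R}^d$ with $d$ fixed. The coordinates $\{1,\dots,d\}$ are partitioned into $m$ non-overlapping groups $\mathcal{G}_1,\dots,\mathcal{G}_m$ with $\mathrm{card}(\mathcal{G}_k)=c_k$, $\sum_k c_k=d$; $\theta^{(k)}=(\theta^{(k)}_i)_{i=1,\dots,c_k}$ is the subvector of $\theta$ on group $k$. $l$ is a known loss function with $\theta\mapsto l(\epsilon_t;\theta)$ convex, and $\mathbb{G}_T l(\theta)=\frac1T\sum_{t=1}^T l(\epsilon_t;\theta)$. The map $\theta\mapsto\mathbb{E}[l(\epsilon_t;\theta)]$ is one-to-one and is minimized uniquely at the true parameter $\theta_0$. $\mathcal{A}=\{j:\theta_{0,j}\ne0\}$ is the true active set, $\hat{\mathcal{A}}=\{j:\hat\theta_j\ne0\}$, $\mathcal{S}=\{k:\theta_0^{(k)}\ne0\}$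 is the set of active groups, and $\mathcal{A}_k=\{(k,i):\theta_{0,i}^{(k)}\ne0\}$ is the set of active indices in group $k$. Subscripts $\mathcal{A}$, $\mathcal{A}\mathcal{A}$ denote restriction of vectors and matrices to the indices in $\mathcal{A}$. The adaptive Sparse Group LASSO estimator is $$\hat\theta=\underset{\theta\in\Theta}{\arg\min}\Big\{\mathbb{G}_Tl(\theta)+\frac{\lambda_T}{T}\sum_{k=1}^m\sum_{i=1}^{c_k}\alpha^{(k)}_{T,i}|\theta^{(k)}_i|+\frac{\gamma_T}{T}\sum_{l=1}^m\xi_{T,l}\|\theta^{(l)}\|_2\Big\},$$ with random weights $\alpha^{(k)}_{T,i}=|\tilde\theta^{(k)}_i|^{-\eta}$ and $\xi_{T,l}=\|\tilde\theta^{(l)}\|_2^{-\mu}$ for constants $\eta>0$, $\mu>0$, where $\tilde\theta$ is a first-step estimator that is $T^{1/2}$-consistent for $\theta_0$ (for instance $\tilde\theta=\arg\min_{\theta\in\Theta}\mathbb{G}_Tl(\theta)$), and $\lambda_T,\gamma_T\ge0$ are tuning parameters varying with $T$.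
   Formalization: The true parameter θ0 is assumed to be an interior point of Θ; without this the claim fails, e.g. Θ=[1,∞), l=(ε−θ)²/2, θ0=1, where √T(θ̂−θ0)≥0 cannot be asymptotically normal. *)

(* Defs.v *)
From HB Require Import structures.
From mathcomp Require Import all_boot all_order all_algebra.
From mathcomp Require Import all_classical all_reals all_analysis.

Set Implicit Arguments.
Unset Strict Implicit.
Unset Printing Implicit Defensive.

Import Order.TTheory GRing.Theory Num.Theory.
Import numFieldNormedType.Exports.

Local Open Scope classical_set_scope.
Local Open Scope ring_scope.

Section Calculus.
Context {R : realType} {d : nat}.
Implicit Types (f : 'rV[R]_d -> R) (D : set 'rV[R]_d).

(* The library norm on ['rV_d] is the sup norm; this is the Euclidean norm of
   the subvector of [v] indexed by [B]. *)
Definition l2norm (B : {set 'I_d}) (v : 'rV[R]_d) : R :=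
  Num.sqrt (\sum_(i in B) v 0 i ^+ 2).

Definition partials f (s : seq 'I_d) : 'rV[R]_d -> R :=
  foldr (fun i g => 'D_(delta_mx 0 i) g) f s.

(* [D] need not be open: as usual, smoothness on [D] means smoothness on some
   open set containing [D]. *)
Definition smooth_on D f : Prop :=
  exists U : set 'rV[R]_d, [/\ open U, D `<=` U &
    forall (s : seq 'I_d) (x : 'rV[R]_d), U x ->
      {for x, continuous (partials f s)} /\
      forall i : 'I_d, derivable (partials f s) x (delta_mx 0 i)].

Definition strictly_convex_on D f : Prop :=
  forall (x y : 'rV[R]_d) (t : R), D x -> D y -> x != y -> 0 < t < 1 ->
    f (t *: x + (1 - t) *: y) < t * f x + (1 - t) * f y.

Definition is_argmin_on D (f : 'rV[R]_d -> \bar R) (x : 'rV[R]_d) : Prop :=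
  D x /\ forall y, D y -> (f x <= f y)%E.

Definition posdefmx (M : 'M[R]_d) : Prop :=
  forall u : 'rV[R]_d, u != 0 -> 0 < (u *m M *m u^T) 0 0.

Definition supp (v : 'rV[R]_d) : {set 'I_d} := [set i | v 0 i != 0]%SET.

End Calculus.

Section Restriction.
Context {R : realType} {d : nat}.

Definition subvec (A : {set 'I_d}) (v : 'rV[R]_d) : 'rV[R]_#|A| :=
  colsub enum_val v.

Definition submx_on (A : {set 'I_d}) (M : 'M[R]_d) : 'M[R]_#|A| :=
  mxsub enum_val enum_val M.

End Restriction.

Definition is_grouping (d m : nat) (G : 'I_m -> {set 'I_d}) : Prop :=
  [/\ forall k, G k != finset.set0,
      forall k l i, i \in G k -> i \in G l -> k = l &
      forall i, exists k, i \in G k].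

Section Processes.
Context {dO : measure_display} {Omega : measurableType dO} {R : realType}.
Variable P : probability Omega R.

(* The sigma-algebra of the path space, generated by the coordinates. *)
Definition path_sigma {dE} {E : measurableType dE} : set (set (nat -> E)) :=
  <<s [set B | exists (t : nat) (A : set E),
         measurable A /\ B = [set x : nat -> E | A (x t)]] >>.

Definition strictly_stationary {dE} {E : measurableType dE}
    (X : nat -> Omega -> E) : Prop :=
  forall (h : nat) (B : set (nat -> E)), path_sigma B ->
    P [set w | B (fun t => X (t + h)%N w)] = P [set w | B (fun t => X t w)].

Definition ergodic {dE} {E : measurableType dE} (X : nat -> Omega -> E) : Prop :=
  forall B : set (nat -> E), path_sigma B ->
    (forall x : nat -> E, B (fun t => x t.+1) <-> B x) ->
    P [set w | B (fun t => X t w)] = 0%E \/ P [set w | B (fun t => X t w)] = 1%E.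

Definition filtration (F : nat -> set (set Omega)) : Prop :=
  [/\ forall t, sigma_algebra setT (F t),
      forall t, F t `<=` measurable &
      forall s t, (s <= t)%N -> F s `<=` F t].

Definition adapted {dE} {E : measurableType dE} (F : nat -> set (set Omega))
    (X : nat -> Omega -> E) : Prop :=
  forall t (A : set E), measurable A -> F t (X t @^-1` A).

(* The last clause says that the conditional expectation of [X t.+1] given
   [F t] vanishes. *)
Definition martingale_difference (F : nat -> set (set Omega))
    (X : nat -> Omega -> R) : Prop :=
  [/\ adapted (E := measurableTypeR R) F X,
      forall t, P.-integrable setT (EFin \o X t) &
      forall t (B : set Omega), F t B ->
        (\int[P]_(w in B) (X t.+1 w)%:E = 0)%E].

Definition square_integrable (X : Omega -> R) : Prop :=
  measurable_fun setT X /\ P.-integrable setT (fun w => (X w ^+ 2)%:E).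

Definition random_vector {d} (X : Omega -> 'rV[R]_d) : Prop :=
  forall i, measurable_fun setT (fun w => X w 0 i).

Definition root_consistent {d} (X : nat -> Omega -> 'rV[R]_d)
    (x0 : 'rV[R]_d) : Prop :=
  forall e : R, 0 < e -> exists M : R, \forall T \near \oo,
    (P [set w | (M < Num.sqrt T%:R * l2norm finset.setT (X T w - x0))%R]
       <= e%:E)%E.

End Processes.

Section Gaussian.
Context {R : realType}.

Definition rv_of_tuple k (x : k.-tuple R) : 'rV[R]_k := \row_i tnth x i.

(* The library's [normal_prob] takes the standard deviation, and is not a point
   mass when it vanishes. *)
Definition centered_normal (v : R) : set (measurableTypeR R) -> \bar R :=
  if v == 0 then \d_(0 : measurableTypeR R) else normal_prob 0 (Num.sqrt v).

(* Every linear functional [x |-> <a, x>] is normal with variance [a V a^T]. *)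
Definition is_centered_gaussian k (V : 'M[R]_k)
    (Q : probability (k.-tuple (measurableTypeR R)) R) : Prop :=
  forall (a : 'rV[R]_k) (B : set (measurableTypeR R)), measurable B ->
    Q [set x | B ((a *m (rv_of_tuple x)^T) 0 0)] =
    centered_normal ((a *m V *m a^T) 0 0) B.

Definition cvg_in_law {dO : measure_display} {Omega : measurableType dO}
    (P : probability Omega R) k (X : nat -> Omega -> 'rV[R]_k)
    (Q : probability (k.-tuple (measurableTypeR R)) R) : Prop :=
  forall f : 'rV[R]_k -> R, continuous f ->
    (exists M, forall x, `|f x| <= M) ->
    (\int[P]_w (f (X T w))%:E)%E @[T --> \oo] -->
    (\int[Q]_x (f (rv_of_tuple x))%:E)%E.

Definition cvg_in_law_to_normal {dO : measure_display}
    {Omega : measurableType dO} (P : probability Omega R) k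
    (X : nat -> Omega -> 'rV[R]_k) (V : 'M[R]_k) : Prop :=
  exists Q : probability (k.-tuple (measurableTypeR R)) R,
    is_centered_gaussian V Q /\ cvg_in_law P X Q.

End Gaussian.

Section SparseGroupLasso.
Context {R : realType} {E : Type} {d m : nat}.
Variables (G : 'I_m -> {set 'I_d}) (loss : E -> 'rV[R]_d -> R).
Variables (eta mu : R) (lambda gamma : nat -> R).

Definition empirical_loss (T : nat) (x : nat -> E) (theta : 'rV[R]_d) : R :=
  T%:R^-1 * \sum_(1 <= t < T.+1) loss (x t) theta.

(* Inverses are taken in [\bar R], where [0^-1 = +oo] and [+oo * 0 = 0]: a zero
   first-step coordinate (group) forces that coordinate (group) to zero. The
   real power [0 `^ (- eta)] of the library would instead be [0]. *)
Definition alpha (tt : 'rV[R]_d) (i : 'I_d) : \bar R :=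
  (((`|tt 0 i| `^ eta)%:E)^-1)%E.

Definition xi (tt : 'rV[R]_d) (k : 'I_m) : \bar R :=
  (((l2norm (G k) tt `^ mu)%:E)^-1)%E.

(* [x] is the observed path and [tt] the first-step estimate. *)
Definition sgl_objective (T : nat) (x : nat -> E) (tt theta : 'rV[R]_d) :
    \bar R :=
  ((empirical_loss T x theta)%:E
   + (lambda T / T%:R)%:E
     * (\sum_(k < m) \sum_(i in G k) alpha tt i * `|theta 0 i|%:E)
   + (gamma T / T%:R)%:E
     * (\sum_(k < m) xi tt k * (l2norm (G k) theta)%:E))%E.

Definition active_groups (theta0 : 'rV[R]_d) : {set 'I_m} :=
  [set k | [exists i in G k, theta0 0 i != 0]]%SET.

Definition a_bound (theta0 tt : 'rV[R]_d) : \bar R :=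
  (#|supp theta0|%:R%:E
   * \big[maxe/0]_(k in active_groups theta0)
       \big[maxe/0]_(i in (G k :&: supp theta0)%SET) alpha tt i)%E.

Definition b_bound (theta0 tt : 'rV[R]_d) : \bar R :=
  (#|supp theta0|%:R%:E
   * \big[maxe/0]_(k in active_groups theta0) xi tt k)%E.

Definition nu (T : nat) (theta0 tt : 'rV[R]_d) : \bar R :=
  (((Num.sqrt T%:R)^-1)%:E
   + (lambda T / T%:R)%:E * a_bound theta0 tt
   + (gamma T / T%:R)%:E * b_bound theta0 tt)%E.

(* The loss is only considered on [Theta], hence so are its derivatives. *)
Definition upsilon (Theta : set 'rV[R]_d) (theta0 : 'rV[R]_d) (C : R) (T : nat)
    (tt : 'rV[R]_d) (e : E) : \bar R :=
  \big[maxe/0%E]_(s : 3.-tuple 'I_d)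
    ereal_sup [set (`|partials (loss e) s theta|)%:E | theta in
      [set theta | Theta theta /\
         ((l2norm finset.setT (theta - theta0))%:E
            <= nu T theta0 tt * C%:E)%E]].

End SparseGroupLasso.

(* Main.v *)
(* Put [n = sqrt T] and [u = n (hat theta - theta_0)]. On an event of probability
   close to 1 the normalized score [s] is bounded, the empirical Hessian is close
   to [H], and the third derivatives are bounded on average over a ball of radius
   [R0 / n], so that [n] times the empirical gradient at [theta_0 + v / n] is
   [s + v H] up to a small error, uniformly in [|v| <= R0]. By convexity the
   minimizer lies in that ball: on its boundary the loss has grown by more than
   the [o(1) |v|] that the penalty can gain on the true support. If
   [hat theta_i <> 0] while [theta_(0,i) = 0], then the weight of coordinate [i],
   which is at least of order [T^((eta - 1)/2) lambda_T] after multiplication by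
   [n], exceeds the gradient, and setting that coordinate to zero lowers the
   objective. On the active coordinates, moving [hat theta] by [+- delta / n]
   gives [s_A + u_A H_AA -> 0] in probability.

   It remains to prove a central limit theorem for [s]. Each linear combination
   is a normalized sum of stationary ergodic martingale differences, and
   [E (exp(Q/2) cos(S + phi))], where [Q] is the truncated quadratic variation of
   [S], is nearly constant along the sum, while [Q] tends to the variance by the
   ergodic theorem. Convergence of the characteristic functions, in the real form
   [E cos(<a, X> + b)], gives convergence in law because Fejer sums approximate
   continuous functions on cubes by bounded trigonometric polynomials. *)
From HB Require Import structures.
Require Import Defs.
From mathcomp Require Import all_boot all_order all_algebra.
From mathcomp Require Import all_classical all_reals all_analysis.
From mathcomp Require Import measurable_realfun ring lra.

Set Implicit Arguments.
Unset Strict Implicit.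
Unset Printing Implicit Defensive.

Import Order.TTheory GRing.Theory Num.Theory.
Import numFieldNormedType.Exports.

Local Open Scope classical_set_scope.
Local Open Scope ring_scope.

(** * Partial derivatives *)

(** The analysis of the estimator is deterministic: it treats one path and one pair of estimates
    under explicit inequalities, and probability only shows that these inequalities hold outside a
    measurable set of small probability. The events themselves force this form: the argmin property
    and the suprema of third derivatives over balls need not be measurable. Derivatives are
    controlled only near [theta0], whereas the minimizer may lie anywhere in [Theta]; convexity is
    what brings it back. Optimality is exploited by comparing the minimizer with explicit
    competitors ([theta0], one coordinate set to zero, one active coordinate moved), the loss being
    compared through the gradient inequality for convex functions. In the central limit theorem the
    factor [exp(Q/2)] compensates the quadratic term of the cosine, and truncating and stopping [Q]
    keeps that factor bounded, so that second moments suffice. The phase in [cos(<a, X> + phi)]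
    carries the sine along, which keeps everything real. *)

Section Calculus.
Context {R : realType} {d : nat}.
Implicit Types (f : 'rV[R]_d -> R) (x y v : 'rV[R]_d).

Local Notation e_ i := (delta_mx 0 i : 'rV[R]_d).

Lemma coord_le_norm v i : `|v 0 i| <= `|v|.
Proof.
rewrite [leRHS]/Num.Def.normr /= mx_normrE.
by apply: (@le_bigmax _ _ _ 0 (fun ij : 'I_1 * 'I_d => `|v ij.1 ij.2|) (0, i)).
Qed.

Lemma rv_norm_le v (r : R) : 0 <= r -> (forall i, `|v 0 i| <= r) -> `|v| <= r.
Proof.
move=> r0 H; rewrite [leLHS]/Num.Def.normr /= mx_normrE.
by apply/bigmax_leP; split => // -[i j] _ /=; rewrite ord1.
Qed.

Lemma rv_norm_lt v (r : R) : 0 < r -> (forall i, `|v 0 i| < r) -> `|v| < r.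
Proof.
move=> r0 H; rewrite [ltLHS]/Num.Def.normr /= mx_normrE.
by apply/bigmax_ltP; split => // -[i j] _ /=; rewrite ord1.
Qed.

Lemma derivable_lineE f x v (s : R) :
  derivable f (x + s *: v) v ->
  is_derive s (1 : R) (fun s => f (x + s *: v)) ('D_v f (x + s *: v)).
Proof.
move=> df.
have E : (fun h : R => h^-1 *: (((fun s => f (x + s *: v)) \o shift s) (h *: 1) - f (x + s *: v)))
  = (fun h : R => h^-1 *: ((f \o shift (x + s *: v)) (h *: v) - f (x + s *: v))).
  apply/funext => h /=; congr (_ *: (f _ - _)).
  by rewrite /shift /= /GRing.scale /= mulr1 -/(GRing.scale _ _) scalerDl addrCA [in RHS]addrC; rewrite addrC -!addrA; congr (_ + _); rewrite addrC.
apply: DeriveDef; first by rewrite /derivable E.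
by rewrite /derive E.
Qed.

(** The intermediate point is given as a fraction [c] of [h], so that later uses need not
    distinguish the sign of [h]. *)
Lemma coord_MVT f x i (h : R) :
  (forall c, 0 <= c <= 1 -> derivable f (x + (c * h) *: e_ i) (e_ i)) ->
  exists2 c, 0 <= c <= 1 &
    f (x + h *: e_ i) - f x = h * 'D_(e_ i) f (x + (c * h) *: e_ i).
Proof.
move=> df; pose g := fun s : R => f (x + s *: e_ i).
pose dg := fun s : R => 'D_(e_ i) f (x + s *: e_ i).
have [h0|h0|h0] := ltgtP h 0.
- have dgP (s : R) : s \in `[h, 0]%R -> is_derive s 1 g (dg s).
    rewrite in_itv /= => /andP[hs s0].
    apply: derivable_lineE; rewrite -[s](@divfK _ h) ?lt_eqF//.
    by apply: df; rewrite ler_ndivlMr// ler_ndivrMr// mul0r mul1r s0.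
  have cg : {within `[h, 0], continuous g}.
    by apply: derivable_within_continuous => s /dgP [].
  have dgo (s : R) : s \in `]h, 0[%R -> is_derive s 1 g (dg s).
    by move=> sh; apply: dgP; apply: subset_itv_oo_cc sh.
  have [c] := MVT_segment (ltW h0) dgo cg.
  rewrite in_itv /= => /andP[hc c0] E.
  exists (c / h); first by rewrite ler_ndivlMr// ler_ndivrMr// mul0r mul1r c0.
  rewrite divfK ?lt_eqF//; apply: oppr_inj; rewrite opprB.
  by move: E; rewrite /g /dg scale0r addr0 sub0r mulrN mulrC.
- have dgP (s : R) : s \in `[0, h]%R -> is_derive s 1 g (dg s).
    rewrite in_itv /= => /andP[s0 sh].
    apply: derivable_lineE; rewrite -[s](@divfK _ h) ?gt_eqF//.
    by apply: df; rewrite ler_pdivlMr// ler_pdivrMr// mul0r mul1r s0.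
  have cg : {within `[0, h], continuous g}.
    by apply: derivable_within_continuous => s /dgP [].
  have dgo (s : R) : s \in `]0, h[%R -> is_derive s 1 g (dg s).
    by move=> sh; apply: dgP; apply: subset_itv_oo_cc sh.
  have [c] := MVT_segment (ltW h0) dgo cg.
  rewrite in_itv /= => /andP[c0 hc] E.
  exists (c / h); first by rewrite ler_pdivlMr// ler_pdivrMr// mul0r mul1r c0.
  rewrite divfK ?gt_eqF//.
  by move: E; rewrite /g /dg scale0r addr0 subr0 mulrC.
- exists 0; first by rewrite lexx ler01.
  by rewrite h0 scale0r addr0 subrr mul0r.
Qed.

(** The corners of the path from [0] to [v] that follows the coordinate axes in turn. *)
Definition trunc_rv v (k : nat) : 'rV[R]_d :=
  \row_i (if (i < k)%N then v 0 i else 0).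

Lemma trunc_rv0 v : trunc_rv v 0 = 0.
Proof. by apply/rowP => i; rewrite !mxE ltn0. Qed.

Lemma trunc_rv_full v : trunc_rv v d = v.
Proof. by apply/rowP => i; rewrite !mxE ltn_ord. Qed.

Lemma trunc_rvS v (k : 'I_d) : trunc_rv v k.+1 = trunc_rv v k + v 0 k *: e_ k.
Proof.
apply/rowP => i; rewrite !mxE eqxx /= ltnS leq_eqVlt.
have [->|ik] := eqVneq i k; first by rewrite eqxx ltnn /= mulr1 add0r.
by rewrite -(inj_eq val_inj) in ik; rewrite (negbTE ik) mulr0 addr0.
Qed.

(** Only partial derivatives are given, so [x + v] is reached along the axes, with one mean value
    point per edge. In the sup norm no point of this path is farther from [x] than [|v|], hence [f]
    is derivable along all of it. *)
Lemma telescope_MVT f x v (r : R) :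
  (forall y i, `|y - x| <= r -> derivable f y (e_ i)) -> `|v| <= r ->
  exists2 z : 'I_d -> 'rV[R]_d, forall k, `|z k - x| <= `|v| &
    f (x + v) - f x = \sum_k v 0 k * 'D_(e_ k) f (z k).
Proof.
move=> df vr.
have H (k : 'I_d) : exists z : 'rV[R]_d, `|z - x| <= `|v| /\
    f (x + trunc_rv v k.+1) - f (x + trunc_rv v k) = v 0 k * 'D_(e_ k) f z.
  have B c : 0 <= c <= 1 ->
      `|x + trunc_rv v k + (c * v 0 k) *: e_ k - x| <= `|v|.
    move=> /andP[c0 c1]; rewrite addrAC (addrC x) addrK.
    apply: rv_norm_le => // i; rewrite !mxE eqxx /=.
    have [->|ik] := eqVneq i k.
      rewrite ltnn add0r mulr1 normrM (ger0_norm c0).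
      by apply: le_trans (coord_le_norm v k); rewrite ler_piMl.
    rewrite mulr0 addr0; case: ifP => _; first exact: coord_le_norm.
    by rewrite normr0.
  have [|c c01 E] := @coord_MVT f (x + trunc_rv v k) k (v 0 k).
    by move=> c c01; apply: df; apply: le_trans (B _ c01) vr.
  exists (x + trunc_rv v k + (c * v 0 k) *: e_ k); split; first exact: B.
  by rewrite trunc_rvS addrA.
have [z zP] := choice H.
exists z => [k|]; first by have [] := zP k.
rewrite -{1}(trunc_rv_full v) -{2}(addr0 x) -(trunc_rv0 v).
rewrite -(telescope_sumr (fun k => f (x + trunc_rv v k))) // big_mkord.
by apply: eq_bigr => k _; have [_] := zP k.
Qed.

Lemma mvt_sum_bound (v w : 'I_d -> R) (b c : R) : 0 <= b ->
  (forall k, `|v k| <= b) -> (forall k, `|w k| <= c) ->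
  `|\sum_k v k * w k| <= d%:R * (b * c).
Proof.
move=> b0 vb wc; apply: le_trans (ler_norm_sum _ _ _) _.
rewrite -[d in leRHS]card_ord -sumr_const mulr_suml; apply: ler_sum => k _.
by rewrite mul1r normrM ler_pM.
Qed.

(** [telescope_MVT] is applied to [f], and then to each partial derivative between [x] and its mean
    value point; the two passes produce [d ^ 2]. *)
Lemma taylor1_bound f x v (r B : R) : `|v| <= r ->
  (forall y k, `|y - x| <= r -> derivable f y (e_ k)) ->
  (forall y k l, `|y - x| <= r -> derivable ('D_(e_ k) f) y (e_ l)) ->
  (forall y k l, `|y - x| <= r -> `|'D_(e_ l) ('D_(e_ k) f) y| <= B) ->
  `|f (x + v) - f x - \sum_k v 0 k * 'D_(e_ k) f x|
    <= d%:R ^+ 2 * `|v| ^+ 2 * B.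
Proof.
move=> vr df ddf bB.
have [|z zv ->] := @telescope_MVT f x v r _ vr.
  by move=> y i yr; exact: df.
rewrite -sumrB.
under eq_bigr do rewrite -mulrBr.
have -> : d%:R ^+ 2 * `|v| ^+ 2 * B = d%:R * (`|v| * (d%:R * (`|v| * B))) by ring.
apply: mvt_sum_bound => // k; first exact: coord_le_norm.
have wv : `|z k - x| <= r by apply: le_trans (zv k) vr.
have [|z' z'v] := @telescope_MVT ('D_(e_ k) f) x (z k - x) r _ wv.
  by move=> y i yr; exact: ddf.
rewrite [x + _]addrC subrK => ->.
apply: mvt_sum_bound => // l; first exact: le_trans (coord_le_norm _ _) (zv k).
by apply: bB; apply: le_trans (z'v l) wv.
Qed.

Lemma dist_lt_half (a b c c' e : R) : c = c' ->
  `|c - a| < e / 2 -> `|c' - b| < e / 2 -> `|a - b| <= e.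
Proof.
move=> <-; rewrite !ltr_norml => /andP[a1 a2] /andP[b1 b2].
by rewrite ler_norml; apply/andP; split; lra.
Qed.

Lemma continuous_for_dist f x (e : R) : {for x, continuous f} -> 0 < e ->
  exists2 del : R, 0 < del & forall t, `|t - x| < del -> `|f t - f x| < e.
Proof.
move=> /cvgrPdist_lt cf e0; have := cf _ e0 => /nbhs_ballP[del /= del0 H].
exists del => // t xt; rewrite distrC; apply: H.
by rewrite mx_norm_ball /ball_ /= distrC.
Qed.

(** Convexity on the segment bounds the slope of [f] at a short step [s] towards [y] by [f y - f x].
    For small [s] the mean value points are close to [x], where the partial derivatives are
    continuous. *)
Lemma convex_gradient_ineq f x y (r : R) : 0 < r ->
  (forall t, 0 < t < 1 -> f (t *: y + (1 - t) *: x) <= t * f y + (1 - t) * f x) ->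
  (forall z i, `|z - x| <= r -> derivable f z (e_ i)) ->
  (forall i, {for x, continuous ('D_(e_ i) f)}) ->
  \sum_i (y - x) 0 i * 'D_(e_ i) f x <= f y - f x.
Proof.
move=> r0 cvx df cf; set v := y - x.
apply/ler_addgt0Pr => e e0.
pose e' := e / (d%:R * `|v| + 1).
have den0 : 0 < d%:R * `|v| + 1 by rewrite ltr_wpDl// mulr_ge0.
have e'0 : 0 < e' by rewrite divr_gt0.
have Hi i : \forall z \near x, `|'D_(e_ i) f z - 'D_(e_ i) f x| < e'.
  move: (cf i) => /cvgrPdist_lt /(_ _ e'0).
  by apply: filterS => z; rewrite distrC.
have : \forall z \near x, forall i, `|'D_(e_ i) f z - 'D_(e_ i) f x| < e'.
  exact: (filter_forall _ Hi).
move=> /nbhs_ballP[del /= del0 Hdel].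
(* Keeps [s *: v] inside both balls; dividing by [|v| + 1] covers [v = 0]. *)
pose s := Num.min (1/2) (Num.min r (del / 2) / (`|v| + 1)).
have v1 : 0 < `|v| + 1 by rewrite ltr_wpDl.
have s0 : 0 < s.
  by rewrite lt_min divr_gt0//= divr_gt0// lt_min r0 divr_gt0.
have s1 : s < 1 by rewrite gt_min; apply/orP; left; lra.
have sv : `|s *: v| <= Num.min r (del / 2).
  rewrite normrZ gtr0_norm//.
  have : s <= Num.min r (del / 2) / (`|v| + 1) by rewrite /s ge_min lexx orbT.
  rewrite ler_pdivlMr// => h; apply: le_trans h.
  by rewrite ler_wpM2l ?(ltW s0)// lerDl.
move: sv; rewrite le_min => /andP[svr svd].
have [|z zv E] := @telescope_MVT f x (s *: v) r _ svr.
  by move=> z i zr; exact: df.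
have := cvx s; rewrite s0 s1 => /(_ isT).
have -> : s *: y + (1 - s) *: x = x + s *: v.
  by rewrite /v scalerBr scalerBl scale1r addrCA.
move=> c1.
have c2 : f (x + s *: v) - f x <= s * (f y - f x) by move: c1; lra.
rewrite E in c2.
have Hz k : `|'D_(e_ k) f (z k) - 'D_(e_ k) f x| <= e'.
  apply/ltW/Hdel; rewrite mx_norm_ball /ball_ /= distrC.
  apply: le_lt_trans (zv k) _; apply: le_lt_trans svd _.
  by rewrite ltr_pdivrMr// ltr_pMr// ltr1n.
have b1 : `|\sum_k v 0 k * ('D_(e_ k) f (z k) - 'D_(e_ k) f x)| <= e.
  apply: le_trans (_ : d%:R * (`|v| * e') <= _).
    by apply: mvt_sum_bound => // k; exact: coord_le_norm.
  rewrite mulrA /e' mulrA ler_pdivrMr// mulrC ler_wpM2l ?(ltW e0)//.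
  by rewrite lerDl.
have : \sum_k (s *: v) 0 k * 'D_(e_ k) f (z k) =
   s * (\sum_k v 0 k * 'D_(e_ k) f x + \sum_k v 0 k * ('D_(e_ k) f (z k) - 'D_(e_ k) f x)).
  rewrite -big_split mulr_sumr /=; apply: eq_bigr => k _.
  by rewrite !mxE; ring.
move=> E2; move: c2; rewrite E2 ler_pM2l// => c2.
move: b1; rewrite ler_norml => /andP[b1 b2]; lra.
Qed.

Lemma derivable_translate f a x v : derivable f (x + a) v ->
  derivable (fun y => f (y + a)) x v.
Proof.
rewrite /derivable (_ : (fun h => _ *: (((fun y => f (y + a)) \o _) _ - _)) =
  (fun h => h^-1 *: ((f \o shift (x + a)) (h *: v) - f (x + a))))//.
by apply/funext => h /=; rewrite addrA.
Qed.

Lemma derive_translate f a x v : 'D_v (fun y => f (y + a)) x = 'D_v f (x + a).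
Proof.
rewrite /derive (_ : (fun h => _ *: (((fun y => f (y + a)) \o _) _ - _)) =
  (fun h => h^-1 *: ((f \o shift (x + a)) (h *: v) - f (x + a))))//.
by apply/funext => h /=; rewrite addrA.
Qed.

Lemma norm_e_le (c : R) i : `|c *: e_ i| <= `|c|.
Proof.
apply: rv_norm_le => // k; rewrite !mxE eqxx /=.
by case: eqP => _; rewrite ?mulr1 ?mulr0 ?normr0.
Qed.

(** The second difference over a square of side [h] is the increment in direction [i] of
    [y |-> f (y + h e_j) - f y]; one mean value in direction [i] and one in direction [j] turn it
    into a mixed derivative. *)
Lemma mixed_difference f x (r h : R) i j :
  0 < h -> h + h <= r ->
  (forall y k, `|y - x| <= r -> derivable f y (e_ k)) ->
  (forall y k l, `|y - x| <= r -> derivable ('D_(e_ k) f) y (e_ l)) ->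
  exists2 z, `|z - x| <= h + h &
    f (x + h *: e_ i + h *: e_ j) - f (x + h *: e_ i) - (f (x + h *: e_ j) - f x)
    = h * h * 'D_(e_ j) ('D_(e_ i) f) z.
Proof.
move=> h0 hr df ddf.
have hc c : 0 <= c <= 1 -> `|c * h| <= h.
  move=> /andP[c0 c1]; rewrite normrM (ger0_norm c0) (gtr0_norm h0).
  by rewrite ler_piMl// ltW.
pose g := fun y => f (y + h *: e_ j) - f y.
have b1 c k : 0 <= c <= 1 -> `|x + (c * h) *: e_ k - x| <= h.
  by move=> c01; rewrite [x + _]addrC addrK; apply: le_trans (norm_e_le _ _) (hc _ c01).
have b2 c c' k l : 0 <= c <= 1 -> 0 <= c' <= 1 ->
    `|x + (c * h) *: e_ k + (c' * h) *: e_ l - x| <= h + h.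
  move=> c01 c'01; rewrite -(addrA x) (addrC x) addrK.
  apply: le_trans (ler_normD _ _) _.
  by apply: lerD; apply: le_trans (norm_e_le _ _) (hc _ _).
have i1 : 0 <= (1 : R) <= 1 by rewrite ler01 lexx.
have dg c : 0 <= c <= 1 -> derivable g (x + (c * h) *: e_ i) (e_ i).
  move=> c01; apply: derivableB.
    apply: derivable_translate; apply: df.
    by rewrite -[X in X *: e_ j]mul1r; apply: le_trans hr; exact: b2.
  by apply: df; apply: le_trans (b1 _ _ c01) _; lra.
have [c c01] := coord_MVT dg.
rewrite /g deriveB; first last.
- by apply: df; apply: le_trans (b1 _ _ c01) _; lra.
- apply: derivable_translate; apply: df.
  by rewrite -[X in X *: e_ j]mul1r; apply: le_trans hr; exact: b2.
rewrite derive_translate.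
have [|c' c'01 ->] := @coord_MVT ('D_(e_ i) f) (x + (c * h) *: e_ i) j h.
  by move=> c' c'01; apply: ddf; apply: le_trans hr; exact: b2.
move=> E; exists (x + (c * h) *: e_ i + (c' * h) *: e_ j); first exact: b2.
by move: E => /= ->; rewrite mulrA.
Qed.

(** The second difference is symmetric in [i] and [j], so the two mixed derivatives take a common
    value at points within [2 h] of [x], and continuity carries this to [x]. The symmetry of the
    Hessian, which [posdefmx] does not include, comes from here. *)
Lemma mixed_partials_commute f x (r : R) i j : 0 < r ->
  (forall y k, `|y - x| <= r -> derivable f y (e_ k)) ->
  (forall y k l, `|y - x| <= r -> derivable ('D_(e_ k) f) y (e_ l)) ->
  {for x, continuous ('D_(e_ j) ('D_(e_ i) f))} ->
  {for x, continuous ('D_(e_ i) ('D_(e_ j) f))} ->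
  'D_(e_ j) ('D_(e_ i) f) x = 'D_(e_ i) ('D_(e_ j) f) x.
Proof.
move=> r0 df ddf cij cji.
apply/eqP; rewrite -subr_eq0 -normr_le0; apply/ler_addgt0Pr => e e0.
rewrite add0r.
have e2 : 0 < e / 2 by rewrite divr_gt0.
have [d1 d10 H1] := continuous_for_dist cij e2.
have [d2 d20 H2] := continuous_for_dist cji e2.
pose del := Num.min d1 d2.
have del0 : 0 < del by rewrite lt_min d10.
pose h := Num.min r del / 4.
have m0 : 0 < Num.min r del by rewrite lt_min r0.
have h0 : 0 < h by rewrite divr_gt0.
have hr : h + h <= r.
  by have := ge_min r r del; rewrite lexx /= /h => hh; lra.
have hd : h + h < del.
  by have := ge_min del r del; rewrite lexx orbT /= /h => hh; lra.
have [z zh Ez] := @mixed_difference f x r h i j h0 hr df ddf.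
have [z' z'h Ez'] := @mixed_difference f x r h j i h0 hr df ddf.
have E : 'D_(e_ j) ('D_(e_ i) f) z = 'D_(e_ i) ('D_(e_ j) f) z'.
  apply: (@mulfI _ (h * h)); first by rewrite mulf_neq0 ?gt_eqF.
  apply: etrans (esym Ez) (etrans _ Ez'); rewrite [x + h *: e_ j + _]addrAC.
  move: (f _) (f _) (f _) (f _) => p q u w; ring.
have zd : `|z - x| < d1.
  by apply: le_lt_trans zh (lt_le_trans hd _); rewrite ge_min lexx.
have zd' : `|z' - x| < d2.
  by apply: le_lt_trans z'h (lt_le_trans hd _); rewrite ge_min lexx orbT.
exact: (dist_lt_half E (H1 z zd) (H2 z' zd')).
Qed.

End Calculus.

(** * Positive definite matrices *)

Section Matrices.
Context {R : realType}.

(** Elimination of the first coordinate: the Schur complement [S] is again symmetric and positive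
    definite, and induction factors it. *)
Lemma posdef_cholesky n (A : 'M[R]_n) : A^T = A -> posdefmx A ->
  exists2 L : 'M[R]_n, L \in unitmx & A = L *m L^T.
Proof.
elim: n A => [|n IH] A symA pdA.
  exists 1%:M; first exact: unitmx1.
  by apply/matrixP => -[].
rewrite -[n.+1]/(1 + n)%N in A symA pdA *.
pose a := A 0 0; pose b : 'rV[R]_n := ursubmx A; pose C : 'M[R]_n := drsubmx A.
have E11 : ulsubmx A = a%:M.
  by apply/matrixP => i j; rewrite !ord1 !mxE /a eqxx mulr1n; congr (A _ _); apply/val_inj.
have E21 : dlsubmx A = b^T by rewrite /b trmx_ursub symA.
have symC : C^T = C by rewrite /C trmx_drsub symA.
have AE : A = block_mx a%:M b b^T C by rewrite -[LHS]submxK E11 E21.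
have a0 : 0 < a.
  have := pdA (row_mx 1%:M 0); rewrite AE.
  have -> : row_mx 1%:M 0 != 0 :> 'rV[R]_(1 + n).
    apply/eqP => /(congr1 lsubmx); rewrite row_mxKl => /matrixP /(_ 0 0).
    by rewrite !mxE => /eqP; rewrite oner_eq0.
  move=> /(_ isT); rewrite mul_row_block tr_row_mx mul_row_col.
  by rewrite !mul0mx !addr0 mul1mx tr_scalar_mx mulmx1 trmx0 mulmx0 addr0 mxE.
pose S := C - a^-1 *: (b^T *m b).
have symS : S^T = S.
  by rewrite /S linearB /= symC linearZ /= trmx_mul trmxK.
have pdS : posdefmx S.
  (* For given [v] this first coordinate minimizes the form of [A], and the minimum is the form of
     [S] at [v]. *)
  move=> v v0; pose u : 'rV[R]_(1 + n) := row_mx (- (a^-1 *: (v *m b^T))) v.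
  have u0 : u != 0.
    by apply: contraNneq v0 => /(congr1 rsubmx); rewrite row_mxKr => ->; rewrite linear0.
  have := pdA u u0; rewrite AE mul_row_block tr_row_mx mul_row_col.
  have -> : - (a^-1 *: (v *m b^T)) *m a%:M + v *m b^T = 0.
    by rewrite mul_mx_scalar scalerN scalerA divff ?gt_eqF// scale1r addNr.
  rewrite mul0mx add0r; congr (_ < _).
  congr ((_ *m _) _ _); rewrite /S mulmxBr mulNmx addrC; congr (_ - _).
  by rewrite -!scalemxAl -!scalemxAr mulmxA.
have [L uL SE] := IH S symS pdS.
pose r := Num.sqrt a.
have r0 : r != 0 by rewrite gt_eqF// sqrtr_gt0.
have rr : r * r = a by rewrite -expr2 sqr_sqrtr ?ltW.
exists (block_mx r%:M 0 (r^-1 *: b^T) L).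
  rewrite unitmxE det_lblock unitrM det_scalar expr1 unitfE r0.
  by rewrite -unitmxE.
rewrite tr_block_mx mulmx_block AE !trmx0 linearZ /= trmxK tr_scalar_mx.
rewrite !mulmx0 !mul0mx !addr0 -scalar_mxM rr mul_mx_scalar mul_scalar_mx.
rewrite !scalerA divff// !scale1r -scalemxAl -scalemxAr scalerA -invfM rr -SE.
by rewrite /S addrCA subrr addr0.
Qed.

Lemma posdef_unitmx n (A : 'M[R]_n) : posdefmx A -> A \in unitmx.
Proof.
move=> pdA; rewrite -row_free_unit -kermx_eq0; apply/rowV0P => v /sub_kermxP vA.
apply/eqP; apply: contraT => v0.
by have := pdA v v0; rewrite vA mul0mx mxE ltxx.
Qed.

(** With [A = L L^T] the form is the Euclidean square of [v L], and multiplying by [invmx L] bounds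
    [v] in terms of [v L]. *)
Lemma posdef_coercive n (A : 'M[R]_n) : A^T = A -> posdefmx A ->
  exists2 c : R, 0 < c & forall v : 'rV[R]_n, c * `|v| ^+ 2 <= (v *m A *m v^T) 0 0.
Proof.
move=> sA pA; have [L uL AE] := posdef_cholesky sA pA.
pose K := n%:R * `|invmx L| + 1.
have K0 : 0 < K by rewrite ltr_wpDl// mulr_ge0.
exists (K ^- 2); first by rewrite invr_gt0 exprn_gt0.
move=> v; pose w := v *m L.
have -> : (v *m A *m v^T) 0 0 = \sum_k w 0 k ^+ 2.
  rewrite AE mulmxA -mulmxA -trmx_mul mxE; apply: eq_bigr => k _.
  by rewrite !mxE expr2.
have vw : v = w *m invmx L by rewrite mulmxK.
have wn k : w 0 k ^+ 2 <= \sum_k w 0 k ^+ 2.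
  by rewrite (bigD1 k)//= lerDl sumr_ge0 // => i _; rewrite sqr_ge0.
set s := \sum_k _ in wn *.
have s0 : 0 <= s by apply: sumr_ge0 => i _; rewrite sqr_ge0.
have nw : `|w| <= Num.sqrt s.
  apply: rv_norm_le; first exact: sqrtr_ge0.
  by move=> i; rewrite -sqrtr_sqr ler_wsqrtr.
have nv : `|v| <= K * Num.sqrt s.
  apply: le_trans (_ : n%:R * (`|w| * `|invmx L|) <= _).
    rewrite {1}vw; apply: rv_norm_le => [|i]; first by rewrite !mulr_ge0.
    rewrite mxE; apply: mvt_sum_bound => // k; first exact: coord_le_norm.
    rewrite [leRHS]/Num.Def.normr /= mx_normrE.
    exact: (@le_bigmax _ _ _ 0 (fun ij : 'I_n * 'I_n => `|invmx L ij.1 ij.2|) (k, i)).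
  rewrite [`|w| * _]mulrC mulrA /K; apply: ler_pM => //.
  by rewrite lerDl.
rewrite mulrC ler_pdivrMr ?exprn_gt0// mulrC.
rewrite -[s]sqr_sqrtr// -exprMn ler_sqr ?nnegrE ?mulr_ge0 ?sqrtr_ge0 ?(ltW K0)//.
Qed.

(** Extension by zero; [insub] supplies the membership proof that [enum_rank_in] requires. *)
Definition embed d (A : {set 'I_d}) (u : 'rV[R]_#|A|) : 'rV[R]_d :=
  \row_i (if insub i : {? x | x \in A} is Some j
          then u 0 (enum_rank_in (svalP j) (sval j)) else 0).

Lemma embed_enum_val d (A : {set 'I_d}) (u : 'rV[R]_#|A|) k :
  embed u 0 (enum_val k) = u 0 k.
Proof.
rewrite mxE; case: insubP => [j _ jE|]; last by rewrite enum_valP.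
by move: (svalP j); rewrite (_ : sval j = enum_val k)// => p; rewrite enum_valK_in.
Qed.

Lemma embed_out d (A : {set 'I_d}) (u : 'rV[R]_#|A|) i :
  i \notin A -> embed u 0 i = 0.
Proof. by move=> iA; rewrite mxE insubN. Qed.

Lemma sum_enum_val d (A : {set 'I_d}) (F : 'I_d -> R) :
  \sum_(k < #|A|) F (enum_val k) = \sum_(i in A) F i.
Proof. by rewrite [RHS]big_enum_val. Qed.

Lemma sum_embed d (A : {set 'I_d}) (u : 'rV[R]_#|A|) (F : 'I_d -> R) :
  \sum_i embed u 0 i * F i = \sum_k u 0 k * F (enum_val k).
Proof.
rewrite (bigID (mem A)) /= [X in _ + X]big1 ?addr0 => [|i iA]; last first.
  by rewrite embed_out// mul0r.
rewrite -(sum_enum_val _ (fun i => embed u 0 i * F i)).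
by apply: eq_bigr => k _; rewrite embed_enum_val.
Qed.

(** Through this identity positive definiteness descends to submatrices, and the limiting variance
    on the active set becomes that of a linear form of the full score. *)
Lemma embed_quad d (A : {set 'I_d}) (M : 'M[R]_d) (u : 'rV[R]_#|A|) :
  (embed u *m M *m (embed u)^T) 0 0 = (u *m submx_on A M *m u^T) 0 0.
Proof.
rewrite !mxE; transitivity (\sum_j embed u 0 j * (embed u *m M) 0 j).
  by apply: eq_bigr => j _; rewrite mulrC [(embed u)^T _ _]mxE.
rewrite sum_embed; apply: eq_bigr => k _; rewrite mulrC [u^T _ _]mxE; congr (_ * _).
by rewrite !mxE sum_embed; apply: eq_bigr => j _; rewrite !mxE.
Qed.

Lemma posdef_sub d (A : {set 'I_d}) (M : 'M[R]_d) :
  posdefmx M -> posdefmx (submx_on A M).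
Proof.
move=> pM u u0; rewrite -embed_quad; apply: pM.
apply: contraNneq u0 => /rowP E; apply/eqP/rowP => k.
by have := E (enum_val k); rewrite embed_enum_val !mxE.
Qed.

Lemma sub_sym d (A : {set 'I_d}) (M : 'M[R]_d) :
  M^T = M -> (submx_on A M)^T = submx_on A M.
Proof. by move=> sM; apply/matrixP => i j; rewrite !mxE -{1}sM mxE. Qed.

End Matrices.

(** * Expectations and events of high probability *)

Section Expectation.
Context {dO : measure_display} {Omega : measurableType dO} {R : realType}.
Variable P : probability Omega R.
Implicit Types (X Y : Omega -> R).

Definition L1 X := P.-integrable setT (EFin \o X).
Definition Ex X : R := \int[P]_w X w.

Lemma L1_meas X : L1 X -> measurable_fun setT X.
Proof. by move=> /integrableP[/measurable_EFinP]. Qed.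

Lemma L1_le X Y : measurable_fun setT X -> (forall w, `|X w| <= Y w) -> L1 Y -> L1 X.
Proof.
move=> mX XY; apply: le_integrable => //; first exact/measurable_EFinP.
by move=> w _ /=; rewrite lee_fin (le_trans (XY w))// ler_norm.
Qed.

Lemma L1_cst (c : R) : L1 (fun=> c).
Proof. exact: (finite_measure_integrable_cst P c). Qed.

Lemma L1_bounded X (c : R) : measurable_fun setT X -> (forall w, `|X w| <= c) -> L1 X.
Proof. by move=> mX Xc; apply: L1_le mX Xc (L1_cst c). Qed.

Lemma L1D X Y : L1 X -> L1 Y -> L1 (fun w => X w + Y w).
Proof.
by move=> hX hY; exact: (integrableD measurableT hX hY).
Qed.

Lemma L1Z (c : R) X : L1 X -> L1 (fun w => c * X w).
Proof. by move=> hX; exact: (integrableZl measurableT c hX). Qed.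

Lemma L1N X : L1 X -> L1 (fun w => - X w).
Proof. by move=> hX; exact: (integrableN hX). Qed.

Lemma L1B X Y : L1 X -> L1 Y -> L1 (fun w => X w - Y w).
Proof. by move=> hX hY; apply: L1D => //; exact: L1N. Qed.

Lemma L1_norm X : L1 X -> L1 (fun w => `|X w|).
Proof. by move=> hX; apply: integrable_norm hX. Qed.

Lemma L1_sum I (r : seq I) (p : pred I) (X : I -> Omega -> R) :
  (forall i, p i -> L1 (X i)) -> L1 (fun w => \sum_(i <- r | p i) X i w).
Proof.
move=> hX; apply: (eq_integrable measurableT _ _ _ (integrable_sum measurableT r hX)).
by move=> w _; rewrite /= sumEFin.
Qed.

Lemma ExD X Y : L1 X -> L1 Y -> Ex (fun w => X w + Y w) = Ex X + Ex Y.
Proof. by move=> hX hY; rewrite /Ex RintegralD. Qed.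

Lemma ExB X Y : L1 X -> L1 Y -> Ex (fun w => X w - Y w) = Ex X - Ex Y.
Proof. by move=> hX hY; rewrite /Ex RintegralB. Qed.

Lemma ExZ (c : R) X : L1 X -> Ex (fun w => c * X w) = c * Ex X.
Proof. by move=> hX; rewrite /Ex RintegralZl. Qed.

Lemma Ex_cst (c : R) : Ex (fun=> c) = c.
Proof.
rewrite /Ex Rintegral_cst//.
transitivity (c * fine (1%E : \bar R)); last by rewrite mulr1.
by congr (_ * fine _); exact: (@probability_setT _ _ _ P).
Qed.

Lemma Ex_ext X Y : X =1 Y -> Ex X = Ex Y.
Proof. by move=> XY; rewrite /Ex; apply: eq_Rintegral => w _; rewrite XY. Qed.

Lemma Ex_sum I (r : seq I) (p : pred I) (X : I -> Omega -> R) :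
  (forall i, p i -> L1 (X i)) ->
  Ex (fun w => \sum_(i <- r | p i) X i w) = \sum_(i <- r | p i) Ex (X i).
Proof.
move=> hX; elim: r => [|i r IH].
  rewrite big_nil -[RHS](Ex_cst 0); apply: Ex_ext => w; rewrite big_nil //.
rewrite big_cons; under [Ex _]Ex_ext do rewrite big_cons.
case: ifPn => pi; last exact: IH.
by rewrite ExD ?IH//; [exact: hX|exact: L1_sum].
Qed.

Lemma Ex_le X Y : L1 X -> L1 Y -> (forall w, X w <= Y w) -> Ex X <= Ex Y.
Proof. by move=> hX hY XY; rewrite /Ex le_Rintegral. Qed.

Lemma Ex_ge0 X : (forall w, 0 <= X w) -> 0 <= Ex X.
Proof. by move=> X0; apply: Rintegral_ge0. Qed.

Lemma Ex_norm_le X : L1 X -> `|Ex X| <= Ex (fun w => `|X w|).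
Proof. by move=> hX; apply: le_normr_Rintegral. Qed.

Lemma ExE X : L1 X -> (\int[P]_w (X w)%:E)%E = (Ex X)%:E.
Proof. by move=> hX; rewrite /Ex /Rintegral fineK// integrable_fin_num. Qed.

Lemma Ex_dominated_ae (X : nat -> Omega -> R) X0 Y :
  (forall n, measurable_fun setT (X n)) -> measurable_fun setT X0 ->
  {ae P, forall w, X n w @[n --> \oo] --> X0 w} ->
  (forall n w, `|X n w| <= Y w) -> L1 Y ->
  L1 X0 /\ Ex (X n) @[n --> \oo] --> Ex X0.
Proof.
move=> mX mX0 XX0 XY hY.
have hXn n : L1 (X n) by apply: L1_le (mX n) (XY n) hY.
have [|||||] := @dominated_convergence _ _ _ P setT measurableT
   (fun n => EFin \o X n) (EFin \o X0) (EFin \o Y).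
- by move=> n; exact/measurable_EFinP.
- exact/measurable_EFinP.
- by apply: filterS XX0 => w XX0 _; apply/cvg_EFin; [exact: nearW|exact: XX0].
- exact: hY.
- by apply: aeW => w n _; rewrite /= lee_fin.
move=> hX0 _ cvgE; split => //.
have : (Ex (X n))%:E @[n --> \oo] --> (Ex X0)%:E.
  rewrite -ExE//; under eq_fun do rewrite -ExE//.
  exact: cvgE.
by move=> /fine_cvgP[].
Qed.

Lemma Ex_dominated (X : nat -> Omega -> R) X0 Y :
  (forall n, measurable_fun setT (X n)) ->
  (forall w, X n w @[n --> \oo] --> X0 w) ->
  (forall n w, `|X n w| <= Y w) -> L1 Y ->
  L1 X0 /\ Ex (X n) @[n --> \oo] --> Ex X0.
Proof.
move=> mX XX0 XY hY; apply: Ex_dominated_ae XY hY => //; last exact: aeW.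
by apply: (@measurable_fun_cvg _ _ _ _ X) => // w _; exact: XX0.
Qed.

Lemma meas_le X Y : measurable_fun setT X -> measurable_fun setT Y ->
  measurable [set w | X w <= Y w].
Proof.
by move=> mX mY; rewrite -[X in measurable X]setTI; apply: measurable_fun_le.
Qed.

Lemma meas_lt X Y : measurable_fun setT X -> measurable_fun setT Y ->
  measurable [set w | X w < Y w].
Proof.
move=> mX mY; rewrite (_ : mkset _ = ~` [set w | Y w <= X w]).
  by apply: measurableC; exact: meas_le.
by apply/seteqP; split => w /=; rewrite ltNge => /negP.
Qed.

Lemma Ex_indic (A : set Omega) : measurable A -> (Ex (\1_A : Omega -> R))%:E = P A.
Proof.
move=> mA; rewrite -ExE; last exact: integrable_indic.
by rewrite integral_indic// setIT.
Qed.

Lemma markov_real X (c : R) : L1 X -> (forall w, 0 <= X w) -> 0 < c ->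
  (P [set w | (c <= X w)%R] <= (Ex X / c)%:E)%E.
Proof.
move=> hX X0 c0.
have mA : measurable [set w | c <= X w].
  rewrite -[X in measurable X]setTI; apply: measurable_fun_le => //.
  exact: L1_meas.
rewrite -Ex_indic// lee_fin ler_pdivlMr// mulrC -ExZ; last exact: integrable_indic.
apply: Ex_le => // [|w]; first by apply: L1Z; exact: integrable_indic.
rewrite indicE; have [|_] := boolP (w \in _); last by rewrite mulr0.
by rewrite inE mulr1.
Qed.

(** Integrates the pointwise bound [del + M * 1_N]. Expectations of bounded variables are compared
    through it whenever an estimate holds only outside [N]. *)
Lemma Ex_small X (N : set Omega) (del e M : R) :
  measurable_fun setT X -> measurable N -> (P N <= e%:E)%E -> 0 <= del -> 0 <= M ->
  (forall w, `|X w| <= M) -> (forall w, ~ N w -> `|X w| <= del) ->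
  `|Ex X| <= del + M * e.
Proof.
move=> mX mN Ne del0 M0 XM Xdel.
have hX : L1 X by exact: L1_bounded mX XM.
have hN : L1 (\1_N : Omega -> R) by exact: integrable_indic.
apply: le_trans (Ex_norm_le hX) _.
apply: le_trans (_ : Ex (fun w => del + M * \1_N w) <= _).
  apply: Ex_le; first exact: L1_norm.
    by apply: L1D; [exact: L1_cst|exact: L1Z].
  move=> w; rewrite indicE; have [_|] := boolP (w \in N).
    by rewrite mulr1 (le_trans (XM w))// lerDr.
  by rewrite notin_setE => Nw; rewrite mulr0 addr0 Xdel.
rewrite ExD; [|exact: L1_cst|exact: L1Z].
rewrite Ex_cst ExZ// lerD2l ler_wpM2l//.
by rewrite -lee_fin Ex_indic.
Qed.

End Expectation.

Section Mostly.
Context {dO : measure_display} {Omega : measurableType dO} {R : realType}.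
Variable P : probability Omega R.
Implicit Types (S : nat -> set Omega).

(* [S T] need not be measurable: its complement is eventually covered by a
   measurable set of probability at most [e]. *)
Definition mostly (e : R) S := \forall T \near \oo,
  exists N, [/\ measurable N, (P N <= e%:E)%E & forall w, ~ N w -> S T w].

(** Both notions are kept: in a tightness statement the bound depends on [e], which calls for
    [mostly], whereas convergence in probability yields [whp]. *)
Definition whp S := forall e, 0 < e -> mostly e S.

Lemma mostlyS e S S' : (\forall T \near \oo, S T `<=` S' T) -> mostly e S -> mostly e S'.
Proof.
move=> SS'; apply: filterS2 SS' => T h [N [mN Ne NS]].
by exists N; split => // w /NS /h.
Qed.

Lemma mostlyI e e' S S' : mostly e S -> mostly e' S' ->
  mostly (e + e') (fun T => S T `&` S' T).
Proof.
apply: filterS2 => T [N [mN Ne NS]] [N' [mN' Ne' NS']].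
exists (N `|` N'); split; first exact: measurableU.
  rewrite EFinD; apply: le_trans (leeD Ne Ne').
  exact: measureU2.
move=> w /not_orP[nN nN']; split; [exact: NS|exact: NS'].
Qed.

Lemma mostly_le e e' S : e <= e' -> mostly e S -> mostly e' S.
Proof.
move=> ee'; apply: filterS => T [N [mN Ne NS]]; exists N; split => //.
by apply: le_trans Ne _; rewrite lee_fin.
Qed.

Lemma whpS S S' : (\forall T \near \oo, S T `<=` S' T) -> whp S -> whp S'.
Proof. by move=> h hS e e0; apply: mostlyS h (hS e e0). Qed.

Lemma whpI S S' : whp S -> whp S' -> whp (fun T => S T `&` S' T).
Proof.
move=> h h' e e0; have e2 : 0 < e / 2 by rewrite divr_gt0.
by rewrite [e]splitr; apply: mostlyI; [exact: h|exact: h'].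
Qed.

Lemma whp_forall (I : finType) (S : I -> nat -> set Omega) :
  (forall i, whp (S i)) -> whp (fun T => [set w | forall i, S i T w]).
Proof.
move=> h.
suff H (s : seq I) : whp (fun T => [set w | forall i, i \in s -> S i T w]).
  apply: whpS (H (enum I)); apply: nearW => T w Hw i; apply: Hw.
  by rewrite mem_enum.
elim: s => [|i s IH].
  move=> e e0; apply: nearW => T; exists set0; split => //.
  by rewrite measure0 lee_fin ltW.
apply: whpS (whpI (h i) IH); apply: nearW => T w [Si Ss] j.
by rewrite inE => /predU1P[->//|]; exact: Ss.
Qed.

Lemma mostly_forall (I : finType) (S : I -> nat -> set Omega) (e : R) : 0 <= e ->
  (forall i, mostly e (S i)) ->
  mostly (#|I|%:R * e) (fun T => [set w | forall i, S i T w]).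
Proof.
move=> e0 h.
suff H (s : seq I) : mostly ((size s)%:R * e) (fun T => [set w | forall i, i \in s -> S i T w]).
  rewrite cardE; apply: mostlyS (H (enum I)); apply: nearW => T w Hw i; apply: Hw.
  by rewrite mem_enum.
elim: s => [|i s IH].
  apply: nearW => T; exists set0; split => //.
  by rewrite measure0 lee_fin mul0r.
rewrite /= -natr1 mulrDl mul1r addrC.
apply: mostlyS (mostlyI (h i) IH); apply: nearW => T w [Si Ss] j.
by rewrite inE => /predU1P[->//|]; exact: Ss.
Qed.

Lemma whp_cvg_prob S : (forall T, measurable (S T)) -> whp S ->
  P (S T) @[T --> \oo] --> 1%E.
Proof.
move=> mS hS.
have E T : P (S T) = (Ex P (\1_(S T)))%:E by rewrite Ex_indic.
under eq_fun do rewrite E; apply/cvg_EFin; first exact: nearW.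
apply/cvgrPdist_le => e e0.
apply: filterS (hS e e0) => T [N [mN Ne NS]].
have hST : L1 P (\1_(S T) : Omega -> R) by exact: integrable_indic.
rewrite -[X in X - _](Ex_cst P) -ExB//; last exact: L1_cst.
rewrite -[leRHS]add0r -[X in _ + X]mul1r.
apply: (@Ex_small _ _ _ _ _ N) => //.
- by apply: measurable_funB => //; exact: measurable_indic.
- move=> w; rewrite indicE; case: (w \in _); rewrite ?subrr ?normr0//.
  by rewrite subr0 normr1.
- by move=> w /NS Sw; rewrite indicE mem_set// subrr normr0.
Qed.

Lemma cvg_prob0_mostly (A : nat -> set Omega) (e : R) :
  (forall T, measurable (A T)) -> (\forall T \near \oo, (P (A T) <= e%:E)%E) ->
  mostly e (fun T => ~` A T).
Proof.
move=> mA; apply: filterS => T AT; exists (A T); split => //.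
Qed.

End Mostly.

(** * The weak law of large numbers for ergodic processes *)

Section SameLaw.
Context {dO dE : measure_display} {Omega : measurableType dO}
  {E : measurableType dE} {R : realType}.
Variable P : probability Omega R.

Lemma same_law (phi psi : Omega -> E) (h : E -> R) :
  measurable_fun setT phi -> measurable_fun setT psi ->
  (forall A, measurable A -> P (phi @^-1` A) = P (psi @^-1` A)) ->
  measurable_fun setT h -> L1 P (h \o phi) ->
  L1 P (h \o psi) /\ Ex P (h \o psi) = Ex P (h \o phi).
Proof.
move=> mphi mpsi law mh hphi.
have mEh : measurable_fun setT (EFin \o h) by exact/measurable_EFinP.
have mah : measurable_fun setT (abse \o (EFin \o h)) by exact: measurableT_comp.
have H := @ge0_integral_pushforward _ _ _ _ _ psi mpsi P setT _ measurableT mah.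
have H' := @ge0_integral_pushforward _ _ _ _ _ phi mphi P setT _ measurableT mah.
have hpsi : L1 P (h \o psi).
  apply/integrableP; split; first by apply/measurable_EFinP/measurableT_comp.
  move: hphi => /integrableP[_]; apply: le_lt_trans; rewrite le_eqVlt; apply/orP; left.
  have abs0 : {in [set: E], forall y, 0 <= (abse \o (EFin \o h)) y}%E by move=> y _; exact: abse_ge0.
  apply/eqP; apply: etrans (esym (H abs0)) (etrans _ (H' abs0)).
  by apply: eq_measure_integral => A mA _; apply/esym; exact: law.
split => //; rewrite /Ex /Rintegral; congr fine.
have J := @integral_pushforward _ _ _ _ _ psi mpsi P setT _ mEh hpsi measurableT.
have J' := @integral_pushforward _ _ _ _ _ phi mphi P setT _ mEh hphi measurableT.
apply: etrans (esym J) (etrans _ J').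
by apply: eq_measure_integral => A mA _; apply/esym; exact: law.
Qed.

End SameLaw.

Section PathSpace.
Context {dE : measure_display} {E : measurableType dE}.

(** The generator of [path_sigma], named to make path space a measurable type on which functions of
    the whole path can be integrated. *)
Definition path_gen : set (set (nat -> E)) :=
  [set B | exists t A, measurable A /\ B = [set x : nat -> E | A (x t)]].

Definition pathspace := g_sigma_algebraType path_gen.

Lemma measurable_coord t : measurable_fun setT (fun x : pathspace => x t).
Proof.
by move=> _ A mA; rewrite setTI; apply: sub_sigma_algebra; exists t, A.
Qed.

Lemma measurable_to_path d (T : measurableType d) (X : nat -> T -> E) :
  (forall t, measurable_fun setT (X t)) ->
  measurable_fun setT (fun w => (fun t => X t w) : pathspace).
Proof.
move=> mX; apply: (@measurability _ _ T pathspace setT _ path_gen) => //.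
move=> _ [_ [t [A [mA ->]]] <-].
have -> : [set: T] `&` ((fun w => (fun t => X t w) : pathspace) @^-1` [set x | A (x t)])
  = [set: T] `&` X t @^-1` A by [].
exact: mX.
Qed.

End PathSpace.

Section Ergodic.
Context {dO dE : measure_display} {Omega : measurableType dO}
  {E : measurableType dE} {R : realType}.
Variable P : probability Omega R.
Variable X : nat -> Omega -> E.
Hypothesis mX : forall t, measurable_fun setT (X t).
Hypothesis statX : strictly_stationary P X.

Local Notation path0 := (fun w => (fun t => X t w) : @pathspace _ E).
Local Notation path1 := (fun w => (fun t => X (t + 1)%N w) : @pathspace _ E).

Lemma stationary_law s (h : @pathspace _ E -> R) :
  measurable_fun setT h -> L1 P (h \o path0) ->
  L1 P (fun w => h (fun t => X (t + s)%N w)) /\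
  Ex P (fun w => h (fun t => X (t + s)%N w)) = Ex P (h \o path0).
Proof.
move=> mh h0.
have mp0 : measurable_fun setT path0 by exact: measurable_to_path.
have mps : measurable_fun setT (fun w => (fun t => X (t + s)%N w) : @pathspace _ E).
  exact: measurable_to_path.
apply: (same_law mp0 mps) => // A mA.
by apply/esym; exact: statX.
Qed.

Lemma stationary_marginal (h : E -> R) t : measurable_fun setT h ->
  L1 P (h \o X 0%N) -> L1 P (h \o X t) /\ Ex P (h \o X t) = Ex P (h \o X 0%N).
Proof.
move=> mh h0.
have mh' : measurable_fun setT (fun x : @pathspace _ E => h (x 0%N)).
  by apply: measurableT_comp => //; exact: measurable_coord.
by have := stationary_law t mh' h0.
Qed.

Section Maximal.
Variable g : E -> R.
Hypothesis mg : measurable_fun setT g.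

Definition birkhoff_sum n (x : @pathspace _ E) : R := \sum_(k < n) g (x k).
Definition path_shift (x : @pathspace _ E) : @pathspace _ E := fun t => x (t + 1)%N.
(** The running maximum of the partial sums, unfolded at the first term so that
    [M_(n+1) - M_n o shift] is visibly [max (- M_n o shift) (g (x 0))]. *)
Fixpoint birkhoff_max n (x : @pathspace _ E) : R :=
  if n is n'.+1 then Num.max 0 (g (x 0%N) + birkhoff_max n' (path_shift x)) else 0.

Lemma birkhoff_sumS n x : birkhoff_sum n.+1 x = g (x 0%N) + birkhoff_sum n (path_shift x).
Proof.
rewrite /birkhoff_sum big_ord_recl; congr (_ + _).
by apply: eq_bigr => k _; rewrite /path_shift addn1.
Qed.

Lemma birkhoff_max_ge0 n x : 0 <= birkhoff_max n x.
Proof. by case: n => //= n; rewrite le_max lexx. Qed.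

Lemma birkhoff_max_ge n j x : (j <= n)%N -> birkhoff_sum j x <= birkhoff_max n x.
Proof.
elim: n j x => [|n IH] [|j] x //; rewrite ?/birkhoff_sum ?big_ord0 ?birkhoff_max_ge0//.
by move=> jn; rewrite -/(birkhoff_sum _ _) birkhoff_sumS /= le_max lerD2l IH ?orbT.
Qed.

Lemma birkhoff_max_nondecr n x : birkhoff_max n x <= birkhoff_max n.+1 x.
Proof.
elim: n x => [x|n IH x]; first exact: birkhoff_max_ge0.
rewrite [leLHS]/= [leRHS]/= -/(birkhoff_max n.+1 _).
by apply: le_max2; rewrite ?lexx// lerD2l; exact: IH.
Qed.

Lemma birkhoff_max_le n x : birkhoff_max n x <= \sum_(k < n) `|g (x k)|.
Proof.
elim: n x => [|n IH] x; first by rewrite big_ord0.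
rewrite big_ord_recl /= ge_max; apply/andP; split.
  by rewrite addr_ge0// sumr_ge0.
apply: lerD; first exact: ler_norm.
apply: le_trans (IH _) _; apply: ler_sum => k _.
by rewrite /path_shift addn1.
Qed.

Lemma measurable_path_shift : measurable_fun setT path_shift.
Proof.
apply: (measurable_to_path (X := fun t (x : @pathspace _ E) => x (t + 1)%N)) => t.
exact: measurable_coord.
Qed.

Lemma measurable_birkhoff_sum n : measurable_fun setT (birkhoff_sum n).
Proof.
apply: measurable_sum => k; apply: measurableT_comp => //.
exact: measurable_coord.
Qed.

Lemma measurable_birkhoff_max n : measurable_fun setT (birkhoff_max n).
Proof.
elim: n => [|n IH] /=; first exact: measurable_cst.
apply: measurable_maxr => //; apply: measurable_funD.
  by apply: measurableT_comp => //; exact: measurable_coord.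
by apply: measurableT_comp IH _; exact: measurable_path_shift.
Qed.

Definition unbounded_sums : set (@pathspace _ E) :=
  [set x | forall K : nat, exists n, K%:R < birkhoff_sum n x].

Lemma measurable_exceeds (K : nat) :
  measurable [set x : @pathspace _ E | exists n, K%:R < birkhoff_sum n x].
Proof.
rewrite (_ : mkset _ = \bigcup_n [set x | K%:R < birkhoff_sum n x]).
  apply: bigcup_measurable => n _; apply: meas_lt => //.
  exact: measurable_birkhoff_sum.
by apply/seteqP; split => x [n]; [exists n|exists n].
Qed.

Lemma measurable_unbounded_sums : measurable unbounded_sums.
Proof.
rewrite (_ : unbounded_sums = \bigcap_(K : nat) [set x | exists n, K%:R < birkhoff_sum n x]).
  by apply: bigcap_measurable => [|K _]; [exists 0%N|exact: measurable_exceeds].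
by apply/seteqP; split => [x Bx K _|x Bx K]; [exact: Bx|exact: Bx].
Qed.

(** Dropping the first term changes all partial sums by the same amount, which raising the threshold
    by [K0] absorbs. Invariance makes ergodicity applicable to this event. *)
Lemma unbounded_sums_shift x : unbounded_sums (path_shift x) <-> unbounded_sums x.
Proof.
have [K0 K0P] : exists K0 : nat, `|g (x 0%N)| < K0%:R.
  by exists (Num.truncn `|g (x 0%N)|).+1; rewrite truncnS_gt.
split=> Bx K.
  have [n nK] := Bx (K + K0)%N; exists n.+1; rewrite birkhoff_sumS.
  move: nK K0P; rewrite natrD ltr_norml => nK /andP[h1 h2]; lra.
have [[|n] nK] := Bx (K + K0)%N.
  by move: nK; rewrite /birkhoff_sum big_ord0 ltrn0.
exists n; move: nK K0P; rewrite birkhoff_sumS natrD ltr_norml => nK /andP[h1 h2]; lra.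
Qed.

End Maximal.

Hypothesis ergX : ergodic P X.

(* If the partial sums were almost surely unbounded above, then
   [M_(n+1) - M_n o shift], with [M_n] the running maximum, would tend to
   [g (X 0)], while its expectation is nonnegative by stationarity. *)
Lemma sums_tight (g : E -> R) : measurable_fun setT g -> L1 P (g \o X 0%N) ->
  Ex P (g \o X 0%N) < 0 ->
  forall e : R, 0 < e -> exists K : nat,
    (P [set w | exists n, (K%:R < \sum_(k < n) g (X k w))%R] <= e%:E)%E.
Proof.
move=> mg hg Eg0.
have mp0 : measurable_fun setT path0 by exact: measurable_to_path.
have mp1 : measurable_fun setT path1 by exact: measurable_to_path.
have mB : measurable (path0 @^-1` unbounded_sums g).
  by rewrite -[X in measurable X]setTI; apply: mp0 => //; exact: measurable_unbounded_sums.
have hM n : L1 P (birkhoff_max g n \o path0).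
  apply: (@L1_le _ _ _ _ _ (fun w => \sum_(k < n) `|g (X k w)|)).
  - by apply: measurableT_comp => //; exact: measurable_birkhoff_max.
  - by move=> w; rewrite ger0_norm ?birkhoff_max_ge0// birkhoff_max_le.
  - apply: L1_sum => k _; apply: L1_norm.
    by have [] := stationary_marginal k mg hg.
have PB0 : P (path0 @^-1` unbounded_sums g) = 0%E.
  have [||//|PB1] := ergX (B := unbounded_sums g).
  - exact: measurable_unbounded_sums.
  - move=> x; rewrite -(unbounded_sums_shift g x) /path_shift.
    by under [in X in _ <-> X]eq_fun do rewrite addn1.
  exfalso; move: Eg0; apply/negP; rewrite -leNgt.
  pose D n w := Num.max (- birkhoff_max g n (path1 w)) (g (X 0%N w)).
  have DE n w : D n w = birkhoff_max g n.+1 (path0 w) - birkhoff_max g n (path1 w).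
    by rewrite /D [birkhoff_max g n.+1 _]/= addr_maxl sub0r addrK.
  have hD n : 0 <= Ex P (D n).
    have [h1 h2] := stationary_law 1 (measurable_birkhoff_max mg n) (hM n).
    rewrite (Ex_ext P (DE n)) ExB//; last exact: hM n.+1.
    rewrite h2 subr_ge0; apply: Ex_le => [||w]; [exact: hM|exact: hM n.+1|].
    exact: birkhoff_max_nondecr.
  have [|||||_ cvgD] := @Ex_dominated_ae _ _ _ P D (g \o X 0%N) (fun w => `|g (X 0%N w)|).
  - move=> n; apply: measurable_maxr; last exact: measurableT_comp.
    apply: (@measurable_funN _ _ _ _ (fun w => birkhoff_max g n (path1 w))).
    exact: (measurableT_comp (measurable_birkhoff_max mg n) mp1).
  - exact: measurableT_comp.
  - exists (~` (path0 @^-1` unbounded_sums g)); split.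
    + exact: measurableC.
    + by rewrite probability_setC// PB1 subee.
    + apply: subsetC => w Bw0.
      (* Once the shifted maximum exceeds [|g (X 0)|], [D n] is equal to [g (X 0)]. *)
      have Bw : unbounded_sums g (path_shift (path0 w)) by apply/unbounded_sums_shift.
      have [K KP] : exists K : nat, `|g (X 0%N w)| < K%:R.
        by exists (Num.truncn `|g (X 0%N w)|).+1; rewrite truncnS_gt.
      have [n0 n0P] := Bw K.
      apply: cvg_near_cst; exists n0 => // n /= n0n.
      apply/max_idPr; rewrite lerNl.
      have := birkhoff_max_ge g (path1 w) n0n.
      move: n0P KP; rewrite /path_shift ltr_norml => a /andP[b c] a'.
      by apply: le_trans a'; apply: ltW; apply: le_lt_trans a; lra.
  - move=> n w; rewrite /D ler_norml; apply/andP; split.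
      by rewrite le_max [- _ <= g _]lerNl -normrN ler_norm orbT.
    rewrite ge_max ler_norm andbT; apply: le_trans (normr_ge0 _).
    by rewrite oppr_le0 birkhoff_max_ge0.
  - exact: L1_norm.
  by apply: (cvgr_to_ge cvgD); apply: nearW.
move=> e e0.
(* These events decrease to the null set of unbounded sums, so continuity from above provides
   [K]. *)
pose C (K : nat) := [set w | exists n, K%:R < \sum_(k < n) g (X k w)].
have mC K : measurable (C K).
  have -> : C K = [set: Omega] `&` path0 @^-1` [set x | exists n, K%:R < birkhoff_sum g n x].
    by rewrite setTI.
  by apply: mp0 => //; exact: measurable_exceeds.
have capC : \bigcap_K (C K) = path0 @^-1` unbounded_sums g.
  by apply/seteqP; split => [w Bw K|w Bw K _]; exact: Bw.
have mcapC : measurable (\bigcap_K (C K)) by rewrite capC.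
have decC : {homo C : n m / (n <= m)%N >-> (m <= n)%O}.
  move=> n m nm; apply/subsetPset => w [k kP]; exists k.
  by apply: le_lt_trans kP; rewrite ler_nat.
have PC0 : (P (C 0%N) < +oo)%E.
  by apply: le_lt_trans (probability_le1 P (mC 0%N)) _; rewrite ltry.
have : P (C K) @[K --> \oo] --> 0%E.
  by rewrite -PB0 -capC; exact: (nonincreasing_cvg_mu PC0 mC mcapC decC).
move=> /fine_cvgP[] _ /cvgrPdist_le /(_ _ e0) [K _ /(_ K (leqnn _))].
rewrite /= sub0r normrN => KP; exists K.
have finC : P (C K) \is a fin_num by apply: fin_num_measure.
rewrite -(fineK finC) lee_fin; apply: le_trans KP; exact: ler_norm.
Qed.

(** Centring [g] at its mean plus [del / 2] makes the mean negative, so outside a small event all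
    centred sums stay below a fixed [K], and [K / T <= del / 2] for large [T]. *)
Lemma lln_upper (g : E -> R) (del : R) : measurable_fun setT g -> L1 P (g \o X 0%N) ->
  0 < del ->
  whp P (fun T => [set w |
    T%:R^-1 * \sum_(k < T) g (X k w) <= Ex P (g \o X 0%N) + del]).
Proof.
move=> mg hg del0 e e0.
pose m := Ex P (g \o X 0%N) + del / 2.
pose g' x := g x - m.
have mg' : measurable_fun setT g' by apply: measurable_funB.
have hg' : L1 P (g' \o X 0%N) by apply: L1B => //; exact: L1_cst.
have Eg' : Ex P (g' \o X 0%N) < 0.
  by rewrite /g' [Ex _ _]ExB ?Ex_cst//; [rewrite /m; lra|exact: L1_cst].
have [K KP] := sums_tight mg' hg' Eg' e0.
have mp0 : measurable_fun setT path0 by exact: measurable_to_path.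
exists (Num.truncn (K%:R / (del / 2))).+1 => // T /= TK.
have T0 : 0 < T%:R :> R by rewrite ltr0n (leq_trans _ TK).
exists [set w | exists n, K%:R < \sum_(k < n) g' (X k w)]; split => //.
  have -> : [set w | exists n, K%:R < \sum_(k < n) g' (X k w)] =
     [set: Omega] `&` path0 @^-1` [set x | exists n, K%:R < birkhoff_sum g' n x].
    by rewrite setTI.
  by apply: mp0 => //; exact: measurable_exceeds.
move=> w /forallNP /(_ T) /negP; rewrite -leNgt /g' sumrB sumr_const card_ord => h.
rewrite /= mulrC ler_pdivrMr//.
have h2 : K%:R <= del / 2 * T%:R.
  have d2 : 0 < del / 2 by rewrite divr_gt0.
  rewrite mulrC -ler_pdivrMr//; apply: ltW; apply: lt_le_trans (truncnS_gt _) _.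
  by rewrite ler_nat.
by move: h; rewrite lerBlDr -mulr_natr /m => h; apply: le_trans h _; lra.
Qed.

Lemma lln (g : E -> R) (del : R) : measurable_fun setT g -> L1 P (g \o X 0%N) ->
  0 < del ->
  whp P (fun T => [set w |
    `|T%:R^-1 * (\sum_(k < T) g (X k w)) - Ex P (g \o X 0%N)| <= del]).
Proof.
move=> mg hg del0.
have mNg : measurable_fun setT (fun x => - g x).
  exact: (@measurable_funN _ _ _ _ g).
have hNg : L1 P ((fun x => - g x) \o X 0%N) by exact: L1N.
apply: whpS (whpI (lln_upper mg hg del0) (lln_upper mNg hNg del0)).
apply: nearW => T w [/= h1 h2].
have EN : Ex P ((fun x => - g x) \o X 0%N) = - Ex P (g \o X 0%N).
  rewrite -mulN1r -ExZ//; apply: Ex_ext => w' /=; rewrite mulN1r //.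
move: h2; rewrite EN sumrN mulrN => h2.
by rewrite ler_norml; apply/andP; split; lra.
Qed.

End Ergodic.

Section ErgodicShift.
Context {dO dE : measure_display} {Omega : measurableType dO}
  {E : measurableType dE} {R : realType}.
Variable P : probability Omega R.
Variable X : nat -> Omega -> E.
Hypothesis mX : forall t, measurable_fun setT (X t).
Hypothesis statX : strictly_stationary P X.
Hypothesis ergX : ergodic P X.

(** The empirical sums start at [t = 1]; the law is applied to the shifted process, which inherits
    stationarity and ergodicity and has the same mean. *)
Lemma lln1 (g : E -> R) (del : R) : measurable_fun setT g -> L1 P (g \o X 0%N) ->
  0 < del ->
  whp P (fun T => [set w |
    `|T%:R^-1 * (\sum_(1 <= t < T.+1) g (X t w)) - Ex P (g \o X 0%N)| <= del]).
Proof.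
move=> mg hg del0; pose Y t := X t.+1.
have mY t : measurable_fun setT (Y t) by exact: mX.
have statY : strictly_stationary P Y.
  move=> h B pB; rewrite /Y.
  have -> : [set w | B (fun t => X (t + h).+1 w)] = [set w | B (fun t => X (t + h.+1)%N w)].
    by under [in RHS]eq_set => w do under eq_fun do rewrite addnS.
  rewrite statX//.
  have -> : [set w | B (fun t => X t.+1 w)] = [set w | B (fun t => X (t + 1)%N w)].
    by under [in RHS]eq_set => w do under eq_fun do rewrite addn1.
  by rewrite statX.
have ergY : ergodic P Y.
  move=> B pB invB.
  have -> : [set w | B (fun t => Y t w)] = [set w | B (fun t => X t w)].
    by apply/seteqP; split => w /=; rewrite -(invB (fun t => X t w)).
  exact: ergX.
have [hgY EY] := stationary_marginal mX statX 1 mg hg.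
have := lln mY statY ergY mg hgY del0.
apply: whpS; apply: nearW => T w /=.
by rewrite -[Y 0%N]/(X 1%N) EY big_add1 big_mkord.
Qed.

End ErgodicShift.

(** * The martingale central limit theorem *)

Section TrigBounds.
Context {R : realType}.
Implicit Types (x y s : R).

Lemma cos_sin_lipschitz x y : `|cos x - cos y| <= `|x - y| /\ `|sin x - sin y| <= `|x - y|.
Proof.
have H (f df : R -> R) : (forall z : R, is_derive z (1 : R) f (df z)) -> continuous f ->
    (forall z : R, `|df z| <= 1) -> forall a b, a <= b -> `|f a - f b| <= `|a - b|.
  move=> f' cf df1 a b ab.
  have f'' (z : R) : z \in `]a, b[%R -> is_derive z (1 : R) f (df z) by [].
  have cf' : {within `[a, b], continuous f} by exact: continuous_subspaceT.
  have [c _ E] := MVT_segment ab f'' cf'.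
  by rewrite distrC E normrM [`|a - b|]distrC ler_piMl.
have dc (z : R) : is_derive z (1 : R) cos (- sin z) by exact: is_derive_cos.
have ds (z : R) : is_derive z (1 : R) sin (cos z) by exact: is_derive_sin.
have bc (z : R) : `|- sin z| <= 1 by rewrite normrN ler_norml sin_geN1 sin_le1.
have bs (z : R) : `|cos z| <= 1 by rewrite ler_norml cos_geN1 cos_le1.
have Hc := H cos (fun z => - sin z) dc (@continuous_cos R) bc.
have Hs := H sin cos ds (@continuous_sin R) bs.
have [xy|yx] := leP x y; first by split; [exact: Hc|exact: Hs].
by split; rewrite distrC [leRHS]distrC; [apply: Hc|apply: Hs]; exact: ltW.
Qed.

Lemma sin_norm_le y : `|sin y| <= `|y|.
Proof. by have [_] := cos_sin_lipschitz y 0; rewrite sin0 !subr0. Qed.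

Lemma one_minus_cos y : 1 - cos y = 2 * sin (y / 2) ^+ 2.
Proof.
have {1}-> : y = y / 2 + y / 2 by rewrite -splitr.
by rewrite cosD; have := cos2Dsin2 (y / 2); rewrite -!expr2; lra.
Qed.

Lemma one_minus_cos_ge0 y : 0 <= 1 - cos y.
Proof. by rewrite subr_ge0 cos_le1. Qed.

Lemma one_minus_cos_le y : 1 - cos y <= y ^+ 2 / 2.
Proof.
rewrite one_minus_cos.
have : sin (y / 2) ^+ 2 <= (y / 2) ^+ 2.
  by rewrite -[leLHS]real_normK ?num_real// -[leRHS]real_normK ?num_real// ler_sqr ?nnegrE// sin_norm_le.
by rewrite expr_div_n; lra.
Qed.

Lemma sin_taylor y : `|sin y - y| <= `|y| ^+ 3 / 2.
Proof.
have H (a : R) : 0 <= a -> `|sin a - a| <= `|a| ^+ 3 / 2.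
  move=> a0; pose f (z : R) := sin z - z.
  have f' (z : R) : z \in `]0, a[%R -> is_derive z (1 : R) f (cos z - 1).
    by move=> _; apply: is_deriveB.
  have cf : {within `[0, a], continuous f}.
    apply: continuous_subspaceT => z; apply: continuousB; last exact: cvg_id.
    exact: continuous_sin.
  have [c /[!in_itv]/= /andP[c0 ca] E] := MVT_segment a0 f' cf.
  have -> : sin a - a = (cos c - 1) * a.
    by move: E; rewrite /f sin0 !subr0.
  rewrite normrM distrC (ger0_norm (one_minus_cos_ge0 _)) exprS mulrC -mulrA.
  rewrite ler_wpM2l//; apply: le_trans (one_minus_cos_le c) _.
  by rewrite (ger0_norm a0) ler_pM2r// ler_sqr ?nnegrE.
have [|y0] := leP 0 y; first exact: H.
have := H (- y); rewrite sinN normrN -opprD normrN; apply; lra.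
Qed.

(** By the half-angle formula the remainder is [2 (z - sin z) (z + sin z)] with [z = y / 2], which
    reduces it to the sine. *)
Lemma cos_taylor y : `|y| <= 1 -> `|cos y - (1 - y ^+ 2 / 2)| <= `|y| ^+ 3.
Proof.
move=> y1.
have h1 := sin_taylor (y / 2); have h2 := sin_norm_le (y / 2).
have h3 := one_minus_cos y; set z := y / 2 in h1 h2 h3 *.
have -> : cos y - (1 - y ^+ 2 / 2) = 2 * ((z - sin z) * (z + sin z)).
  by rewrite (_ : y = 2 * z) in h3 *; [lra|rewrite /z; field].
have zy : `|y| = 2 * `|z| by rewrite /z normrM normfV normr_nat; field.
rewrite distrC in h1.
have h4 : `|z - sin z| * `|z + sin z| <= (`|z| ^+ 3 / 2) * (`|z| + `|z|).
  apply: ler_pM => //; apply: le_trans (ler_normD _ _) _.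
  by rewrite lerD2l.
rewrite !normrM normr_nat zy exprMn; move: h4.
have z1 : `|z| <= 1 by move: y1; rewrite zy; have := normr_ge0 z; lra.
have z3 : `|z| ^+ 3 * `|z| <= `|z| ^+ 3 by rewrite ler_piMr// exprn_ge0.
have : 0 <= `|z| ^+ 3 by rewrite exprn_ge0.
move: z3; set w := `|z| ^+ 3 => z3 w0.
have -> : w / 2 * (`|z| + `|z|) = w * `|z| by field.
have -> : (2 : R) ^+ 3 = 8 by ring.
lra.
Qed.

(** The upper bound rests on [expR (- x) >= 1 - x], that is [(1 - x) expR x <= 1]. *)
Lemma expR_taylor x : 0 <= x <= 1 / 2 -> 0 <= expR x - 1 - x <= 2 * x ^+ 2.
Proof.
move=> /andP[x0 x1]; apply/andP; split.
  by have := expR_ge1Dx x; lra.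
have h := expR_ge1Dx (- x); rewrite expRN in h.
have e0 := expR_gt0 x.
have h2 : (1 - x) * expR x <= 1 by rewrite -ler_pdivlMr// mul1r.
have : (expR x - 1 - x - 2 * x ^+ 2) * (1 - x) <= 0.
  have -> : (expR x - 1 - x - 2 * x ^+ 2) * (1 - x) =
     (1 - x) * expR x - 1 - x ^+ 2 * (1 - 2 * x) by ring.
  have : 0 <= x ^+ 2 * (1 - 2 * x) by rewrite mulr_ge0 ?sqr_ge0//; lra.
  lra.
rewrite pmulr_lle0; first lra.
lra.
Qed.

(** The cut at 1 keeps [trunc_sq y / 2] in the range of [expR_taylor] and bounds the increments of
    the quadratic variation. *)
Definition trunc_sq y : R := Num.min (y ^+ 2) 1.

Lemma trunc_sq_ge0 y : 0 <= trunc_sq y.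
Proof. by rewrite le_min sqr_ge0 ler01. Qed.

Lemma trunc_sq_le1 y : trunc_sq y <= 1.
Proof. by rewrite ge_min lexx orbT. Qed.

(* One step of [exp(Q/2) cos S], where [Q] is the quadratic variation of [S]:
   the term [- y sin s] has conditional mean zero, the rest is negligible. *)
Lemma mcleish_pointwise s y (del : R) : 0 < del <= 1 ->
  `|expR (trunc_sq y / 2) * cos (s + y) - cos s + y * sin s|
  <= 6 * (del * y ^+ 2 + (if del < `|y| then y ^+ 2 else 0)).
Proof.
move=> /andP[del0 del1].
set e := expR _.
have -> : e * cos (s + y) - cos s + y * sin s =
    cos s * (e * cos y - 1) - sin s * (e * sin y - y) by rewrite cosD; ring.
have T1 : `|cos s * (e * cos y - 1) - sin s * (e * sin y - y)|
    <= `|e * cos y - 1| + `|e * sin y - y|.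
  apply: le_trans (ler_normB _ _) _; rewrite !normrM; apply: lerD.
    by rewrite ler_piMl// ler_norml cos_geN1 cos_le1.
  by rewrite ler_piMl// ler_norml sin_geN1 sin_le1.
apply: le_trans T1 _.
have q0 := trunc_sq_ge0 y; have q1 := trunc_sq_le1 y.
have q2 : 0 <= trunc_sq y / 2 <= 1 / 2 by apply/andP; split; lra.
have /andP[e1 e2] := expR_taylor q2.
rewrite -/e in e1 e2.
have e_le2 : e <= 2.
  have : (trunc_sq y / 2) ^+ 2 <= 1 / 4.
    rewrite expr_div_n; have : trunc_sq y ^+ 2 <= 1 by rewrite expr_le1.
    by rewrite (_ : (2 : R) ^+ 2 = 4); [lra|ring].
  lra.
have e0 : 0 < e by exact: expR_gt0.
have y20 := sqr_ge0 y.
(* For [|y| > 1] the tail term is present, since [del <= 1], and crude bounds suffice. Otherwise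
   nothing is truncated and both differences are of order [|y| ^ 3]. *)
have [y1|y1] := leP `|y| 1; last first.
  have -> : del < `|y| by apply: le_lt_trans y1.
  have n1 : `|e * cos y - 1| <= 3.
    apply: le_trans (ler_normB _ _) _; rewrite normrM gtr0_norm// normr1.
    have : e * `|cos y| <= 2 * 1.
      apply: ler_pM => //; first exact: ltW.
      by rewrite ler_norml cos_geN1 cos_le1.
    lra.
  have n2 : `|e * sin y - y| <= 2 + `|y|.
    apply: le_trans (ler_normB _ _) _; rewrite normrM gtr0_norm// lerD2r.
    rewrite -[leRHS]mulr1; apply: ler_pM; rewrite ?(ltW e0)//.
    by rewrite ler_norml sin_geN1 sin_le1.
  have yy : `|y| <= y ^+ 2.
    by rewrite -[y ^+ 2]real_normK ?num_real// expr2 ler_peMr// ltW.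
  have : 0 <= del * y ^+ 2 by rewrite mulr_ge0// ltW.
  lra.
have qE : trunc_sq y = y ^+ 2.
  by apply/min_idPl; rewrite -[y ^+ 2]real_normK ?num_real// expr_le1.
rewrite qE in e1 e2.
have y2E : `|y| ^+ 2 = y ^+ 2 by rewrite real_normK ?num_real.
have y3 : `|y| ^+ 3 = `|y| * y ^+ 2 by rewrite exprS y2E.
have y4 : y ^+ 2 * y ^+ 2 <= `|y| ^+ 3.
  by rewrite -{1}y2E y3 ler_wpM2r// expr2 ler_piMr.
have y0 := normr_ge0 y.
have c1 := cos_taylor y1; have s1 := sin_taylor y.
have y30 : 0 <= `|y| ^+ 3 by rewrite exprn_ge0.
have y21 : y ^+ 2 <= 1 by rewrite -y2E expr_le1.
have e2' : e <= 1 + y ^+ 2 / 2 + y ^+ 2 * y ^+ 2 / 2.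
  by move: e2; rewrite (_ : 2 * (y ^+ 2 / 2) ^+ 2 = y ^+ 2 * y ^+ 2 / 2); [lra|field].
have m1 : `|e * cos y - 1| <= 3 * `|y| ^+ 3.
  (* The quadratic terms of [e] and of the cosine cancel: [(1 + y^2/2) (1 - y^2/2) = 1 - y^4/4]. *)
  rewrite (_ : e * cos y - 1 = (1 + y ^+ 2 / 2) * (cos y - (1 - y ^+ 2 / 2))
     + (e - 1 - y ^+ 2 / 2) * cos y - y ^+ 2 * y ^+ 2 / 4); last by field.
  apply: le_trans (ler_normB _ _) _.
  have a1 : `|(1 + y ^+ 2 / 2) * (cos y - (1 - y ^+ 2 / 2)) + (e - 1 - y ^+ 2 / 2) * cos y|
      <= 3/2 * `|y| ^+ 3 + y ^+ 2 * y ^+ 2 / 2.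
    apply: le_trans (ler_normD _ _) _; apply: lerD; rewrite normrM.
      by apply: ler_pM => //; rewrite ger0_norm; lra.
    rewrite -[leRHS]mulr1; apply: ler_pM => //.
      by rewrite ger0_norm; lra.
    by rewrite ler_norml cos_geN1 cos_le1.
  have a2 : `|y ^+ 2 * y ^+ 2 / 4| <= `|y| ^+ 3 / 4.
    by rewrite ger0_norm ?ler_pM2r// ?invr_gt0// divr_ge0// mulr_ge0.
  lra.
have m2 : `|e * sin y - y| <= 2 * `|y| ^+ 3.
  rewrite (_ : e * sin y - y = e * (sin y - y) + (e - 1) * y); last by ring.
  apply: le_trans (ler_normD _ _) _; rewrite !normrM (gtr0_norm e0).
  have b1 : e * `|sin y - y| <= 2 * (`|y| ^+ 3 / 2) by apply: ler_pM => //; exact: ltW.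
  have b2 : `|e - 1| * `|y| <= `|y| ^+ 3.
    rewrite y3 mulrC ler_wpM2l// ger0_norm; last lra.
    have : y ^+ 2 * y ^+ 2 <= y ^+ 2 by rewrite ler_piMr.
    lra.
  lra.
apply: le_trans (lerD m1 m2) _.
apply: le_trans (_ : 6 * `|y| ^+ 3 <= _); first lra.
rewrite ler_pM2l// y3; case: ifPn => [_|].
  have : 0 <= del * y ^+ 2 by rewrite mulr_ge0// ltW.
  have : `|y| * y ^+ 2 <= y ^+ 2 by rewrite ler_piMl.
  lra.
by rewrite -leNgt addr0 => yd; rewrite ler_wpM2r.
Qed.

End TrigBounds.

Section Martingale.
Context {dO : measure_display} {Omega : measurableType dO} {R : realType}.
Variable P : probability Omega R.
Variable F : nat -> set (set Omega).
Hypothesis filtF : filtration F.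

(** Stated on the measurable type generated by [F n], so that the closure properties of measurable
    functions apply to it. *)
Definition Fm n (f : Omega -> R) :=
  measurable_fun [set: g_sigma_algebraType (F n)] (f : g_sigma_algebraType (F n) -> R).

Let sF n : sigma_algebra setT (F n). Proof. by have [] := filtF. Qed.

Lemma FmP n f : Fm n f <-> forall A : set R, measurable A -> F n (f @^-1` A).
Proof.
split=> [mf A mA|H _ A mA].
  have := mf measurableT A mA.
  by rewrite setTI measurable_g_measurableTypeE.
by rewrite setTI measurable_g_measurableTypeE//; exact: H.
Qed.

Lemma Fm_le n m f : (n <= m)%N -> Fm n f -> Fm m f.
Proof.
move=> nm /FmP H; apply/FmP => A mA.
by have [_ _ mono] := filtF; exact: (mono n m nm _ (H A mA)).
Qed.

Lemma Fm_meas n f : Fm n f -> measurable_fun setT f.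
Proof.
move=> /FmP H _ A mA; rewrite setTI.
by have [_ sub _] := filtF; exact: (sub n _ (H A mA)).
Qed.

Variable X : nat -> Omega -> R.
Hypothesis mdX : martingale_difference P F X.

Lemma md_L1 t : L1 P (X t). Proof. by have [_ h _] := mdX; exact: h. Qed.

Lemma md_Fm t : Fm t (X t).
Proof. by apply/FmP => A mA; have [h _ _] := mdX; exact: h. Qed.

Lemma md_indic t (B : set Omega) : F t B -> Ex P (fun w => \1_B w * X t.+1 w) = 0.
Proof.
move=> FB; have [_ _ h] := mdX.
have mB : measurable B by have [_ sub _] := filtF; exact: sub FB.
rewrite /Ex /Rintegral -[RHS]/(fine 0%E); congr fine.
rewrite -(h t B FB) [RHS]integral_mkcond; apply: eq_integral => w _.
by rewrite patchE indicE; case: (w \in B); rewrite ?mul1r// mul0r.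
Qed.

(** The sum counts the positive integers up to [z], so it is the integer part. It serves to
    approximate a bounded function uniformly by sums of indicators. *)
Lemma staircase (z : R) (N : nat) : 0 <= z <= N%:R ->
  `|z - \sum_(j < N) (if j.+1%:R <= z then 1 else 0)| <= 1.
Proof.
move=> /andP[z0 zN].
have E : \sum_(j < N) (if j.+1%:R <= z then 1 else 0) = (Num.truncn z)%:R :> R.
  have kN : (Num.truncn z <= N)%N.
    by rewrite -(ler_nat R); apply: le_trans zN; rewrite truncn_le.
  rewrite -big_mkcond /= -[X in _ = X%:R]card_ord -sumr_const (@big_ord_widen R 0 +%R _ N (fun=> 1) kN).
  by apply: eq_bigl => j; rewrite -truncn_ge_nat.
rewrite E; have := truncn_le z; rewrite z0 => b; have := truncnS_gt z; rewrite -natr1 => a.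
by rewrite ger0_norm; lra.
Qed.

(** Orthogonality to indicators of [F t] passes to [Y] through step functions at uniform distance
    [1 / (n + 1)]; the error is at most this distance times [E |X|]. *)
Lemma md_orth t (Y : Omega -> R) (M : R) :
  Fm t Y -> (forall w, `|Y w| <= M) -> Ex P (fun w => Y w * X t.+1 w) = 0.
Proof.
move=> mY YM.
have M0 : 0 <= M by apply: le_trans (YM point).
have hX := md_L1 t.+1.
have step (n : nat) : `|Ex P (fun w => Y w * X t.+1 w)| <= n.+1%:R^-1 * Ex P (fun w => `|X t.+1 w|).
  pose h : R := n.+1%:R^-1; have h0 : 0 < h by rewrite invr_gt0.
  pose N := (Num.truncn ((M + M) / h)).+1.
  have MN : (M + M) / h <= N%:R by exact/ltW/truncnS_gt.
  pose B (j : nat) := [set w | j.+1%:R <= (Y w + M) / h].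
  have FB j : F t (B j).
    rewrite (_ : B j = Y @^-1` `[j.+1%:R * h - M, +oo[%classic).
      by move/FmP: mY; apply; exact: measurable_itv.
    by apply/seteqP; split => w; rewrite /B /= in_itv /= andbT ler_pdivlMr// => ?; lra.
  have mB j : measurable (B j) by have [_ sub _] := filtF; exact: sub (FB j).
  pose Yn w := - M + h * \sum_(j < N) \1_(B j) w.
  have YnE w : `|Y w - Yn w| <= h.
    have z0N : 0 <= (Y w + M) / h <= N%:R.
      have := YM w; rewrite ler_norml => /andP[a b]; apply/andP; split.
        by rewrite divr_ge0 ?(ltW h0)//; lra.
      by apply: le_trans MN; rewrite ler_pM2r ?invr_gt0//; lra.
    have := staircase z0N.
    rewrite (eq_bigr (fun j : 'I_N => \1_(B j) w)); last first.
      move=> j _; rewrite indicE; case: ifPn => Bw; first by rewrite mem_set.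
      by rewrite memNset//; apply/negP.
    move=> H; rewrite /Yn.
    have -> : Y w - (- M + h * \sum_(j < N) \1_(B j) w) =
      h * ((Y w + M) / h - \sum_(j < N) \1_(B j) w) by field; rewrite gt_eqF.
    by rewrite normrM gtr0_norm// ler_piMr// ltW.
  have hB j : L1 P (fun w => \1_(B j) w * X t.+1 w).
    apply: L1_le (L1_norm hX); first by apply: measurable_funM; [exact: measurable_indic|exact: (L1_meas hX)].
    move=> w; rewrite normrM indicE; case: (_ \in _); rewrite ?normr1 ?mul1r// normr0 mul0r//.
  have YnX w : Yn w * X t.+1 w = - M * X t.+1 w + h * \sum_(j < N) (\1_(B j) w * X t.+1 w).
    by rewrite /Yn mulrDl -mulrA mulr_suml.
  have hsum : L1 P (fun w => \sum_(j < N) (\1_(B j) w * X t.+1 w)) by exact: L1_sum.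
  have EX : Ex P (X t.+1) = 0.
    have FT : F t setT.
      by have [s0 sC _] := sF t; have := sC _ s0; rewrite setD0.
    by rewrite -(md_indic FT); apply: Ex_ext => w; rewrite indicT mul1r.
  have EYn : Ex P (fun w => Yn w * X t.+1 w) = 0.
    rewrite (Ex_ext P YnX) ExD; [|exact: L1Z|exact: L1Z].
    rewrite !ExZ// Ex_sum// EX mulr0 add0r big1 ?mulr0// => j _.
    exact: md_indic.
  have hYX : L1 P (fun w => Y w * X t.+1 w).
    apply: L1_le (L1Z M (L1_norm hX)); first by apply: measurable_funM; [exact: (Fm_meas mY)|exact: (L1_meas hX)].
    by move=> w; rewrite normrM ler_wpM2r.
  have hYnX : L1 P (fun w => Yn w * X t.+1 w).
    by rewrite (_ : (fun w => _) = (fun w => - M * X t.+1 w + h * \sum_(j < N) (\1_(B j) w * X t.+1 w))); [apply: L1D; exact: L1Z|exact/funext].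
  rewrite -[X in `|X|]subr0 -EYn -ExB//.
  apply: le_trans (Ex_norm_le (L1B hYX hYnX)) _.
  rewrite -ExZ; last exact: L1_norm.
  apply: Ex_le => [||w]; [exact: L1_norm (L1B hYX hYnX)|exact: L1Z (L1_norm hX)|].
  by rewrite -mulrBl normrM ler_wpM2r.
apply/eqP; rewrite -normr_le0; apply/ler_addgt0Pr => e e0; rewrite add0r.
pose A := Ex P (fun w => `|X t.+1 w|).
have A0 : 0 <= A by apply: Ex_ge0.
apply: le_trans (step (Num.truncn (A / e))) _.
rewrite mulrC ler_pdivrMr// -/A mulrC -ler_pdivrMr//.
exact/ltW/truncnS_gt.
Qed.

(* Truncation extends orthogonality from bounded to integrable products. *)
Lemma md_orth_L1 t (Y : Omega -> R) : Fm t Y ->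
  L1 P (fun w => Y w * X t.+1 w) -> Ex P (fun w => Y w * X t.+1 w) = 0.
Proof.
move=> mY hYX.
pose Yn (n : nat) w := if `|Y w| <= n%:R then Y w else 0.
have mYn n : Fm t (Yn n).
  apply: measurable_fun_ifT => //; apply: measurable_fun_ler => //.
  exact: measurableT_comp.
have YnE n : Ex P (fun w => Yn n w * X t.+1 w) = 0.
  apply: (@md_orth _ _ n%:R) => // w; rewrite /Yn; case: ifPn => //.
  by rewrite normr0.
have [||||_ cvgE] := @Ex_dominated _ _ _ P (fun n w => Yn n w * X t.+1 w)
   (fun w => Y w * X t.+1 w) (fun w => `|Y w * X t.+1 w|).
- by move=> n; by apply: measurable_funM; [exact: (Fm_meas (mYn n))|exact: (L1_meas (md_L1 _))].
- move=> w; apply: cvg_near_cst; exists (Num.truncn `|Y w|).+1 => // n /= nY.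
  rewrite /Yn ifT//; apply: ltW; apply: lt_le_trans (truncnS_gt _) _.
  by rewrite ler_nat.
- move=> n w; rewrite /Yn; case: ifPn => // _.
  by rewrite mul0r normr0.
- exact: L1_norm.
apply/esym; move: cvgE; under eq_fun do rewrite YnE.
by move=> /(cvg_unique _ (cvg_cst 0)) ->.
Qed.

End Martingale.

Section StoppedSums.
Context {dO : measure_display} {Omega : measurableType dO} {R : realType}.
Variable P : probability Omega R.
Variable F : nat -> set (set Omega).
Hypothesis filtF : filtration F.
Variable X : nat -> Omega -> R.
Hypothesis mdX : martingale_difference P F X.
Hypothesis X2 : forall t, L1 P (fun w => X t w ^+ 2).

(** The Lindeberg tail of the square. *)
Definition tail_sq (c : R) t w : R := if c < `|X t w| then X t w ^+ 2 else 0.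

Variables (r K phi : R).
Hypotheses (r0 : 0 < r) (K0 : 0 <= K).

Definition qvar n w : R := \sum_(k < n) trunc_sq (r * X k.+1 w).
Definition psum n w : R := \sum_(k < n) r * X k.+1 w.

(* The stopped processes freeze once the quadratic variation exceeds [K]. *)
Fixpoint qstop n w : R :=
  if n is n'.+1 then qstop n' w + (if qvar n' w <= K then trunc_sq (r * X n w) else 0) else 0.
Fixpoint pstop n w : R :=
  if n is n'.+1 then pstop n' w + (if qvar n' w <= K then r * X n w else 0) else 0.

Lemma qvarS n w : qvar n.+1 w = qvar n w + trunc_sq (r * X n.+1 w).
Proof. by rewrite /qvar big_ord_recr. Qed.

Lemma psumS n w : psum n.+1 w = psum n w + r * X n.+1 w.
Proof. by rewrite /psum big_ord_recr. Qed.

(** [qvar] is nondecreasing in [n], so a final value at most [K] means that nothing was frozen on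
    the way. *)
Lemma stopE n w : qvar n w <= K -> qstop n w = qvar n w /\ pstop n w = psum n w.
Proof.
elim: n => [|n IH] h; first by rewrite /qvar /psum !big_ord0.
rewrite qvarS in h.
have h' : qvar n w <= K by apply: le_trans h; rewrite lerDl trunc_sq_ge0.
by rewrite /= h' qvarS psumS; have [-> ->] := IH h'.
Qed.

(** The level [K] is tested before a term is added, so it can be passed by one increment, which is
    at most 1. *)
Lemma qstop_bounds n w : 0 <= qstop n w <= K + 1.
Proof.
elim: n => [|n /andP[a b]] /=; first by rewrite lexx addr_ge0.
have t0 := trunc_sq_ge0 (r * X n.+1 w); have t1 := trunc_sq_le1 (r * X n.+1 w).
case: ifPn => h; last by rewrite addr0 a.
have [-> _] := stopE h; apply/andP; split; last exact: lerD.
by rewrite addr_ge0// sumr_ge0// => k _; rewrite trunc_sq_ge0.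
Qed.

Lemma Fm_X n k : (k <= n)%N -> Fm F n (X k).
Proof. by move=> kn; apply: (Fm_le filtF kn); exact: (md_Fm filtF mdX). Qed.

Lemma Fm_trunc n k : (k <= n)%N -> Fm F n (fun w => trunc_sq (r * X k w)).
Proof.
move=> kn; apply: measurable_minr => //; apply: measurable_funX.
by apply: measurable_funM => //; exact: Fm_X.
Qed.

Lemma Fm_qvar n k : (k <= n)%N -> Fm F n (qvar k).
Proof.
elim: k => [|k IH] kn.
  rewrite (_ : qvar 0 = cst 0); first exact: measurable_cst.
  by apply/funext => w; rewrite /qvar big_ord0.
rewrite (_ : qvar k.+1 = fun w => qvar k w + trunc_sq (r * X k.+1 w)); last first.
  by apply/funext => w; rewrite qvarS.
by apply: measurable_funD; [exact: IH (ltnW kn)|exact: Fm_trunc].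
Qed.

Lemma Fm_stop n k : (k <= n)%N -> Fm F n (qstop k) /\ Fm F n (pstop k).
Proof.
elim: k => [|k IH] kn; first by split; exact: measurable_cst.
have [IH1 IH2] := IH (ltnW kn).
have mI : measurable_fun [set: g_sigma_algebraType (F n)] (fun w => qvar k w <= K).
  by apply: measurable_fun_ler => //; exact: Fm_qvar (ltnW kn).
split; apply: measurable_funD => //; apply: measurable_fun_ifT => //.
  exact: Fm_trunc.
by apply: measurable_funM => //; exact: Fm_X.
Qed.

Definition zstop n w : R := expR (qstop n w / 2) * cos (pstop n w + phi).

Lemma Fm_cosD (n : nat) (f : Omega -> R) : Fm F n f -> Fm F n (fun w => cos (f w + phi)).
Proof.
move=> mf; apply: (measurableT_comp (continuous_measurable_fun (@continuous_cos R))).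
exact: measurable_funD.
Qed.

Lemma Fm_sinD (n : nat) (f : Omega -> R) : Fm F n f -> Fm F n (fun w => sin (f w + phi)).
Proof.
move=> mf; apply: (measurableT_comp (continuous_measurable_fun (@continuous_sin R))).
exact: measurable_funD.
Qed.

Lemma Fm_expq n : Fm F n (fun w => expR (qstop n w / 2)).
Proof.
have [mq _] := Fm_stop (leqnn n).
by apply: measurableT_comp => //; apply: measurable_funM.
Qed.

Lemma Fm_zstop n : Fm F n (zstop n).
Proof.
have [_ mp] := Fm_stop (leqnn n).
by apply: measurable_funM; [exact: Fm_expq|exact: Fm_cosD].
Qed.

Lemma zstop_bound n w : `|zstop n w| <= expR ((K + 1) / 2).
Proof.
rewrite normrM (gtr0_norm (expR_gt0 _)) -[leRHS]mulr1; apply: ler_pM => //.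
- by have /andP[_ b] := qstop_bounds n w; rewrite ler_expR ler_pM2r.
- by rewrite ler_norml cos_geN1 cos_le1.
Qed.

Lemma L1_zstop n : L1 P (zstop n).
Proof.
by apply: L1_bounded (zstop_bound n); exact: (Fm_meas filtF (Fm_zstop (n:=n))).
Qed.

Variables (del s2 tail : R).
Hypotheses (del01 : 0 < del <= 1).
Hypothesis EX2 : forall t, Ex P (fun w => X t w ^+ 2) = s2.
Hypothesis Etail : forall t, Ex P (tail_sq (del / r) t) = tail.

Lemma L1_tail c t : L1 P (tail_sq c t).
Proof.
have mX : measurable_fun setT (X t) by exact: L1_meas (md_L1 mdX t).
apply: L1_le (X2 t).
  apply: measurable_fun_ifT => //; last exact: measurable_funX.
  by apply: measurable_fun_ltr => //; exact: measurableT_comp.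
by move=> w; rewrite /tail_sq; case: ifPn => _; rewrite ?normr0 ?ger0_norm ?sqr_ge0.
Qed.

(** Whether step [n + 1] is frozen is decided by [qvar n], hence known at time [n]. If it is not
    frozen, [mcleish_pointwise] applies with the prefactor bounded by [expR (K / 2)], and the linear
    term has mean zero by [md_orth]. *)
Lemma zstop_step n :
  `|Ex P (zstop n.+1) - Ex P (zstop n)| <= 6 * expR (K / 2) * r ^+ 2 * (del * s2 + tail).
Proof.
pose I w : bool := qvar n w <= K.
pose Y w : R := if I w then expR (qstop n w / 2) * sin (pstop n w + phi) else 0.
have mI : measurable_fun [set: g_sigma_algebraType (F n)] I.
  by apply: measurable_fun_ler => //; exact: Fm_qvar.
have mY : Fm F n Y.
  have [_ mp] := Fm_stop (leqnn n).
  apply: measurable_fun_ifT => //; apply: measurable_funM; first exact: Fm_expq.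
  exact: Fm_sinD.
have bE w : I w -> expR (qstop n w / 2) <= expR (K / 2).
  by rewrite /I => h; have [-> _] := stopE h; rewrite ler_expR ler_pM2r.
have YM w : `|Y w| <= expR (K / 2).
  rewrite /Y; case: ifPn => [h|_]; last by rewrite normr0 ltW// expR_gt0.
  rewrite normrM (gtr0_norm (expR_gt0 _)) -[leRHS]mulr1; apply: ler_pM => //.
  - exact: bE.
  - by rewrite ler_norml sin_geN1 sin_le1.
have orth := md_orth filtF mdX mY YM.
have hYX : L1 P (fun w => Y w * X n.+1 w).
  apply: L1_le (L1Z (expR (K / 2)) (L1_norm (md_L1 mdX n.+1))).
    by apply: measurable_funM; [exact: (Fm_meas filtF mY)|exact: L1_meas (md_L1 mdX _)].
  by move=> w; rewrite normrM ler_wpM2r.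
(* The increment with its linear term removed: the mean is the same, but this one is pointwise
   small. *)
pose D w := zstop n.+1 w - zstop n w + r * (Y w * X n.+1 w).
have hD : L1 P D by apply: L1D; [apply: L1B; exact: L1_zstop|exact: L1Z].
have ED : Ex P D = Ex P (zstop n.+1) - Ex P (zstop n).
  rewrite /D ExD; [|by apply: L1B; exact: L1_zstop|exact: L1Z].
  by rewrite ExZ// orth mulr0 addr0 ExB//; exact: L1_zstop.
rewrite -ED; apply: le_trans (Ex_norm_le hD) _.
have bD w : `|D w| <= 6 * expR (K / 2) * r ^+ 2 * (del * X n.+1 w ^+ 2 + tail_sq (del / r) n.+1 w).
  have rhs0 : 0 <= 6 * expR (K / 2) * r ^+ 2 * (del * X n.+1 w ^+ 2 + tail_sq (del / r) n.+1 w).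
    have e0 : 0 <= expR (K / 2) by exact: ltW (expR_gt0 _).
    have d0 : 0 <= del by case/andP: del01 => /ltW.
    apply: mulr_ge0; first by rewrite mulr_ge0 ?sqr_ge0// mulr_ge0.
    apply: addr_ge0; first by rewrite mulr_ge0 ?sqr_ge0.
    by rewrite /tail_sq; case: ifP => _; rewrite ?sqr_ge0.
  rewrite /D /zstop /Y /=; case: ifPn => h; rewrite -/(I w) in h *.
    set y := r * X n.+1 w; set s := pstop n w + phi; set a := qstop n w.
    rewrite mulrDl expRD h.
    have -> : expR (a / 2) * expR (trunc_sq y / 2) * cos (pstop n w + y + phi) - expR (a / 2) * cos s
        + r * (expR (a / 2) * sin s * X n.+1 w) =
       expR (a / 2) * (expR (trunc_sq y / 2) * cos (s + y) - cos s + y * sin s).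
      by rewrite (_ : pstop n w + y + phi = s + y) ?/y; [ring|rewrite /s addrAC].
    rewrite normrM (gtr0_norm (expR_gt0 _)).
    have := mcleish_pointwise s y del01.
    have -> : (if del < `|y| then y ^+ 2 else 0) = r ^+ 2 * tail_sq (del / r) n.+1 w.
      rewrite /tail_sq /y normrM (gtr0_norm r0) ltr_pdivrMr// [r * `|_|]mulrC exprMn.
      by case: ifP => _; rewrite ?mulr0.
    move=> m; apply: le_trans (ler_pM _ _ (bE w h) m) _ => //.
    by rewrite /y exprMn le_eqVlt; apply/orP; left; apply/eqP; ring.
  by rewrite (negbTE h) !addr0 subrr mul0r mulr0 addr0 normr0.
apply: le_trans (Ex_le (L1_norm hD) _ bD) _.
  by apply: L1Z; apply: L1D; [exact: L1Z|exact: L1_tail].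
rewrite ExZ ?ExD ?ExZ ?EX2 ?Etail//; [exact: L1Z|exact: L1_tail|].
by apply: L1D; [exact: L1Z|exact: L1_tail].
Qed.

(** Summation of the steps from [zstop 0]. For [r ^ 2 = 1 / n] the bound does not grow with [n]. *)
Lemma zstop_total n :
  `|Ex P (zstop n) - cos phi| <= n%:R * (6 * expR (K / 2) * r ^+ 2 * (del * s2 + tail)).
Proof.
elim: n => [|n IH].
  have -> : Ex P (zstop 0) = cos phi.
    rewrite -[RHS](Ex_cst P); apply: Ex_ext => w.
    by rewrite /zstop /= mul0r expR0 mul1r add0r.
  by rewrite subrr normr0 mul0r.
rewrite -natr1 mulrDl mul1r -(subrKA (Ex P (zstop n))) addrC.
apply: le_trans (ler_normD _ _) _; apply: lerD; last exact: zstop_step.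
by [].
Qed.

End StoppedSums.

Section MartingaleCLT.
Context {dO : measure_display} {Omega : measurableType dO} {R : realType}.
Variable P : probability Omega R.
Variable F : nat -> set (set Omega).
Hypothesis filtF : filtration F.
Variable X : nat -> Omega -> R.
Hypothesis mdX : martingale_difference P F X.
Hypothesis X2 : forall t, L1 P (fun w => X t w ^+ 2).
Variable s2 : R.
Hypothesis EX2 : forall t, Ex P (fun w => X t w ^+ 2) = s2.
Hypothesis Etail : forall c t, Ex P (tail_sq X c t) = Ex P (tail_sq X c 0%N).
Hypothesis llnX2 : forall del : R, 0 < del -> whp P (fun T => [set w |
  `|T%:R^-1 * (\sum_(1 <= t < T.+1) X t w ^+ 2) - s2| <= del]).

Let mX t : measurable_fun setT (X t). Proof. exact: L1_meas (md_L1 mdX t). Qed.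

Let s20 : 0 <= s2. Proof. by rewrite -(EX2 0); apply: Ex_ge0 => w; rewrite sqr_ge0. Qed.

Lemma tail_sq_ge0 c t w : 0 <= tail_sq X c t w.
Proof. by rewrite /tail_sq; case: ifP => _; rewrite ?sqr_ge0. Qed.

Lemma tail_small (e : R) : 0 < e ->
  exists c0 : R, forall c, c0 <= c -> Ex P (tail_sq X c 0%N) <= e.
Proof.
move=> e0.
have L1t c := L1_tail mdX X2 c 0%N.
have [||||_ cvgE] := @Ex_dominated _ _ _ P (fun n => tail_sq X n%:R 0%N)
   (fun=> 0) (fun w => X 0%N w ^+ 2).
- by move=> n; exact: L1_meas (L1t _).
- move=> w; apply: cvg_near_cst; exists (Num.truncn `|X 0%N w|).+1 => // n /= nX.
  rewrite /tail_sq ifF//; apply/negbTE; rewrite -leNgt; apply: ltW.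
  by apply: lt_le_trans (truncnS_gt _) _; rewrite ler_nat.
- move=> n w; rewrite ger0_norm ?tail_sq_ge0// /tail_sq.
  by case: ifP => _; rewrite ?sqr_ge0.
- exact: X2.
move: cvgE; rewrite Ex_cst => /cvgrPdist_le /(_ _ e0) [n _ /(_ n (leqnn _))].
have t0 : 0 <= Ex P (tail_sq X n%:R 0%N) by apply: Ex_ge0 => w; exact: tail_sq_ge0.
rewrite /= sub0r normrN ger0_norm// => h; exists n%:R => c nc; apply: le_trans h.
apply: Ex_le (L1t _) (L1t _) _ => w; rewrite /tail_sq.
case: ifPn => [cX|_]; first by rewrite (le_lt_trans nc cX).
by case: ifP => _; rewrite ?sqr_ge0.
Qed.

(** Truncation acts only where [|X| > sqrt T], so the mean of the loss [U] is at most a Lindeberg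
    tail at level [sqrt T]; the untruncated average is covered by the law of large numbers. *)
Lemma qvar_cvg (del : R) : 0 < del -> whp P (fun T => [set w |
  `|qvar X (Num.sqrt T%:R)^-1 T w - s2| <= del]).
Proof.
move=> del0; have del2 : 0 < del / 2 by rewrite divr_gt0.
pose r T : R := (Num.sqrt T%:R)^-1.
pose U T w : R := \sum_(k < T) ((r T * X k.+1 w) ^+ 2 - trunc_sq (r T * X k.+1 w)).
have U0 T w : 0 <= U T w.
  by apply: sumr_ge0 => k _; rewrite subr_ge0 ge_min lexx.
have hterm (T : nat) (k : 'I_T) : L1 P (fun w => (r T * X k.+1 w) ^+ 2 - trunc_sq (r T * X k.+1 w)).
  apply: L1_le (L1Z (r T ^+ 2) (X2 k.+1)).
    apply: measurable_funB; first by apply: measurable_funX; exact: measurable_funM.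
    by apply: measurable_minr => //; apply: measurable_funX; exact: measurable_funM.
  move=> w; rewrite ger0_norm ?subr_ge0 ?ge_min ?lexx//.
  by rewrite -exprMn lerBlDr lerDl trunc_sq_ge0.
have hU T : L1 P (U T) by exact: L1_sum.
have whpU : whp P (fun T => [set w | U T w < del / 2]).
  move=> e e0; have [c0 c0P] := tail_small (mulr_gt0 e0 del2).
  exists (Num.truncn (`|c0| ^+ 2)).+1 => // T /= Tc.
  have T0 : 0 < T%:R :> R by rewrite ltr0n (leq_trans _ Tc).
  have c0T : c0 <= Num.sqrt T%:R.
    apply: le_trans (ler_norm _) _; rewrite -(ler_sqr (normr_nneg _)) ?nnegrE ?sqrtr_ge0//.
    rewrite sqr_sqrtr ?(ltW T0)//; apply: ltW; apply: lt_le_trans (truncnS_gt _) _.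
    by rewrite ler_nat.
  exists [set w | del / 2 <= U T w]; split.
  - by apply: meas_le => //; exact: L1_meas (hU T).
  - apply: le_trans (markov_real (hU T) (U0 T) del2) _.
    rewrite lee_fin ler_pdivrMr//; apply: le_trans (c0P _ c0T).
    apply: le_trans (_ : \sum_(k < T) (r T ^+ 2 * Ex P (tail_sq X (Num.sqrt T%:R) 0%N)) <= _).
      rewrite /U Ex_sum//; apply: ler_sum => k _.
      rewrite -(Etail _ k.+1) -ExZ; last exact: (L1_tail mdX X2).
      apply: Ex_le => [||w]; [exact: hterm|by apply: L1Z; exact: (L1_tail mdX X2)|].
      rewrite /trunc_sq /tail_sq /r exprMn; have s0 : 0 < Num.sqrt T%:R :> R by rewrite sqrtr_gt0.
      case: ifPn => [_|].
        rewrite lerBlDr lerDl le_min ler01 andbT mulr_ge0 ?sqr_ge0//.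
      rewrite -leNgt mulr0 subr_le0 le_min lexx /= => h.
      by rewrite -exprMn -[leLHS]real_normK ?num_real// expr_le1// normrM gtr0_norm ?invr_gt0// mulrC ler_pdivrMr// mul1r.
    rewrite sumr_const card_ord -mulrnAl /r exprVn sqr_sqrtr ?(ltW T0)//.
    by rewrite -mulr_natl divff ?gt_eqF// mul1r.
  - by move=> w /negP; rewrite -ltNge.
apply: whpS (whpI (llnX2 del2) whpU).
exists 1%N => // T /= T1 w [/= h1 h2].
have T0 : 0 < T%:R :> R by rewrite ltr0n.
have E : qvar X (r T) T w = T%:R^-1 * (\sum_(1 <= t < T.+1) X t w ^+ 2) - U T w.
  rewrite /U sumrB opprB addrCA -[LHS]addr0; congr (_ + _).
  rewrite big_add1 big_mkord mulr_sumr; apply/esym/eqP; rewrite subr_eq0; apply/eqP.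
  by apply: eq_bigr => k _; rewrite exprMn /r exprVn sqr_sqrtr// ltW.
rewrite -/(r T) E; have := U0 T w; move: h1 h2; rewrite !ler_norml => /andP[a b] c d'.
by apply/andP; split; lra.
Qed.

(** On the good event [zstop] is [exp(Q/2) cos(S + phi)] with [Q] near [s2], so [cos(S + phi)] is
    near [exp(- s2 / 2) zstop], while [zstop] has mean close to [cos phi]. The error splits into
    three parts of size [e / 4]. *)
Lemma martingale_clt phi :
  Ex P (fun w => cos ((Num.sqrt T%:R)^-1 * (\sum_(1 <= t < T.+1) X t w) + phi))
    @[T --> \oo] --> expR (- s2 / 2) * cos phi.
Proof.
apply/cvgrPdist_le => e e0.
(* On the good event [Q] is within [del2 <= 1] of [s2], so that no step is frozen there. *)
pose K := s2 + 1.
have K0 : 0 <= K by rewrite addr_ge0.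
pose C := 6 * expR (K / 2).
have C0 : 0 < C by rewrite mulr_gt0 ?expR_gt0.
have C1 : 0 < C * K by rewrite mulr_gt0// /K ltr_wpDl.
have e4 : 0 < e / 4 by rewrite divr_gt0.
(* The total step error is at most [C * (del * s2 + del) = del * (C * K)] once the tail is below
   [del]. *)
pose del := Num.min 1 (e / 4 / (C * K)).
have del0 : 0 < del by rewrite lt_min ltr01 divr_gt0.
have del01 : 0 < del <= 1 by rewrite del0 ge_min lexx.
have delC : C * (del * s2 + del) <= e / 4.
  rewrite (_ : C * _ = del * (C * K)); last by rewrite /K; ring.
  by rewrite -ler_pdivlMr// ge_min lexx orbT.
pose del2 := Num.min 1 (e / 4).
have del20 : 0 < del2 by rewrite lt_min ltr01.
have del21 : del2 <= 1 by rewrite ge_min lexx.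
have del2e : del2 <= e / 4 by rewrite ge_min lexx orbT.
(* A bound, valid everywhere, for the difference of [cos(S + phi)] and [exp(- s2 / 2) zstop]. *)
pose B := 1 + expR ((K + 1) / 2).
have B0 : 0 < B by rewrite addr_gt0 ?expR_gt0.
have eB : 0 < e / 4 / B by rewrite divr_gt0.
have [c0 c0P] := tail_small del0.
have TC : \forall T \near \oo, c0 <= del * Num.sqrt T%:R.
  exists (Num.truncn ((`|c0| / del) ^+ 2)).+1 => // T /= Tc.
  have T0 : 0 < T%:R :> R by rewrite ltr0n (leq_trans _ Tc).
  apply: le_trans (ler_norm _) _; rewrite mulrC -ler_pdivrMr//.
  have cd0 : 0 <= `|c0| / del by rewrite divr_ge0// ltW.
  rewrite -(ler_sqr) ?nnegrE ?sqrtr_ge0//.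
  rewrite sqr_sqrtr ?(ltW T0)//; apply: ltW; apply: lt_le_trans (truncnS_gt _) _.
  by rewrite ler_nat.
have T1 : \forall T \near \oo, (0 < T)%N by exists 1%N.
have := qvar_cvg del20 eB.
apply: filterS3 T1 TC => T T1 TC [N [mN Ne NS]].
have T0 : 0 < T%:R :> R by rewrite ltr0n.
pose r : R := (Num.sqrt T%:R)^-1.
have r0 : 0 < r by rewrite invr_gt0 sqrtr_gt0.
have Tr : T%:R * r ^+ 2 = 1.
  by rewrite /r exprVn sqr_sqrtr ?ltW// divff// gt_eqF.
have Z1 : `|Ex P (zstop X r K phi T) - cos phi| <= e / 4.
  apply: le_trans (zstop_total filtF mdX X2 phi r0 K0 del01 EX2 (Etail _) T) _.
  rewrite (_ : _ * (_ * _) = T%:R * r ^+ 2 * (C * (del * s2 + Ex P (tail_sq X (del / r) 0%N)))); last by rewrite /C; ring.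
  rewrite Tr mul1r; apply: le_trans delC.
  rewrite ler_pM2l// lerD2l; apply: c0P.
  by rewrite /r invrK.
pose S w := cos (r * (\sum_(1 <= t < T.+1) X t w) + phi).
have SE w : S w = cos (psum X r T w + phi).
  by rewrite /S /psum big_add1 big_mkord mulr_sumr.
have mS : measurable_fun setT S.
  apply: (measurableT_comp (continuous_measurable_fun (@continuous_cos R))).
  apply: measurable_funD => //; apply: measurable_funM => //.
  exact: measurable_sum.
have hZ : L1 P (zstop X r K phi T) by apply: (L1_zstop filtF mdX).
have hS : L1 P S.
  by apply: (@L1_bounded _ _ _ _ _ 1) => // w; rewrite ler_norml cos_geN1 cos_le1.
have es1 : expR (- s2 / 2) <= 1 by rewrite -[leRHS]expR0 ler_expR; have := s20; lra.
have e20 := expR_gt0 (- s2 / 2).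
have D1 : `|Ex P (fun w => S w - expR (- s2 / 2) * zstop X r K phi T w)| <= del2 + B * (e / 4 / B).
  apply: (Ex_small _ mN Ne) => //; rewrite ?(ltW del20) ?(ltW B0)//.
  - apply: measurable_funB => //; apply: measurable_funM => //.
    exact: L1_meas hZ.
  - move=> w; apply: le_trans (ler_normB _ _) _; apply: lerD.
      by rewrite ler_norml cos_geN1 cos_le1.
    rewrite normrM (gtr0_norm e20) -[leRHS]mul1r; apply: ler_pM => //.
    exact: zstop_bound.
  - move=> w /NS /=; rewrite -/r => Qw.
    have QK : qvar X r T w <= K by move: Qw; rewrite ler_norml /K => /andP[_ b]; lra.
    have [Eq Ep] := stopE QK.
    rewrite SE /zstop Eq Ep mulrA -expRD -[X in `|X - _|]mul1r -mulrBl normrM.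
    rewrite -[leRHS]mulr1; apply: ler_pM => //; last by rewrite ler_norml cos_geN1 cos_le1.
    rewrite -mulrDl; move: Qw; set q := qvar X r T w; rewrite ler_norml => /andP[a b].
    pose u := (- s2 + q) / 2; rewrite -/u.
    have u1 : u <= del2 / 2 by rewrite /u; lra.
    have u2 : - (del2 / 2) <= u by rewrite /u; lra.
    have [u0|u0] := leP 0 u.
      have u01 : 0 <= u <= 1 / 2 by rewrite u0 /=; lra.
      have /andP[h1 h2] := expR_taylor u01.
      have : u ^+ 2 <= u / 2 by rewrite expr2 ler_wpM2l//; lra.
      rewrite ler_norml; move=> h3; apply/andP; split; lra.
    have h1 := expR_ge1Dx u.
    have h2 : expR u <= 1 by rewrite -[leRHS]expR0 ler_expR ltW.
    rewrite ger0_norm; lra.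
rewrite distrC -[X in X - _](subrK (expR (- s2 / 2) * Ex P (zstop X r K phi T))).
rewrite -addrA -mulrBr; apply: le_trans (ler_normD _ _) _.
have D2 : `|expR (- s2 / 2) * (Ex P (zstop X r K phi T) - cos phi)| <= e / 4.
  rewrite normrM (gtr0_norm e20) -[leRHS]mul1r; apply: ler_pM => //.
move: D1; rewrite ExB//; last exact: L1Z.
rewrite ExZ// (_ : B * (e / 4 / B) = e / 4); last by rewrite mulrC divfK ?gt_eqF.
move=> D1.
apply: le_trans (lerD D1 D2) _; lra.
Qed.

End MartingaleCLT.

(** * Weak convergence and trigonometric polynomials *)

Section Fejer.
Context {R : realType}.
Implicit Types (x y : R).

Fixpoint dirichlet n y : R :=
  if n is n'.+1 then dirichlet n' y + 2 * cos (n%:R * y) else 1.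
(** The unnormalized kernel [sin(n y / 2)^2 / sin(y / 2)^2], a sum of Dirichlet kernels. *)
Fixpoint fejer n y : R :=
  if n is n'.+1 then fejer n' y + dirichlet n' y else 0.

Lemma dirichletE n y : dirichlet n y * (1 - cos y) = cos (n%:R * y) - cos (n.+1%:R * y).
Proof.
elim: n => [|n IH]; first by rewrite /= mul0r cos0 !mul1r.
rewrite [dirichlet _ _]/= mulrDl IH.
have E1 : cos (n.+2%:R * y) = cos (n.+1%:R * y) * cos y - sin (n.+1%:R * y) * sin y.
  by rewrite -cosD -natr1 mulrDl mul1r.
have E2 : cos (n%:R * y) = cos (n.+1%:R * y) * cos y + sin (n.+1%:R * y) * sin y.
  rewrite -[n.+1%:R]natr1 mulrDl mul1r; set u := n%:R * y.
  by rewrite -{1}(addrK y u) cosB.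
by rewrite E1 E2; ring.
Qed.

Lemma fejerE n y : fejer n y * (1 - cos y) = 1 - cos (n%:R * y).
Proof.
elim: n => [|n IH]; first by rewrite /= !mul0r cos0 subrr.
by rewrite [fejer _ _]/= mulrDl IH dirichletE; ring.
Qed.

Lemma fejer_ge0 n y : 0 <= fejer n y.
Proof.
have [cy|cy] := eqVneq (cos y) 1; last first.
  have h : 0 < 1 - cos y by rewrite subr_gt0 lt_neqAle cy cos_le1.
  by rewrite -(pmulr_lge0 _ h) fejerE one_minus_cos_ge0.
(* Here [fejerE] reads [0 = 0]; instead all cosines equal 1 and every term is nonnegative. *)
have sy : sin y = 0.
  by apply/eqP; rewrite -sqrf_eq0 sin2cos2 cy expr1n subrr.
have c1 k : cos (k%:R * y) = 1.
  elim: k => [|k IH]; first by rewrite mul0r cos0.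
  by rewrite -natr1 mulrDl mul1r cosD IH cy sy mulr0 subr0 mulr1.
have d0 k : 0 <= dirichlet k y.
  by elim: k => //= k IH; rewrite c1 mulr1 addr_ge0.
by elim: n => //= n IH; rewrite addr_ge0.
Qed.

Variable N : nat.
Hypothesis N0 : (0 < N)%N.

Definition grid (j : 'I_N) : R := (pi *+ 2) * j%:R / N%:R - pi.

Lemma grid_bound j : `|grid j| <= pi.
Proof.
have N1 : 0 < N%:R :> R by rewrite ltr0n.
have j0 : 0 <= j%:R / N%:R :> R by rewrite divr_ge0.
have j1 : j%:R / N%:R <= 1 :> R by rewrite ler_pdivrMr// mul1r ler_nat ltnW.
rewrite /grid -mulrA; set z := j%:R / N%:R in j0 j1 *.
have p0 := pi_ge0 R; rewrite mulr2n.
have a0 : 0 <= pi * z by rewrite mulr_ge0.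
have a1 : pi * z <= pi by rewrite ler_piMr.
by rewrite ler_norml mulrDl; apply/andP; split; lra.
Qed.

(** Multiplied by [2 sin b] with [b = pi k / N], the sum telescopes to a difference of sines over
    [k] full periods. The condition on [k] puts [b] strictly between [0] and [pi], so [sin b] can be
    cancelled. *)
Lemma sum_cos_grid k x : (0 < k < N)%N -> \sum_j cos (k%:R * (x - grid j)) = 0.
Proof.
move=> /andP[k0 kN].
have N1 : 0 < N%:R :> R by rewrite ltr0n.
pose b : R := pi * k%:R / N%:R.
have b0 : 0 < b by rewrite divr_gt0// mulr_gt0 ?pi_gt0// ltr0n.
have bpi : b < pi.
  by rewrite /b -mulrA gtr_pMr ?pi_gt0// ltr_pdivrMr// mul1r ltr_nat.
have sb : sin b != 0 by rewrite gt_eqF// sin_gt0_pi// b0.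
apply: (@mulfI _ (2 * sin b)); first by rewrite mulf_neq0 ?pnatr_eq0.
rewrite mulr0; pose a : R := k%:R * (x + pi).
pose f (j : nat) := sin (a + b - (b *+ 2) * j%:R).
have fE (j : 'I_N) : 2 * sin b * cos (k%:R * (x - grid j)) = - (f j.+1 - f j).
  have -> : k%:R * (x - grid j) = a - (b *+ 2) * j%:R.
    by rewrite /a /b /grid !mulr2n; field; rewrite gt_eqF.
  set u := a - _.
  have -> : f j = sin (u + b) by rewrite /f addrAC.
  have -> : f j.+1 = sin (u - b).
    by congr sin; rewrite /u -natr1 !mulr2n; ring.
  by rewrite (sinD u b) (sinB u b); ring.
rewrite mulr_sumr (eq_bigr _ (fun j _ => fE j)) sumrN.
rewrite -(big_mkord predT (fun j => f j.+1 - f j)) telescope_sumr//.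
have per (n : nat) (u : R) : sin (u - (pi *+ 2) * n%:R) = sin u.
  elim: n => [|n IH]; first by rewrite mulr0 subr0.
  by rewrite -[RHS]IH -[LHS]sinD2pi -natr1; congr sin; ring.
have -> : f N = f 0%N.
  rewrite /f mulr0 subr0 -[RHS](per k); congr (sin (_ - _)).
  by rewrite /b !mulr2n; field; rewrite gt_eqF.
by rewrite subrr oppr0.
Qed.

Lemma sum_dirichlet_grid n x : (n < N)%N -> \sum_j dirichlet n (x - grid j) = N%:R.
Proof.
elim: n => [|n IH] nN; first by rewrite /= sumr_const card_ord.
by rewrite [LHS]big_split /= IH ?(ltnW nN)// -mulr_sumr sum_cos_grid ?nN// mulr0 addr0.
Qed.

(** All frequencies of the kernel lie below [N], so only its constant term survives summation over
    the grid. The grid thus stands in for an integral. *)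
Lemma sum_fejer_grid n x : (n <= N)%N -> \sum_j fejer n (x - grid j) = n%:R * N%:R.
Proof.
elim: n => [|n IH] nN; first by rewrite /= sumr_const mul0rn mul0r.
by rewrite [LHS]big_split /= IH ?(ltnW nN)// sum_dirichlet_grid// -natr1 mulrDl mul1r.
Qed.

Definition fejer_weight (j : 'I_N) x : R := fejer N (x - grid j) / N%:R ^+ 2.

Lemma fejer_weight_ge0 j x : 0 <= fejer_weight j x.
Proof. by rewrite divr_ge0 ?fejer_ge0// exprn_ge0. Qed.

Lemma sum_fejer_weight x : \sum_j fejer_weight j x = 1.
Proof.
rewrite -mulr_suml sum_fejer_grid// -expr2 divff// expf_neq0// pnatr_eq0.
by rewrite -lt0n.
Qed.

(** [1 - cos] cancels the denominator of the kernel, leaving at most [2 / N ^ 2] per grid point. *)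
Lemma fejer_weight_spread x :
  \sum_j fejer_weight j x * (1 - cos (x - grid j)) <= 2 / N%:R.
Proof.
have N1 : 0 < N%:R :> R by rewrite ltr0n.
apply: le_trans (_ : \sum_(j < N) 2 / N%:R ^+ 2 <= _).
  apply: ler_sum => j _; rewrite mulrAC fejerE ler_pM2r ?invr_gt0 ?exprn_gt0//.
  have := cos_geN1 (N%:R * (x - grid j)); lra.
rewrite sumr_const card_ord -mulr_natl le_eqVlt; apply/orP; left; apply/eqP.
by field; rewrite gt_eqF.
Qed.

End Fejer.

Section TrigPolynomials.
Context {R : realType} {k : nat}.
Implicit Types (a x y : 'rV[R]_k) (p q : 'rV[R]_k -> R).

Definition dotv a x : R := \sum_i a 0 i * x 0 i.

(** The phase [b] makes sines and constants instances of the first rule. *)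
Inductive trig : ('rV[R]_k -> R) -> Prop :=
| trig_cos a b : trig (fun x => cos (dotv a x + b))
| trig_zero : trig (fun=> 0)
| trig_add p q : trig p -> trig q -> trig (fun x => p x + q x)
| trig_scale c p : trig p -> trig (fun x => c * p x).

Lemma trig_eq p q : p =1 q -> trig p -> trig q.
Proof. by move=> /funext ->. Qed.

Lemma dotvDl a a' x : dotv (a + a') x = dotv a x + dotv a' x.
Proof. by rewrite /dotv -big_split; apply: eq_bigr => i _; rewrite mxE mulrDl. Qed.

Lemma dotvZl (c : R) a x : dotv (c *: a) x = c * dotv a x.
Proof. by rewrite /dotv mulr_sumr; apply: eq_bigr => i _; rewrite mxE mulrA. Qed.

Lemma dotv0 x : dotv 0 x = 0.
Proof. by rewrite /dotv big1// => i _; rewrite mxE mul0r. Qed.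

Lemma dotv_delta i x : dotv (delta_mx 0 i) x = x 0 i.
Proof.
rewrite /dotv (bigD1 i)//= mxE !eqxx mul1r big1 ?addr0// => j ji.
by rewrite mxE (negbTE ji) andbF mul0r.
Qed.

Lemma trig_cst (c : R) : trig (fun=> c).
Proof.
apply: trig_eq (trig_scale c (trig_cos 0 0)) => x.
by rewrite dotv0 addr0 cos0 mulr1.
Qed.

Lemma trig_mul p q : trig p -> trig q -> trig (fun x => p x * q x).
Proof.
move=> tp tq; elim: tp => [a b||p1 p2 _ IH1 _ IH2|c p1 _ IH].
- elim: tq => [a' b'||q1 q2 _ IH1 _ IH2|c q1 _ IH].
  + have := trig_scale (1/2) (trig_add (trig_cos (a + a') (b + b'))
       (trig_cos (a - a') (b - b'))).
    apply: trig_eq => x; rewrite -scaleN1r !dotvDl dotvZl.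
    set u := dotv a x; set v := dotv a' x.
    have -> : u + v + (b + b') = (u + b) + (v + b') by ring.
    have -> : u + -1 * v + (b - b') = (u + b) - (v + b') by ring.
    by rewrite (cosD (u + b)) (cosB (u + b)); field.
  + by apply: trig_eq trig_zero => x; rewrite mulr0.
  + by apply: trig_eq (trig_add IH1 IH2) => x; rewrite mulrDr.
  + by apply: trig_eq (trig_scale c IH) => x; rewrite mulrCA.
- by apply: trig_eq trig_zero => x; rewrite mul0r.
- by apply: trig_eq (trig_add IH1 IH2) => x; rewrite mulrDl.
- by apply: trig_eq (trig_scale c IH) => x; rewrite mulrA.
Qed.

Lemma trig_sum (I : Type) (r : seq I) (p : I -> 'rV[R]_k -> R) :
  (forall i, trig (p i)) -> trig (fun x => \sum_(i <- r) p i x).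
Proof.
move=> tp; elim: r => [|i r IH].
  by apply: trig_eq trig_zero => x; rewrite big_nil.
by apply: trig_eq (trig_add (tp i) IH) => x; rewrite big_cons.
Qed.

Lemma trig_prod (I : Type) (r : seq I) (p : I -> 'rV[R]_k -> R) :
  (forall i, trig (p i)) -> trig (fun x => \prod_(i <- r) p i x).
Proof.
move=> tp; elim: r => [|i r IH].
  by apply: trig_eq (trig_cst 1) => x; rewrite big_nil.
by apply: trig_eq (trig_mul (tp i) IH) => x; rewrite big_cons.
Qed.

Lemma trig_fejer n i (c b : R) : trig (fun x => fejer n (c * x 0 i - b)).
Proof.
have cosP m : trig (fun x => cos (m%:R * (c * x 0 i - b))).
  apply: trig_eq (trig_cos ((m%:R * c) *: delta_mx 0 i) (- (m%:R * b))) => x.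
  by rewrite dotvZl dotv_delta; congr cos; ring.
have dirP m : trig (fun x => dirichlet m (c * x 0 i - b)).
  elim: m => [|m IH]; first exact: trig_cst.
  exact: trig_add IH (trig_scale 2 (cosP m.+1)).
elim: n => [|n IH]; first exact: trig_zero.
exact: trig_add IH (dirP n).
Qed.

(** Only [x] is confined to the box: the grid points at which [f] is sampled may lie outside. *)
Lemma uniform_continuity_box (f : 'rV[R]_k -> R) (L e : R) : continuous f -> 0 < e ->
  exists2 del : R, 0 < del &
    forall x y, (forall i, `|x 0 i| <= L) -> `|x - y| < del -> `|f x - f y| <= e.
Proof.
move=> cf e0.
have cptK : compact [set x : 'rV[R]_k | forall i, `[- L, L]%classic (x 0 i)].
  by apply: (@rV_compact R k (fun=> `[- L, L]%classic)) => i; exact: segment_compact.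
have := (compact_near_coveringP _).1 cptK R (0^'+)
  (fun del x => forall y, `|x - y| < del -> `|f x - f y| <= e) _.
case=> [x _|del /= del0 H].
  have e2 : 0 < e / 2 by rewrite divr_gt0.
  have [rho rho0 Hrho] := continuous_for_dist (cf x) e2.
  have rho2 : 0 < rho / 2 by rewrite divr_gt0.
  exists ([set x' | `|x' - x| < rho / 2], [set del : R | del < rho / 2]) => /=.
    split; last exact: nbhs_right_lt.
    apply/nbhs_ballP; exists (rho / 2) => //= z.
    by rewrite mx_norm_ball /ball_ /= distrC.
  move=> [x' del] /= [x'x dd] y x'y.
  have yx : `|y - x| < rho.
    rewrite -(subrKA x') [rho]splitr; apply: le_lt_trans (ler_normD _ _) _.
    by apply: ltrD => //; rewrite distrC; exact: lt_trans dd.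
  have x'x2 : `|x' - x| < rho by apply: lt_trans x'x _; lra.
  have := Hrho _ yx; have := Hrho _ x'x2.
  by rewrite !ltr_norml ler_norml => /andP[? ?] /andP[? ?]; apply/andP; split; lra.
exists (del / 2); first by rewrite divr_gt0.
move=> x y xL xy; apply: (H (del / 2)) => //.
- by rewrite /= sub0r normrN gtr0_norm ?divr_gt0//; lra.
- by rewrite divr_gt0.
- by move=> i; rewrite /= in_itv /= -ler_norml.
Qed.

End TrigPolynomials.

Section TrigApprox.
Context {R : realType} {k : nat}.

(* The approximant is a Fejer-kernel average of the values of [f] on a grid; the
   weights are nonnegative with sum 1, which preserves the global bound. *)
Lemma trig_approx (f : 'rV[R]_k -> R) (M L e : R) :
  continuous f -> (forall x, `|f x| <= M) -> 0 < L -> 0 < e ->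
  exists p : 'rV[R]_k -> R, [/\ trig p, (forall x, `|p x| <= M) &
    forall x : 'rV[R]_k, (forall i, `|x 0 i| <= L) -> `|p x - f x| <= e].
Proof.
move=> cf fM L0 e0.
have M0 : 0 <= M by apply: le_trans (fM 0).
have e2 : 0 < e / 2 by rewrite divr_gt0.
have [del del0 Hdel] := uniform_continuity_box L cf e2.
pose eta := Num.min 1 (del / 2 / L).
have eta0 : 0 < eta by rewrite lt_min ltr01 !divr_gt0.
have eta1 : eta <= 1 by rewrite ge_min lexx.
have etaL : L * eta < del.
  apply: le_lt_trans (_ : del / 2 < _); last lra.
  by rewrite mulrC -ler_pdivlMr// ge_min lexx orbT.
pose c := 1 - cos eta.
have pi2 := pi_ge2 R.
have etapi : eta < pi by lra.
have c0 : 0 < c.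
  rewrite subr_gt0 -[ltRHS]cos0 ltr_cos// in_itv /=; apply/andP; split; lra.
(* [cos] is at most [cos eta] on [eta, pi + 1]: it decreases up to [pi], and
   beyond [pi] it is read off at [2 pi - t]. *)
have cosP t : eta <= `|t| -> `|t| <= pi + 1 -> c <= 1 - cos t.
  move=> t1 t2; rewrite lerD2l lerN2.
  have -> : cos t = cos `|t|.
    by have [t0|t0] := leP 0 t; [rewrite ger0_norm|rewrite ltr0_norm// cosN].
  have [tpi|tpi] := leP `|t| pi.
    move: t1; rewrite le_eqVlt => /predU1P[->//|t1].
    by rewrite ltW// ltr_cos// in_itv /=; apply/andP; split; lra.
  have -> : cos `|t| = cos (pi *+ 2 - `|t|).
    by rewrite -[RHS]cosN opprB -[RHS]cosD2pi addrNK.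
  rewrite le_eqVlt; have [->|ne] := eqVneq eta (pi *+ 2 - `|t|); first by rewrite eqxx.
  rewrite ltr_cos ?in_itv /=; rewrite ?mulr2n in ne *.
  - rewrite orbC lt_neqAle ne /=; lra.
  - by apply/andP; split; lra.
  - by apply/andP; split; lra.
(* Makes the contribution of distant grid points, [k] coordinates with spread [2 / N] each, at most
   [e / 2]. *)
pose N := (Num.truncn ((2 * M / c) * k%:R * 2 / (e / 2))).+1.
have N0 : (0 < N)%N by [].
have N1 : 0 < N%:R :> R by rewrite ltr0n.
have NE : (2 * M / c) * (k%:R * (2 / N%:R)) <= e / 2.
  have : (2 * M / c) * k%:R * 2 / (e / 2) <= N%:R by exact/ltW/truncnS_gt.
  rewrite ler_pdivrMr// => h.
  rewrite !mulrA ler_pdivrMr//; apply: le_trans h _; by rewrite mulrC.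
(* The scaling sends the box to [[-1, 1]], so differences with grid points are at most [pi + 1]; as
   [eta <= 1] and [pi >= 2], this stays [eta] away from the period [2 pi]. *)
pose W (J : {ffun 'I_k -> 'I_N}) (x : 'rV[R]_k) := \prod_i fejer_weight (J i) (L^-1 * x 0 i).
pose pt (J : {ffun 'I_k -> 'I_N}) : 'rV[R]_k := \row_i (L * grid (J i)).
have W0 J x : 0 <= W J x by apply: prodr_ge0 => i _; exact: fejer_weight_ge0.
have W1 x : \sum_J W J x = 1.
  rewrite /W -(bigA_distr_bigA (fun i j => fejer_weight j (L^-1 * x 0 i))).
  by rewrite big1// => i _; exact: sum_fejer_weight.
have Wspread x i0 : \sum_J W J x * (1 - cos (L^-1 * x 0 i0 - grid (J i0))) <= 2 / N%:R.
  pose h (i : 'I_k) (j : 'I_N) := fejer_weight j (L^-1 * x 0 i) *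
     (if i == i0 then 1 - cos (L^-1 * x 0 i - grid j) else 1).
  have -> : \sum_J W J x * (1 - cos (L^-1 * x 0 i0 - grid (J i0))) =
      \sum_(J : {ffun 'I_k -> 'I_N}) \prod_i h i (J i).
    apply: eq_bigr => J _; rewrite /W /h [RHS]big_split /=; congr (_ * _).
    rewrite (bigD1 i0)//= eqxx big1 ?mulr1// => i ii0.
    by rewrite (negbTE ii0).
  rewrite -(bigA_distr_bigA h) (bigD1 i0)//= [X in _ * X]big1 ?mulr1; last first.
    move=> i ii0; rewrite /h (negbTE ii0).
    by under eq_bigr do rewrite mulr1; exact: sum_fejer_weight.
  by rewrite /h eqxx; exact: fejer_weight_spread.
exists (fun x => \sum_J f (pt J) * W J x); split.
- apply: trig_sum => J; apply: trig_scale; apply: trig_prod => i.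
  apply: trig_eq (trig_scale (N%:R ^- 2) (trig_fejer N i L^-1 (grid (J i)))) => x.
  by rewrite /fejer_weight mulrC.
- move=> x; apply: le_trans (ler_norm_sum _ _ _) _.
  rewrite -[leRHS]mulr1 -(W1 x) mulr_sumr; apply: ler_sum => J _.
  by rewrite normrM (ger0_norm (W0 _ _)) ler_wpM2r.
- move=> x xL.
  have -> : \sum_J f (pt J) * W J x - f x = \sum_J W J x * (f (pt J) - f x).
    rewrite -[X in _ - X]mul1r -(W1 x) mulr_suml -sumrB.
    by apply: eq_bigr => J _; rewrite mulrBr mulrC.
  apply: le_trans (ler_norm_sum _ _ _) _.
  pose t (J : {ffun 'I_k -> 'I_N}) i := L^-1 * x 0 i - grid (J i).
  apply: le_trans (_ : \sum_J W J x * (e / 2 + (2 * M / c) * \sum_i (1 - cos (t J i))) <= _).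
    apply: ler_sum => J _; rewrite normrM (ger0_norm (W0 _ _)) ler_wpM2l//.
    have s0 : 0 <= \sum_i (1 - cos (t J i)) by apply: sumr_ge0 => i _; exact: one_minus_cos_ge0.
    have Mc0 : 0 <= 2 * M / c by rewrite divr_ge0 ?mulr_ge0// ltW.
    (* If all coordinates are close, uniform continuity applies; otherwise one of the terms
       [1 - cos] is at least [c] and pays for the crude bound [2 * M]. *)
    have [/forallP tsmall|/forallPn[i ti]] := boolP [forall i, `|t J i| < eta].
      have : `|f x - f (pt J)| <= e / 2.
        apply: Hdel => //; apply: le_lt_trans etaL.
        apply: rv_norm_le => [|i]; first by rewrite mulr_ge0// ltW.
        rewrite !mxE (_ : x 0 i - L * grid (J i) = L * t J i); last first.
          by rewrite /t; field; rewrite gt_eqF.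
        by rewrite normrM (gtr0_norm L0) ler_pM2l// ltW.
      rewrite distrC => h; apply: le_trans h _.
      by rewrite lerDl mulr_ge0.
    rewrite -leNgt in ti.
    have tb : `|t J i| <= pi + 1.
      apply: le_trans (ler_normB _ _) _; rewrite addrC; apply: lerD; first exact: grid_bound.
      by rewrite normrM gtr0_norm ?invr_gt0// mulrC ler_pdivrMr// mul1r.
    have ct := cosP _ ti tb.
    have cs : c <= \sum_i (1 - cos (t J i)).
      apply: le_trans ct _; rewrite (bigD1 i)//= lerDl.
      by apply: sumr_ge0 => j _; exact: one_minus_cos_ge0.
    have fb : `|f (pt J) - f x| <= 2 * M.
      apply: le_trans (ler_normB _ _) _; have := fM x; have := fM (pt J); lra.
    apply: le_trans fb _.
    have : 2 * M <= 2 * M / c * \sum_i (1 - cos (t J i)).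
      rewrite -{1}[2 * M](@divfK _ c) ?gt_eqF//.
      by rewrite ler_wpM2l.
    lra.
  have -> : \sum_J W J x * (e / 2 + 2 * M / c * \sum_i (1 - cos (t J i))) =
     e / 2 + 2 * M / c * \sum_i \sum_J W J x * (1 - cos (t J i)).
    rewrite exchange_big /= mulr_sumr -[X in X + _]mul1r -(W1 x) mulr_suml -big_split /=.
    apply: eq_bigr => J _; rewrite mulrDr; congr (_ + _).
    by rewrite mulrCA -mulr_sumr.
  rewrite [leRHS]splitr lerD2l; apply: le_trans NE.
  apply: ler_wpM2l; first by rewrite divr_ge0 ?mulr_ge0// ltW.
  apply: le_trans (_ : \sum_(i < k) 2 / N%:R <= _).
    by apply: ler_sum => i _; exact: Wspread.
  by rewrite sumr_const card_ord -[leLHS]mulr_natl.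
Qed.

End TrigApprox.

Section RandomVectors.
Context {dO : measure_display} {Omega : measurableType dO} {R : realType} {k : nat}.
Variable P : probability Omega R.

Lemma rv_tight (s : Omega -> R) (e : R) : measurable_fun setT s -> 0 < e ->
  exists n : nat, (P [set w | (n%:R < s w)%R] <= e%:E)%E.
Proof.
move=> ms e0.
pose A n := [set w | n%:R < s w].
have mA n : measurable (A n) by apply: meas_lt.
have [||||_ cvgE] := @Ex_dominated _ _ _ P (fun n => \1_(A n)) (fun=> 0) (fun=> 1).
- by move=> n; exact: measurable_indic.
- move=> w; apply: cvg_near_cst; exists (Num.truncn (s w)).+1 => // n /= nX.
  rewrite indicE memNset// /A /=; apply/negP; rewrite -leNgt; apply: ltW.
  by apply: lt_le_trans (truncnS_gt _) _; rewrite ler_nat.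
- by move=> n w; rewrite indicE; case: (_ \in _); rewrite ?normr1 ?normr0.
- exact: L1_cst.
move: cvgE; rewrite Ex_cst => /cvgrPdist_le /(_ _ e0) [n _ /(_ n (leqnn _))].
rewrite /= sub0r normrN => h; exists n.
by rewrite -(Ex_indic P (mA n)) lee_fin; apply: le_trans h; exact: ler_norm.
Qed.

Lemma random_vector_dotv (X : Omega -> 'rV[R]_k) a : random_vector X ->
  measurable_fun setT (fun w => dotv a (X w)).
Proof.
by move=> rX; apply: measurable_sum => i; apply: measurable_funM => //; exact: rX.
Qed.

Lemma trig_measurable (X : Omega -> 'rV[R]_k) p : random_vector X -> trig p ->
  measurable_fun setT (p \o X).
Proof.
move=> rX; elim=> [a b||p1 p2 _ IH1 _ IH2|c p1 _ IH].
- apply: (measurableT_comp (continuous_measurable_fun (@continuous_cos R))).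
  by apply: measurable_funD => //; exact: random_vector_dotv.
- exact: measurable_cst.
- exact: measurable_funD.
- exact: measurable_funM.
Qed.

(** [random_vector] speaks of coordinates only; trigonometric polynomials on growing boxes exhibit
    [f \o X] as a pointwise limit of measurable functions. *)
Lemma continuous_random_vector (X : Omega -> 'rV[R]_k) (f : 'rV[R]_k -> R) (M : R) :
  random_vector X -> continuous f -> (forall x, `|f x| <= M) ->
  measurable_fun setT (f \o X).
Proof.
move=> rX cf fM.
have H (n : nat) : exists p : 'rV[R]_k -> R, [/\ trig p, (forall x, `|p x| <= M) &
    forall x : 'rV[R]_k, (forall i, `|x 0 i| <= n.+1%:R) -> `|p x - f x| <= n.+1%:R^-1].
  by apply: trig_approx.
have [p pP] := choice H.
apply: (@measurable_fun_cvg _ _ _ _ (fun n => p n \o X)).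
  by move=> n; apply: trig_measurable => //; have [] := pP n.
move=> w _; apply/cvgrPdist_le => e e0.
exists (maxn (Num.truncn `|X w|).+1 (Num.truncn e^-1).+1) => // n /=.
rewrite geq_max => /andP[n1 n2]; rewrite distrC.
have [_ _ pf] := pP n; apply: le_trans (pf (X w) _) _.
  move=> i; apply: le_trans (coord_le_norm _ _) _; apply: ltW.
  by apply: lt_le_trans (truncnS_gt _) _; rewrite ler_nat (leq_trans n1).
rewrite -[leRHS]invrK lef_pV2 ?posrE ?invr_gt0//; apply: ltW.
by apply: lt_le_trans (truncnS_gt _) _; rewrite ler_nat (leq_trans n2).
Qed.

End RandomVectors.

Section WeakConvergence.
Context {dO dQ : measure_display} {Omega : measurableType dO}
  {Omega' : measurableType dQ} {R : realType} {k : nat}.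
Variables (P : probability Omega R) (Q : probability Omega' R).
Variables (X : nat -> Omega -> 'rV[R]_k) (Y : Omega' -> 'rV[R]_k).
Hypotheses (rX : forall T, random_vector (X T)) (rY : random_vector Y).
Hypothesis tightX : forall e, 0 < e ->
  exists C : R, mostly P e (fun T => [set w | forall i, `|X T w 0 i| <= C]).
Hypothesis charXY : forall a b,
  Ex P (fun w => cos (dotv a (X T w) + b)) @[T --> \oo]
    --> Ex Q (fun w => cos (dotv a (Y w) + b)).

Lemma trig_bounded p : trig p -> exists c : R, forall x : 'rV[R]_k, `|p x| <= c.
Proof.
elim=> [a b||p1 p2 _ [c1 h1] _ [c2 h2]|c p1 _ [c1 h1]].
- by exists 1 => x; rewrite ler_norml cos_geN1 cos_le1.
- by exists 0 => x; rewrite normr0.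
- by exists (c1 + c2) => x; apply: le_trans (ler_normD _ _) (lerD (h1 x) (h2 x)).
- by exists (`|c| * c1) => x; rewrite normrM ler_wpM2l.
Qed.

Lemma trig_L1 d (T : measurableType d) (mu : probability T R) (Z : T -> 'rV[R]_k) p :
  random_vector Z -> trig p -> L1 mu (p \o Z).
Proof.
move=> rZ tp; have [c pc] := trig_bounded tp.
by apply: (@L1_bounded _ _ _ _ _ c) => [|w]; [exact: trig_measurable|exact: pc].
Qed.

Lemma trig_cvg p : trig p -> Ex P (p \o X T) @[T --> \oo] --> Ex Q (p \o Y).
Proof.
elim=> [a b||p1 p2 t1 IH1 t2 IH2|c p1 t1 IH].
- exact: charXY.
- rewrite (_ : (fun T => _) = fun=> Ex P (fun=> 0)); last exact/funext.
  by rewrite [Ex Q _]Ex_cst Ex_cst; exact: cvg_cst.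
- rewrite [X in _ --> X](ExD (trig_L1 Q rY t1) (trig_L1 Q rY t2)).
  rewrite (_ : (fun T => _) = fun T => Ex P (p1 \o X T) + Ex P (p2 \o X T)).
    exact: cvgD.
  by apply/funext => T; rewrite -(ExD (trig_L1 P (rX T) t1) (trig_L1 P (rX T) t2)).
- rewrite [X in _ --> X](ExZ c (trig_L1 Q rY t1)).
  rewrite (_ : (fun T => _) = fun T => c * Ex P (p1 \o X T)); first exact: cvgMr.
  by apply/funext => T; rewrite -(ExZ c (trig_L1 P (rX T) t1)).
Qed.

Lemma weak_cvg (f : 'rV[R]_k -> R) (M : R) : continuous f -> (forall x, `|f x| <= M) ->
  Ex P (f \o X T) @[T --> \oo] --> Ex Q (f \o Y).
Proof.
move=> cf fM; apply/cvgrPdist_le => e e0.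
have M0 : 0 <= M by apply: le_trans (fM 0).
(* Replacing [f] by [p] costs [(1 + 2 * M) * e1] under each law, and the convergence for [p] costs
   [e1]. *)
pose e1 := e / (3 + 4 * M).
have den0 : 0 < 3 + 4 * M by lra.
have e10 : 0 < e1 by rewrite divr_gt0.
have [C CP] := tightX e10.
pose s w := \sum_i `|Y w 0 i|.
have ms : measurable_fun setT s.
  by apply: measurable_sum => i; apply: measurableT_comp => //; exact: rY.
have [n nP] := rv_tight Q ms e10.
have mn : measurable [set w | n%:R < s w] by apply: meas_lt.
pose L := `|C| + n%:R + 1.
have L0 : 0 < L by rewrite ltr_wpDl// addr_ge0.
have [p [tp pM pf]] := trig_approx cf fM L0 e10.
have M2 : 0 <= 2 * M by rewrite mulr_ge0.
have bd x : `|p x - f x| <= 2 * M.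
  by apply: le_trans (ler_normB _ _) _; rewrite mulr_natl mulr2n lerD.
have mfX T := continuous_random_vector (rX T) cf fM.
have mfY := continuous_random_vector rY cf fM.
have hfX T : L1 P (f \o X T) by exact: L1_bounded (mfX T) (fun w => fM _).
have hfY : L1 Q (f \o Y) by exact: L1_bounded mfY (fun w => fM _).
have hpX T := trig_L1 P (rX T) tp.
have hpY := trig_L1 Q rY tp.
have DY : `|Ex Q (fun w => p (Y w) - f (Y w))| <= e1 + 2 * M * e1.
  apply: (Ex_small _ mn nP) => //.
  - by apply: measurable_funB => //; exact: trig_measurable.
  - exact: ltW.
  - move=> w /negP; rewrite -leNgt => h; apply: pf => i.
    apply: le_trans (_ : s w <= _).
      by rewrite /s (bigD1 i)//= lerDl sumr_ge0.
    by apply: le_trans h _; rewrite /L; have := normr_ge0 C; lra.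
have /cvgrPdist_le /(_ _ e10) := trig_cvg tp.
apply: filterS2 CP => T [N [mN Ne NS]] H.
have DX : `|Ex P (fun w => p (X T w) - f (X T w))| <= e1 + 2 * M * e1.
  apply: (Ex_small _ mN Ne) => //.
  - by apply: measurable_funB; [exact: (trig_measurable (rX T) tp)|exact: mfX].
  - exact: ltW.
  - move=> w /NS h; apply: pf => i.
    apply: le_trans (h i) _; apply: le_trans (ler_norm _) _.
    by rewrite /L -addrA lerDl addr_ge0.
move: DX DY H; rewrite (ExB (hpX T) (hfX T)) (ExB hpY hfY).
have -> : e = (3 + 4 * M) * e1 by rewrite /e1 mulrC divfK ?gt_eqF.
move: (Ex P (f \o X T)) (Ex Q (f \o Y)) (Ex P (p \o X T)) (Ex Q (p \o Y)) => A B A' B'.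
have -> : e1 + 2 * M * e1 = (1 + 2 * M) * e1 by ring.
have -> : (3 + 4 * M) * e1 = (1 + 2 * M) * e1 + (1 + 2 * M) * e1 + e1 by ring.
rewrite !ler_norml => /andP[? ?] /andP[? ?] /andP[? ?]; apply/andP; split; lra.
Qed.

End WeakConvergence.

(** * Uniqueness of a law with given characteristic function *)

Section CharUnique.
Context {R : realType}.
Variables (mu nu : probability (measurableTypeR R) R).
Hypothesis char_eq : forall t b : R,
  Ex mu (fun x => cos (t * x + b)) = Ex nu (fun x => cos (t * x + b)).

Let row1 (x : measurableTypeR R) : 'rV[R]_1 := \row_(i < 1) (x : R).

Let rv1 : random_vector row1.
Proof. by move=> i; under eq_fun do rewrite mxE; exact: measurable_id. Qed.

Let dotv1 a x : dotv a (row1 x) = a 0 0 * x.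
Proof. by rewrite /dotv big_ord1 mxE. Qed.

(** Uniqueness is the convergence theorem applied to a constant sequence, whose limit is unique. *)
Lemma char_unique_bounded (f : 'rV[R]_1 -> R) (M : R) : continuous f ->
  (forall x, `|f x| <= M) -> Ex mu (f \o row1) = Ex nu (f \o row1).
Proof.
move=> cf fM.
have H : Ex mu (f \o row1) @[T --> \oo] --> Ex nu (f \o row1).
  apply: (@weak_cvg _ _ _ _ _ _ mu nu (fun _ : nat => row1) row1 _ _ _ _ f M) => //.
  - move=> e e0.
    have ms : measurable_fun [set: measurableTypeR R] (fun x => `|x| : R).
      by apply: measurableT_comp.
    have [n nP] := rv_tight mu ms e0.
    exists n%:R; apply: nearW => T; exists [set w : measurableTypeR R | n%:R < `|w|]; split => //.
      exact: meas_lt.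
    by move=> w /negP; rewrite -leNgt => h i; rewrite mxE.
  - move=> a b; under [X in _ --> X]Ex_ext do rewrite dotv1.
    rewrite -char_eq; under [in X in X @ _]eq_fun do under Ex_ext do rewrite dotv1.
    exact: cvg_cst.
exact: cvg_unique (cvg_cst _) H.
Qed.

Lemma char_unique (B : set (measurableTypeR R)) : measurable B -> mu B = nu B.
Proof.
apply: (@measure_unique _ R (measurableTypeR R) (@RGenOInfty.G R)
  (fun n => `](- n%:R), +oo[%classic) _ _ _ _ mu nu).
- exact: RGenOInfty.measurableE.
- move=> _ _ [a ->] [b ->]; exists (Num.max a b).
  apply/seteqP; split => x /=; rewrite !in_itv /= !andbT gt_max.
    by move=> [-> ->].
  by move=> /andP[].
- by move=> n; exists (- n%:R).
- apply/seteqP; split => // x _; exists (Num.truncn `|x|).+1 => //=.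
  rewrite in_itv /= andbT ltrNl; apply: le_lt_trans (truncnS_gt _).
  by rewrite -normrN ler_norm.
- move=> _ [a ->].
  (* Continuous ramps increasing to the indicator of the half-line; half-lines form a generating
     family stable under intersection. *)
  pose g (n : nat) (v : 'rV[R]_1) : R := Num.max 0 (Num.min 1 (n%:R * (v 0 0 - a))).
  have g01 n v : `|g n v| <= 1.
    by rewrite ger0_norm ?le_max ?lexx// ge_max ler01 ge_min lexx.
  have cg n : continuous (g n).
    move=> v; apply: (@continuous_max R 'rV[R]_1 (fun=> 0)
      (fun v : 'rV[R]_1 => Num.min 1 (n%:R * (v 0 0 - a)))); first exact: cst_continuous.
    apply: (@continuous_min R 'rV[R]_1 (fun=> 1)
      (fun v : 'rV[R]_1 => n%:R * (v 0 0 - a))); first exact: cst_continuous.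
    apply: (@continuousM R 'rV[R]_1 (fun=> n%:R) (fun v : 'rV[R]_1 => v 0 0 - a)).
      exact: cst_continuous.
    apply: (@continuousB R R 'rV[R]_1 (fun v : 'rV[R]_1 => v 0 0) (fun=> a)).
      exact: coord_continuous.
    exact: cst_continuous.
  have gcvg x : g n (row1 x) @[n --> \oo] --> (\1_(`]a, +oo[%classic) x : R).
    rewrite indicE; have [xa|xa] := boolP (x \in _).
      move: xa; rewrite inE /= in_itv /= andbT => xa.
      have xa0 : 0 < x - a by rewrite subr_gt0.
      apply: cvg_near_cst; exists (Num.truncn (x - a)^-1).+1 => // n /= nx.
      rewrite /g mxE min_l ?max_r//.
      rewrite -ler_pdivrMr// mul1r; apply: ltW.
      by apply: lt_le_trans (truncnS_gt _) _; rewrite ler_nat.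
    move: xa; rewrite notin_setE /= in_itv /= andbT => /negP; rewrite -leNgt => xa.
    apply: cvg_near_cst; apply: nearW => n.
    rewrite /g mxE max_l// ge_min; apply/orP; right.
    by rewrite mulr_ge0_le0// subr_le0.
  have E (m : probability (measurableTypeR R) R) :
      Ex m (g n \o row1) @[n --> \oo] --> fine (m `]a, +oo[%classic).
    have [||||_] := @Ex_dominated _ _ _ m (fun n => g n \o row1) (\1_(`]a, +oo[%classic)) (fun=> 1).
    - move=> n; exact: (continuous_random_vector rv1 (cg n) (g01 n)).
    - exact: gcvg.
    - by move=> n w; exact: g01.
    - exact: L1_cst.
    by rewrite -[X in _ --> X -> _]/(fine (Ex m _)%:E) Ex_indic.
  have E2 : Ex mu (g n \o row1) @[n --> \oo] --> fine (nu `]a, +oo[%classic).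
    have eE : (fun n => Ex mu (g n \o row1)) = (fun n => Ex nu (g n \o row1)).
      by apply/funext => n; exact: char_unique_bounded (cg n) (g01 n).
    rewrite eE; exact: (E nu).
  have f1 : mu `]a, +oo[%classic \is a fin_num by exact: fin_num_measure.
  have f2 : nu `]a, +oo[%classic \is a fin_num by exact: fin_num_measure.
  have h : fine (mu `]a, +oo[%classic) = fine (nu `]a, +oo[%classic).
    exact: (cvg_unique (@Rhausdorff R) (E mu) E2).
  have hh : mu `]a, +oo[%classic = nu `]a, +oo[%classic.
    by rewrite -(fineK f1) -(fineK f2) h.
  exact hh.
- move=> n; apply: le_lt_trans (_ : 1%E < _)%E; last exact: ltry.
  by apply: probability_le1; exact: measurable_itv.
Qed.

End CharUnique.

(** * Gaussian vectors *)

Section GaussianIntegral.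
Context {R : realType}.
Notation leb := (@lebesgue_measure R).
Implicit Types (c t b x : R).

Definition gk c x : R := expR (- (c * x ^+ 2)).

Lemma normal_pdf_gk (s x : R) : 0 < s ->
  normal_pdf 0 s x = normal_peak s * gk ((s ^+ 2 *+ 2)^-1) x.
Proof.
move=> s0; rewrite /normal_pdf gt_eqF// /normal_fun /gk subr0; congr (_ * expR _).
by rewrite mulNr mulrC.
Qed.

Lemma gk_integrable c : 0 < c -> leb.-integrable setT (EFin \o gk c).
Proof.
(* The standard deviation whose density is proportional to [gk c]. *)
move=> c0; pose s := Num.sqrt ((c *+ 2)^-1).
have c20 : 0 < c *+ 2 by rewrite pmulrn_lgt0.
have s0 : 0 < s by rewrite sqrtr_gt0 invr_gt0.
have sE : (s ^+ 2 *+ 2)^-1 = c.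
  rewrite sqr_sqrtr ?invr_ge0 ?(ltW c20)//.
  by rewrite -mulr_natr -[c *+ 2]mulr_natr invfM; field; rewrite gt_eqF.
have p0 : normal_peak s != 0 by rewrite gt_eqF// normal_peak_gt0// gt_eqF.
have := integrableZl measurableT (normal_peak s)^-1 (integrable_normal_pdf 0 s).
apply: eq_integrable => // x _; rewrite normal_pdf_gk// sE /= -EFinM.
by rewrite mulrA mulVf// mul1r.
Qed.

Lemma gk_gt0 c x : 0 < gk c x. Proof. exact: expR_gt0. Qed.

Lemma gk_continuous c : continuous (gk c).
Proof.
move=> x; apply: (@continuous_comp _ _ _ (fun x => - (c * x ^+ 2)) expR); last exact: continuous_expR.
apply: (@continuousN R R R (fun x => c * x ^+ 2)).
apply: (@continuousM R R (fun=> c) (fun x => x ^+ 2)); first exact: cst_continuous.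
exact: exprn_continuous.
Qed.

Lemma gk_derive c x : is_derive x (1 : R) (gk c) (- (2 * c * x) * gk c x).
Proof.
have H : is_derive x (1 : R) (fun y : R => - (c * y ^+ 2)) (- (2 * c * x)).
  apply: is_derive_eq; rewrite /GRing.scale /=; ring.
apply: is_derive_eq (is_derive1_comp (is_derive_expR _) H) _.
by rewrite /gk mulrC.
Qed.

(** Half of the exponent absorbs the factor [|x|]. The result is an integrable bound uniform in [t],
    as differentiation under the integral requires. *)
Lemma abs_gk_le c x : 0 < c -> `|x| * gk c x <= (1 + 1 / c) * gk (c / 2) x.
Proof.
move=> c0.
have -> : gk c x = gk (c / 2) x * gk (c / 2) x.
  by rewrite /gk -expRD; congr expR; field.
rewrite mulrA ler_pM2r ?gk_gt0//.
have h := expR_ge1Dx (c / 2 * x ^+ 2).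
have e0 := expR_gt0 (c / 2 * x ^+ 2).
have -> : gk (c / 2) x = (expR (c / 2 * x ^+ 2))^-1 by rewrite /gk expRN.
rewrite ler_pdivrMr//; apply: le_trans (_ : (1 + 1 / c) * (1 + c / 2 * x ^+ 2) <= _).
  have -> : (1 + 1 / c) * (1 + c / 2 * x ^+ 2) = 1 + 1 / c + c / 2 * x ^+ 2 + x ^+ 2 / 2.
    by field; rewrite gt_eqF.
  have i0 : 0 < 1 / c by rewrite divr_gt0.
  have : 0 <= c / 2 * x ^+ 2 by rewrite mulr_ge0 ?sqr_ge0// divr_ge0// ltW.
  have : 2 * `|x| <= 1 + x ^+ 2.
    have := sqr_ge0 (`|x| - 1); rewrite sqrrB1 real_normK ?num_real//.
    by rewrite -mulr_natl; lra.
  lra.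
by rewrite ler_pM2l// addr_gt0// divr_gt0.
Qed.

Definition gphi c b t : R := \int[leb]_x (cos (t * x + b) * gk c x).
Definition gpsi c b t : R := \int[leb]_x (x * sin (t * x + b) * gk c x).

Lemma measurable_gk c : measurable_fun setT (gk c).
Proof. exact: continuous_measurable_fun (gk_continuous (c:=c)). Qed.

Lemma measurable_aff t b : measurable_fun setT (fun x : R => t * x + b).
Proof. by apply: measurable_funD => //; apply: measurable_funM. Qed.

Lemma measurable_cos_aff t b : measurable_fun setT (fun x : R => cos (t * x + b)).
Proof.
apply: (measurableT_comp (continuous_measurable_fun (@continuous_cos R))).
exact: measurable_aff.
Qed.

Lemma measurable_sin_aff t b : measurable_fun setT (fun x : R => sin (t * x + b)).
Proof.
apply: (measurableT_comp (continuous_measurable_fun (@continuous_sin R))).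
exact: measurable_aff.
Qed.

Lemma abs_gk_integrable c : 0 < c ->
  leb.-integrable setT (EFin \o (fun x => (1 + 1 / c) * gk (c / 2) x)).
Proof.
move=> c0; have c2 : 0 < c / 2 by rewrite divr_gt0.
exact: (integrableZl measurableT (1 + 1 / c) (gk_integrable c2)).
Qed.

Lemma cos_gk_integrable c b t : 0 < c ->
  leb.-integrable setT (EFin \o (fun x => cos (t * x + b) * gk c x)).
Proof.
move=> c0; apply: le_integrable (gk_integrable c0) => //.
  apply/measurable_EFinP; apply: measurable_funM; first exact: measurable_cos_aff.
  exact: measurable_gk.
move=> x _ /=; rewrite lee_fin normrM ler_piMl//.
by rewrite ler_norml cos_geN1 cos_le1.
Qed.

Lemma xsin_gk_bound c b t x : 0 < c ->
  `|x * sin (t * x + b) * gk c x| <= (1 + 1 / c) * gk (c / 2) x.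
Proof.
move=> c0; apply: le_trans (abs_gk_le x c0).
rewrite !normrM (gtr0_norm (gk_gt0 _ _)) ler_pM2r ?gk_gt0// ler_piMr//.
by rewrite ler_norml sin_geN1 sin_le1.
Qed.

Lemma xsin_gk_integrable c b t : 0 < c ->
  leb.-integrable setT (EFin \o (fun x => x * sin (t * x + b) * gk c x)).
Proof.
move=> c0; apply: le_integrable (abs_gk_integrable c0) => //.
  apply/measurable_EFinP; apply: measurable_funM; last exact: measurable_gk.
  by apply: measurable_funM => //; exact: measurable_sin_aff.
move=> x _ /=; rewrite lee_fin; apply: le_trans (xsin_gk_bound b t x c0) _.
exact: ler_norm.
Qed.

Lemma is_derive_cos_aff t b x : is_derive x (1 : R) (fun x : R => cos (t * x + b)) (- t * sin (t * x + b)).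
Proof.
have H : is_derive x (1 : R) (fun y : R => t * y + b) t.
  apply: is_derive_eq; rewrite /GRing.scale /=; ring.
apply: is_derive_eq (is_derive1_comp (is_derive_cos _) H) _.
by rewrite mulrC mulNr mulrN.
Qed.

Lemma is_derive_sin_aff t b x : is_derive x (1 : R) (fun x : R => sin (t * x + b)) (t * cos (t * x + b)).
Proof.
have H : is_derive x (1 : R) (fun y : R => t * y + b) t.
  apply: is_derive_eq; rewrite /GRing.scale /=; ring.
by apply: is_derive_eq (is_derive1_comp (is_derive_sin _) H) _; rewrite mulrC.
Qed.

Lemma gphi_derive c b t : 0 < c -> is_derive t (1 : R) (gphi c b) (- gpsi c b t).
Proof.
move=> c0.
pose f (t x : R) := cos (t * x + b) * gk c x.
have dfE (u x : R) : is_derive u (1 : R) (f ^~ x) (- (x * sin (u * x + b) * gk c x)).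
  have H := is_derive_cos_aff x b u.
  have -> : f ^~ x = (fun u => gk c x * cos (x * u + b)).
    by apply/funext => v; rewrite /f mulrC [v * x]mulrC.
  apply: is_derive_eq; rewrite /GRing.scale /= [u * x]mulrC; ring.
have derf1 (x y : R) : `]t - 1, t + 1[%classic x -> [set: R] y -> derivable (f ^~ y) x 1.
  by move=> _ _; have [] := dfE x y.
have d1E (x y : R) : partial1of2 f x y = - (y * sin (x * y + b) * gk c y).
  by rewrite partial1of2E; have [_] := dfE x y.
have Gub (x y : R) : `]t - 1, t + 1[%classic x -> [set: R] y ->
    `|partial1of2 f x y| <= (1 + 1 / c) * gk (c / 2) y.
  by move=> _ _; rewrite d1E normrN; exact: xsin_gk_bound.
have It : `]t - 1, t + 1[%classic t.
  by rewrite /= in_itv /=; apply/andP; split; lra.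
have G0 (y : R) : 0 <= (1 + 1 / c) * gk (c / 2) y.
  by rewrite mulr_ge0 ?(ltW (gk_gt0 _ _))// addr_ge0// divr_ge0// ltW.
have fint (x : R) : `]t - 1, t + 1[%classic x -> leb.-integrable setT (EFin \o f x).
  by move=> _; exact: cos_gk_integrable.
have D := derivable_under_integral measurableT It fint derf1 G0 (abs_gk_integrable c0) Gub.
have E := differentiation_under_integral measurableT It fint derf1 G0 (abs_gk_integrable c0) Gub.
apply: DeriveDef; first exact: D.
rewrite -derive1E E /gpsi -mulN1r -RintegralZl//; last exact: xsin_gk_integrable.
by apply: eq_Rintegral => y _; rewrite d1E mulN1r.
Qed.

(* The derivative of [sin (t x + b) gk c x], whose integral vanishes; with
   [gphi_derive] this gives the equation [gphi' = - t / (2 c) gphi]. *)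
Definition gbound c b t x : R := t * cos (t * x + b) * gk c x - 2 * c * (x * sin (t * x + b) * gk c x).

Lemma gk_cvg0 c (u : R) : 0 < c -> u ^+ 2 = 1 -> gk c (u * n%:R) @[n --> \oo] --> (0 : R).
Proof.
move=> c0 u1; apply/cvgrPdist_le => e e0.
exists (Num.truncn (e^-1 / c)).+1 => // n /= nE.
rewrite sub0r normrN gtr0_norm ?gk_gt0// /gk exprMn u1 mul1r expRN.
rewrite -[leRHS]invrK lef_pV2 ?posrE ?invr_gt0 ?expR_gt0//.
apply: le_trans (expR_ge1Dx _); apply: le_trans (_ : c * n%:R <= _).
  rewrite mulrC -ler_pdivrMr//; apply: ltW; apply: lt_le_trans (truncnS_gt _) _.
  by rewrite ler_nat.
have n1 : 1 <= n%:R :> R by rewrite ler1n (leq_trans _ nE).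
have : c * n%:R <= c * n%:R ^+ 2 by rewrite ler_pM2l// expr2 ler_peMl// (le_trans ler01).
lra.
Qed.

Lemma gbound_FTC c b t (n : nat) : 0 < c ->
  \int[leb]_(x in `[- n.+1%:R, n.+1%:R]) gbound c b t x =
  sin (t * n.+1%:R + b) * gk c n.+1%:R - sin (t * - n.+1%:R + b) * gk c (- n.+1%:R).
Proof.
move=> c0.
pose F (x : R) := sin (t * x + b) * gk c x.
have dF (x : R) : is_derive x (1 : R) F (gbound c b t x).
  have H1 := is_derive_sin_aff t b x; have H2 := gk_derive c x.
  apply: is_derive_eq; rewrite /GRing.scale /= /gbound; ring.
have cF : continuous F.
  by move=> x; apply: differentiable_continuous; apply/derivable1_diffP; have [] := dF x.
have cg : continuous (gbound c b t).
  have csin : continuous (fun x : R => sin (t * x + b)).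
    by move=> x; apply: differentiable_continuous; apply/derivable1_diffP; have [] := is_derive_sin_aff t b x.
  have ccos : continuous (fun x : R => cos (t * x + b)).
    by move=> x; apply: differentiable_continuous; apply/derivable1_diffP; have [] := is_derive_cos_aff t b x.
  move=> x; apply: (@continuousB R R R (fun x => t * cos (t * x + b) * gk c x)
     (fun x => 2 * c * (x * sin (t * x + b) * gk c x))).
    apply: (@continuousM R R (fun x => t * cos (t * x + b)) (gk c)); last exact: gk_continuous.
    by apply: (@continuousM R R (fun=> t) (fun x => cos (t * x + b))); [exact: cst_continuous|exact: ccos].
  apply: (@continuousM R R (fun=> 2 * c) (fun x => x * sin (t * x + b) * gk c x)).
    exact: cst_continuous.
  apply: (@continuousM R R (fun x => x * sin (t * x + b)) (gk c)); last exact: gk_continuous.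
  by apply: (@continuousM R R id (fun x => sin (t * x + b))); [exact: cvg_id|exact: csin].
have lt : - n.+1%:R < n.+1%:R :> R by rewrite gtrN.
rewrite /Rintegral (@continuous_FTC2 _ (gbound c b t) F)//.
- exact: continuous_subspaceT.
- split; first by move=> x _; have [] := dF x.
  + by apply: cvg_at_right_filter; exact: cF.
  + by apply: cvg_at_left_filter; exact: cF.
- by move=> x _; rewrite derive1E; have [_] := dF x.
Qed.

Lemma gbound_integrable c b t : 0 < c -> leb.-integrable setT (EFin \o gbound c b t).
Proof.
move=> c0.
have h1 := integrableZl measurableT t (cos_gk_integrable b t c0).
have h2 := integrableZl measurableT (2 * c) (xsin_gk_integrable b t c0).
apply: eq_integrable (integrableB measurableT h1 h2) => // x _.
by rewrite /= -!EFinM -EFinB /gbound; congr (_%:E); ring.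
Qed.

(** The integral is the limit over growing intervals, on each of which it reduces to boundary terms
    that [gk] sends to zero. *)
Lemma gbound_integral0 c b t : 0 < c -> \int[leb]_x gbound c b t x = 0.
Proof.
move=> c0; have gi := gbound_integrable b t c0.
pose I (n : nat) := `[- n.+1%:R, n.+1%:R]%classic : set R.
have C1 : (\int[leb]_(x in I n) gbound c b t x) @[n --> \oo] --> \int[leb]_x gbound c b t x.
  have mI n : measurable (I n) by exact: measurable_itv.
  have mg : measurable_fun setT (gbound c b t) by have /integrableP[/measurable_EFinP] := gi.
  have mrI n : measurable_fun setT (EFin \o (gbound c b t \_ (I n))).
    apply/measurable_EFinP; have [H _] := measurable_restrictT (gbound c b t) (mI n).
    by apply: H; exact: measurable_funTS.
  have aec : {ae leb, forall x, setT x ->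
      (EFin \o (gbound c b t \_ (I n))) x @[n --> \oo] --> (EFin \o gbound c b t) x}.
    apply: aeW => x _; apply: cvg_near_cst; exists (Num.truncn `|x|).+1 => // n /= nx.
    rewrite patchE ifT// inE /I /= in_itv /= -ler_norml; apply: ltW.
    by apply: lt_le_trans (truncnS_gt _) _; rewrite ler_nat leqW.
  have aed : {ae leb, forall x n, setT x ->
      (`|(EFin \o (gbound c b t \_ (I n))) x| <= (abse \o (EFin \o gbound c b t)) x)%E}.
    apply: aeW => x n _ /=; rewrite patchE lee_fin; case: ifP => _ //.
    by rewrite normr0.
  have [_ _ C] := @dominated_convergence _ _ _ leb setT measurableT _ _ _ mrI
    (measurable_int _ gi) aec (integrable_abse gi) aed.
  have : fine (\int[leb]_x ((gbound c b t \_ (I n)) x)%:E)%E @[n --> \oo]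
      --> \int[leb]_x gbound c b t x.
    by apply: fine_cvg; rewrite fineK ?integrable_fin_num//; exact: C.
  apply: cvg_trans; apply: near_eq_cvg; apply: nearW => n.
  by rewrite Rintegral_mkcond /Rintegral.
have C2 : (\int[leb]_(x in I n) gbound c b t x) @[n --> \oo] --> (0 : R).
  have gN n : gk c (- n%:R) = gk c n%:R by rewrite /gk sqrrN.
  apply/cvgrPdist_le => e e0.
  have e2 : 0 < e / 2 by rewrite divr_gt0.
  have /cvgrPdist_le /(_ _ e2) := gk_cvg0 c0 (expr1n R 2).
  move=> [m _ Hm]; exists m => // n /= mn.
  have := Hm n.+1 (leqW mn); rewrite /= mul1r sub0r normrN gtr0_norm ?gk_gt0// => h.
  rewrite sub0r normrN gbound_FTC// gN.
  apply: le_trans (ler_normB _ _) _; rewrite [e]splitr; apply: lerD.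
    rewrite normrM (gtr0_norm (gk_gt0 _ _)); apply: le_trans h.
    by rewrite ler_piMl ?(ltW (gk_gt0 _ _))// ler_norml sin_geN1 sin_le1.
  rewrite normrM (gtr0_norm (gk_gt0 _ _)); apply: le_trans h.
  by rewrite ler_piMl ?(ltW (gk_gt0 _ _))// ler_norml sin_geN1 sin_le1.
exact: (cvg_unique (@Rhausdorff R) C1 C2).
Qed.

Lemma gpsiE c b t : 0 < c -> gpsi c b t = t / (2 * c) * gphi c b t.
Proof.
move=> c0; have := gbound_integral0 b t c0.
have h1 := cos_gk_integrable b t c0; have h2 := xsin_gk_integrable b t c0.
have -> : \int[leb]_x gbound c b t x = t * gphi c b t - 2 * c * gpsi c b t.
  rewrite /gphi /gpsi -RintegralZl// -RintegralZl// -RintegralB//.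
  - by apply: eq_Rintegral => x _; rewrite /gbound; ring.
  - exact: (integrableZl measurableT t h1).
  - exact: (integrableZl measurableT (2 * c) h2).
move/eqP; rewrite subr_eq0 => /eqP E.
by apply: (@mulfI _ (2 * c)); rewrite ?mulf_neq0 ?gt_eqF// -E; field; rewrite gt_eqF.
Qed.

(** Multiplied by the integrating factor [exp(t^2 / (4 c))], [gphi] has zero derivative, so it is
    determined by its value at [t = 0]. *)
Lemma gphiE c b t : 0 < c ->
  gphi c b t = expR (- (t ^+ 2 / (4 * c))) * cos b * \int[leb]_x gk c x.
Proof.
move=> c0; pose k (u : R) := expR (u ^+ 2 / (4 * c)) * gphi c b u.
have dk (u : R) : is_derive u (1 : R) k 0.
  have H : is_derive u (1 : R) (fun y : R => y ^+ 2 / (4 * c)) (u / (2 * c)).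
    have -> : (fun y : R => y ^+ 2 / (4 * c)) = (fun y : R => (4 * c)^-1 * y ^+ 2).
      by apply/funext => y; rewrite mulrC.
    apply: is_derive_eq; rewrite /GRing.scale /=; field; rewrite gt_eqF//.
  have H1 := is_derive1_comp (is_derive_expR _) H.
  have H2 := gphi_derive b u c0.
  apply: is_derive_eq; rewrite /GRing.scale /= gpsiE//; ring.
have := is_derive_0_is_cst t 0 dk; rewrite /k expr0n mul0r expR0 mul1r.
have -> : gphi c b 0 = cos b * \int[leb]_x gk c x.
  rewrite /gphi -RintegralZl//; last exact: gk_integrable.
  by apply: eq_Rintegral => x _; rewrite mul0r add0r.
move=> E; rewrite -mulrA -E mulrA -expRD addNr expR0 mul1r //.
Qed.

End GaussianIntegral.

Section NormalChar.
Context {R : realType}.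
Variable s : R.
Hypothesis s0 : 0 < s.
Notation leb := (@lebesgue_measure R).

(** The Radon-Nikodym derivative and [normal_pdf] have the same integral over every measurable set,
    hence agree almost everywhere. *)
Lemma normal_prob_Ex (f : R -> R) : L1 (normal_prob 0 s) f ->
  Ex (normal_prob 0 s) f = \int[leb]_x (f x * normal_pdf 0 s x).
Proof.
move=> hf; have dom := normal_prob_dominates 0 s.
have E := Radon_Nikodym_change_of_variables dom measurableT hf.
rewrite /Ex /Rintegral -E; congr fine.
have mf := measurable_int _ hf.
pose nu := charge_of_finite_measure (normal_prob 0 s).
have dom' : nu `<< leb by [].
have iRN := Radon_Nikodym_integrable dom'.
have mp : measurable_fun setT (EFin \o normal_pdf 0 s).
  by apply/measurable_EFinP; exact: measurable_normal_pdf.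
apply: ae_eq_integral => //.
- by apply: emeasurable_funM => //; exact: (measurable_int _ iRN).
- by apply/measurable_EFinP; apply: measurable_funM; [exact: L1_meas hf|exact: measurable_normal_pdf].
have H : ae_eq leb setT (Radon_Nikodym nu leb) (EFin \o normal_pdf 0 s).
  apply: integral_ae_eq => //.
  by move=> A _ mA; rewrite -Radon_Nikodym_integral.
by apply: filterS H => x Hx _; rewrite [in LHS]Hx.
Qed.

Lemma normal_prob_char (t b : R) :
  Ex (normal_prob 0 s) (fun x => cos (t * x + b)) = expR (- (t ^+ 2 * s ^+ 2 / 2)) * cos b.
Proof.
rewrite normal_prob_Ex; last first.
  apply: (@L1_bounded _ _ _ _ _ 1); first exact: measurable_cos_aff.
  by move=> w; rewrite ler_norml cos_geN1 cos_le1.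
pose c := (s ^+ 2 *+ 2)^-1.
have c0 : 0 < c by rewrite invr_gt0 pmulrn_lgt0// exprn_gt0.
have E1 : \int[leb]_x (cos (t * x + b) * normal_pdf 0 s x) = normal_peak s * gphi c b t.
  rewrite /gphi -RintegralZl//; last exact: cos_gk_integrable.
  by apply: eq_Rintegral => x _; rewrite normal_pdf_gk// -/c mulrCA.
(* The value of the Gaussian integral is read off from the total mass of the density. *)
have E2 : normal_peak s * \int[leb]_x gk c x = 1.
  rewrite -RintegralZl//; last exact: gk_integrable.
  have := integral_normal_pdf 0 s => /(congr1 fine) /= <-; rewrite /Rintegral.
  by congr fine; apply: eq_integral => x _; rewrite normal_pdf_gk.
rewrite E1 gphiE// mulrCA -[LHS]mulr1; rewrite mulrC mul1r E2 mulr1.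
congr (expR (- _) * _); rewrite /c -mulr_natr; field; rewrite gt_eqF//.
Qed.

End NormalChar.

Section Pushforward.
Context {d d' : measure_display} {T : measurableType d} {T' : measurableType d'} {R : realType}.

Lemma pushforward_probability (P : probability T R) (phi : T -> T') :
  measurable_fun setT phi ->
  exists Q : probability T' R, (forall A, Q A = P (phi @^-1` A)) /\
    forall h : T' -> R, measurable_fun setT h -> L1 P (h \o phi) ->
      L1 Q h /\ Ex Q h = Ex P (h \o phi).
Proof.
move=> mphi.
pose mixphi := isMeasurableFun.Build _ _ _ _ _ mphi.
pose phi' : {mfun T >-> T'} := HB.pack phi mixphi.
exists (distribution P phi'); split => // h mh hphi.
have mEh : measurable_fun setT (EFin \o h) by exact/measurable_EFinP.
split.
  exact: (@integrable_pushforward _ _ _ _ _ phi mphi P setT (EFin \o h) mEh hphi measurableT).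
rewrite /Ex /Rintegral; congr fine.
exact: (@integral_pushforward _ _ _ _ _ phi mphi P setT (EFin \o h) mEh hphi measurableT).
Qed.

End Pushforward.

Section GaussianVectors.
Context {R : realType}.
Local Notation RT := (measurableTypeR R).

Definition has_gauss_char k (v : 'rV[R]_k -> R) (Q : probability (k.-tuple RT) R) :=
  forall a b, Ex Q (fun x => cos (dotv a (rv_of_tuple x) + b)) = expR (- (v a / 2)) * cos b.

Lemma rv_of_tuple_random k : random_vector (fun x : k.-tuple RT => rv_of_tuple x).
Proof.
by move=> i; under eq_fun do rewrite mxE; exact: measurable_tnth.
Qed.

Lemma cos_tuple_L1 k (Q : probability (k.-tuple RT) R) a b :
  L1 Q (fun x => cos (dotv a (rv_of_tuple x) + b)).
Proof.
apply: (@L1_bounded _ _ _ _ _ 1) => [|w]; last by rewrite ler_norml cos_geN1 cos_le1.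
apply: (measurableT_comp (continuous_measurable_fun (@continuous_cos R))).
apply: measurable_funD => //; apply: random_vector_dotv; exact: rv_of_tuple_random.
Qed.

(** Induction on the dimension with a product measure: in the inner integral the first coordinate
    only shifts the phase [b], so the hypothesis applies and leaves a one-dimensional integral. *)
Lemma std_gaussian k : exists Q : probability (k.-tuple RT) R,
  has_gauss_char (fun a => \sum_i a 0 i ^+ 2) Q.
Proof.
elim: k => [|k [Q IH]].
  exists (dirac [tuple]) => a b.
  rewrite -[RHS](Ex_cst (dirac ([tuple] : 0.-tuple RT))); apply: Ex_ext => x.
  by rewrite /dotv !big_ord0 mul0r oppr0 expR0 mul1r add0r.
pose Z : probability RT R := normal_prob 0 1.
pose PQ := (Z \x Q)%E : probability (RT * k.-tuple RT)%type R.
pose phi (z : RT * k.-tuple RT) : k.+1.-tuple RT := [the k.+1.-tuple RT of z.1 :: z.2].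
have mphi : measurable_fun setT phi by apply: measurable_cons.
have [Q' [_ HQ']] := pushforward_probability PQ mphi.
exists Q' => a b.
have mh : measurable_fun setT (fun x : k.+1.-tuple RT => cos (dotv a (rv_of_tuple x) + b)).
  exact: L1_meas (cos_tuple_L1 Q' a b).
pose f (z : RT * k.-tuple RT) := cos (dotv a (rv_of_tuple (phi z)) + b).
have hf : L1 PQ f.
  apply: (@L1_bounded _ _ _ _ _ 1) => [|w]; last by rewrite ler_norml cos_geN1 cos_le1.
  exact: (measurableT_comp mh mphi).
have [_ ->] := HQ' _ mh hf.
pose a' : 'rV[R]_k := \row_i a 0 (lift ord0 i).
have fE x t : f (x, t) = cos (dotv a' (rv_of_tuple t) + (a 0 0 * x + b)).
  have E1 : rv_of_tuple (phi (x, t)) 0 ord0 = x by rewrite mxE.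
  have E2 i : rv_of_tuple (phi (x, t)) 0 (lift ord0 i) = rv_of_tuple t 0 i.
    by rewrite !mxE tnthS.
  have E3 : \sum_i a 0 (lift ord0 i) * rv_of_tuple (phi (x, t)) 0 (lift ord0 i)
      = dotv a' (rv_of_tuple t).
    by apply: eq_bigr => i _; rewrite E2 [a' 0 i]mxE.
  by rewrite /f; congr cos; rewrite /dotv big_ord_recl E1 E3 [LHS]addrAC addrC.
have Fub : Ex PQ f = Ex Z (fun x => Ex Q (fun t => f (x, t))).
  rewrite /Ex /Rintegral; congr fine.
  rewrite -(@integral12_prod_meas1 _ _ _ _ _ Z Q (EFin \o f) hf).
  apply: eq_integral => x _; rewrite /fubini_F.
  have hx : L1 Q (fun t => f (x, t)).
    rewrite (_ : (fun t => _) = (fun t => cos (dotv a' (rv_of_tuple t) + (a 0 0 * x + b)))).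
      exact: cos_tuple_L1.
    by apply/funext => t; exact: fE.
  exact: ExE.
rewrite Fub.
have inner x : Ex Q (fun t => f (x, t)) = expR (- ((\sum_i a' 0 i ^+ 2) / 2)) * cos (a 0 0 * x + b).
  by rewrite -IH; apply: Ex_ext => t; exact: fE.
rewrite (Ex_ext Z inner) ExZ; last first.
  apply: (@L1_bounded _ _ _ _ _ 1); first exact: measurable_cos_aff.
  by move=> w; rewrite ler_norml cos_geN1 cos_le1.
rewrite (normal_prob_char ltr01) mulrA -expRD big_ord_recl expr1n mulr1.
congr (expR _ * _); rewrite (eq_bigr (fun i => a 0 (lift ord0 i) ^+ 2)); last by move=> i _; rewrite mxE.
by rewrite -opprD -mulrDl [in LHS]addrC.
Qed.

(** The image of the standard vector under [L] gives [<a, x>] the variance [|a L|^2 = a V a^T].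
    Uniqueness then identifies the law of each linear functional, which is a point mass when the
    variance vanishes. *)
Lemma gaussian_exists k (V L : 'M[R]_k) : V = L *m L^T ->
  exists Q : probability (k.-tuple RT) R,
    has_gauss_char (fun a => (a *m V *m a^T) 0 0) Q /\ is_centered_gaussian V Q.
Proof.
move=> VE; have [Q0 HQ0] := std_gaussian k.
have vE a : (a *m V *m a^T) 0 0 = \sum_i (a *m L) 0 i ^+ 2.
  rewrite VE mulmxA -mulmxA -trmx_mul mxE; apply: eq_bigr => i _.
  by rewrite !mxE expr2.
pose phi (x : k.-tuple RT) : k.-tuple RT :=
  [tuple (\sum_j L i j * tnth x j : RT) | i < k].
have mphi : measurable_fun setT phi.
  apply/measurable_fun_tnthP => i.
  have -> : (fun x => tnth x i) \o phi = (fun x => \sum_j L i j * tnth x j).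
    by apply/funext => x; rewrite /= tnth_mktuple.
  apply: measurable_sum => j; apply: measurable_funM => //; exact: measurable_tnth.
have [Q [_ HQ]] := pushforward_probability Q0 mphi.
have dphi a x : dotv a (rv_of_tuple (phi x)) = dotv (a *m L) (rv_of_tuple x).
  rewrite /dotv; under eq_bigr do rewrite mxE tnth_mktuple mulr_sumr.
  rewrite exchange_big; apply: eq_bigr => j _; rewrite !mxE mulr_suml.
  by apply: eq_bigr => i _; rewrite mulrA.
have charQ : has_gauss_char (fun a => (a *m V *m a^T) 0 0) Q.
  move=> a b; have mh := L1_meas (cos_tuple_L1 Q a b).
  have E : (fun x => cos (dotv a (rv_of_tuple x) + b)) \o phi =
     (fun x => cos (dotv (a *m L) (rv_of_tuple x) + b)).
    by apply/funext => x /=; rewrite dphi.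
  have hL : L1 Q0 ((fun x => cos (dotv a (rv_of_tuple x) + b)) \o phi).
    by rewrite E; exact: cos_tuple_L1.
  by have [_ ->] := HQ _ mh hL; rewrite E HQ0 vE.
exists Q; split => // a B mB.
have ma : measurable_fun [set: k.-tuple RT] (fun x => dotv a (rv_of_tuple x) : RT).
  by apply: random_vector_dotv; exact: rv_of_tuple_random.
have [mu [muE muEx]] := pushforward_probability Q ma.
have -> : Q [set x | B ((a *m (rv_of_tuple x)^T) 0 0)] = mu B.
  rewrite muE; congr (Q _); apply/seteqP; split => x /=.
    by rewrite mxE; under eq_bigr do rewrite [X in _ * X]mxE.
  by rewrite mxE; under [in X in _ -> X]eq_bigr do rewrite [X in _ * X]mxE.
have charmu t b : Ex mu (fun x => cos (t * x + b)) =
    expR (- (t ^+ 2 * (a *m V *m a^T) 0 0 / 2)) * cos b.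
  have mh : measurable_fun setT (fun x : RT => cos (t * x + b)) by exact: measurable_cos_aff.
  have E : (fun x : RT => cos (t * x + b)) \o (fun x => dotv a (rv_of_tuple x)) =
     (fun x : k.-tuple RT => cos (dotv (t *: a) (rv_of_tuple x) + b)).
    by apply/funext => x /=; rewrite dotvZl.
  have [|_ ->] := muEx _ mh; first by rewrite E; exact: cos_tuple_L1.
  rewrite E charQ; congr (expR (- (_ / 2)) * _).
  by rewrite linearZ /= -!scalemxAl -scalemxAr scalerA !mxE expr2.
have v0 : 0 <= (a *m V *m a^T) 0 0.
  by rewrite vE; apply: sumr_ge0 => i _; exact: sqr_ge0.
rewrite /centered_normal; case: ifPn => [/eqP v00|vn0].
  apply: (@char_unique _ mu (dirac (0 : RT))) mB => t b.
  rewrite charmu v00 mulr0 mul0r oppr0 expR0 mul1r.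
  rewrite /Ex /Rintegral integral_dirac//; last first.
    by apply/measurable_EFinP; exact: measurable_cos_aff.
  by rewrite diracT mul1e /= mulr0 add0r.
have sv0 : 0 < Num.sqrt ((a *m V *m a^T) 0 0) by rewrite sqrtr_gt0 lt_neqAle eq_sym vn0.
apply: (@char_unique _ mu (normal_prob 0 (Num.sqrt ((a *m V *m a^T) 0 0)))) mB => t b.
by rewrite charmu normal_prob_char// sqr_sqrtr.
Qed.

End GaussianVectors.

(** * The penalized objective *)

Section GroupNorm.
Context {R : realType} {d : nat}.
Implicit Types (B : {set 'I_d}) (x y v : 'rV[R]_d).

Lemma l2norm_ge0 B x : 0 <= l2norm B x. Proof. exact: sqrtr_ge0. Qed.

Lemma coord_le_l2norm B x i : i \in B -> `|x 0 i| <= l2norm B x.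
Proof.
move=> iB; rewrite -sqrtr_sqr ler_wsqrtr// (bigD1 i)//= lerDl.
by apply: sumr_ge0 => j _; exact: sqr_ge0.
Qed.

(** Both sides are squared and compared term by term, using that each [|y_i|] is at most the norm
    and each increment at most their sum [S]. *)
Lemma l2norm_lipschitz B x y : l2norm B x <= l2norm B y + \sum_(i in B) `|(x - y) 0 i|.
Proof.
set S := \sum_(i in B) _.
have S0 : 0 <= S by apply: sumr_ge0.
have y0 := l2norm_ge0 B y.
rewrite -(ger0_norm (addr_ge0 y0 S0)) -sqrtr_sqr ler_wsqrtr// sqrrD.
have -> : l2norm B y ^+ 2 = \sum_(i in B) y 0 i ^+ 2.
  by rewrite sqr_sqrtr// sumr_ge0// => i _; exact: sqr_ge0.
apply: le_trans (_ : \sum_(i in B) (y 0 i ^+ 2 + (l2norm B y * `|(x - y) 0 i|) *+ 2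
    + S * `|(x - y) 0 i|) <= _).
  apply: ler_sum => i iB; set h := (x - y) 0 i.
  have -> : x 0 i = y 0 i + h by rewrite /h !mxE; ring.
  rewrite sqrrD; apply: lerD; first rewrite lerD2l ler_pMn2r//.
    apply: le_trans (ler_norm _) _; rewrite normrM ler_wpM2r//.
    exact: coord_le_l2norm.
  rewrite -[h ^+ 2]real_normK ?num_real// expr2 ler_wpM2r//.
  by rewrite /S (bigD1 i)//= lerDl sumr_ge0.
by rewrite !big_split /= -!mulr_sumr -/S expr2 mulr2n.
Qed.

Lemma l2norm_mono B x y : (forall i, `|x 0 i| <= `|y 0 i|) -> l2norm B x <= l2norm B y.
Proof.
move=> xy; rewrite ler_wsqrtr//; apply: ler_sum => i _.
by rewrite -[leLHS]real_normK ?num_real// -[leRHS]real_normK ?num_real// ler_sqr ?nnegrE.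
Qed.

Lemma sum_abs_le B x : \sum_(i in B) `|x 0 i| <= d%:R * `|x|.
Proof.
apply: le_trans (_ : \sum_(i < d) `|x 0 i| <= _).
  by rewrite big_mkcond; apply: ler_sum => i _; case: ifP.
apply: le_trans (_ : \sum_(i < d) `|x| <= _); last by rewrite sumr_const card_ord -[leLHS]mulr_natl.
apply: ler_sum => i _.
exact: coord_le_norm.
Qed.

Lemma l2normT_le x : l2norm finset.setT x <= d%:R * `|x|.
Proof.
apply: le_trans (l2norm_lipschitz _ x 0) _.
rewrite subr0 /l2norm big1 ?sqrtr0 ?add0r ?sum_abs_le// => i _.
by rewrite mxE expr0n.
Qed.

End GroupNorm.

Section PenalizedArgmin.
Context {R : realType} {d m : nat}.
Variables (G : 'I_m -> {set 'I_d}) (L : 'rV[R]_d -> R) (DL : 'I_d -> 'rV[R]_d -> R).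
Variables (C : 'I_d -> R) (Eg : 'I_m -> R) (theta0 th : 'rV[R]_d) (Theta : set 'rV[R]_d).
Local Notation e_ i := (delta_mx 0 i : 'rV[R]_d).

Definition penalized (x : 'rV[R]_d) : R :=
  L x + \sum_i C i * `|x 0 i| + \sum_k Eg k * l2norm (G k) x.

Hypotheses (C0 : forall i, 0 <= C i) (E0 : forall k, 0 <= Eg k).

(* Bounds the variation of the penalty, per unit of sup norm, over the true
   support. *)
Definition pen_rate : R :=
  \sum_(i in supp theta0) C i + d%:R * \sum_(k in active_groups G theta0) Eg k.

Lemma pen_rate_ge0 : 0 <= pen_rate.
Proof. by rewrite addr_ge0 ?mulr_ge0// sumr_ge0. Qed.

Lemma inactive_group k : k \notin active_groups G theta0 -> l2norm (G k) theta0 = 0.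
Proof.
rewrite inE negb_exists => /forallP H.
rewrite /l2norm big1 ?sqrtr0// => i iG; have := H i.
by rewrite iG /= negbK => /eqP ->; rewrite expr0n.
Qed.

(** Where [theta0] vanishes, the penalty of [th] is not smaller, so only active weights can pay for
    an increase of the loss. *)
Lemma penalized_le_loss : penalized th <= penalized theta0 ->
  L th - L theta0 <= pen_rate * `|th - theta0|.
Proof.
rewrite /penalized => H.
have H1 : \sum_i C i * `|theta0 0 i| - \sum_i C i * `|th 0 i|
    <= (\sum_(i in supp theta0) C i) * `|th - theta0|.
  rewrite -sumrB mulr_suml [leRHS]big_mkcond /=; apply: ler_sum => i _.
  rewrite -mulrBr; case: ifPn; rewrite inE => i0.
    rewrite ler_wpM2l//; apply: le_trans (lerB_dist _ _) _.
    by rewrite distrC; have := coord_le_norm (th - theta0) i; rewrite !mxE.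
  move: i0; rewrite negbK => /eqP ->.
  by rewrite normr0 sub0r mulrN oppr_le0 mulr_ge0.
have H2 : \sum_k Eg k * l2norm (G k) theta0 - \sum_k Eg k * l2norm (G k) th
    <= (d%:R * \sum_(k in active_groups G theta0) Eg k) * `|th - theta0|.
  rewrite -sumrB [d%:R * _]mulrC -mulrA mulr_suml [leRHS]big_mkcond /=.
  apply: ler_sum => k _.
  rewrite -mulrBr; case: ifPn => kS.
    rewrite ler_wpM2l// lerBlDl; apply: le_trans (l2norm_lipschitz _ _ th) _.
    by rewrite lerD2l distrC; exact: sum_abs_le.
  by rewrite inactive_group// sub0r mulrN oppr_le0 mulr_ge0// l2norm_ge0.
by rewrite /pen_rate mulrDl; move: H H1 H2; set a := \sum_i _; set b := \sum_k _; lra.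
Qed.

(** Setting a coordinate to zero saves its own weighted term and increases no group norm. *)
Lemma penalized_zeroed i : penalized th <= penalized (th - th 0 i *: e_ i) ->
  C i * `|th 0 i| <= L (th - th 0 i *: e_ i) - L th.
Proof.
set th' := th - _ => H.
have E j : th' 0 j = if j == i then 0 else th 0 j.
  rewrite !mxE eqxx /=; case: eqP => [->|_]; last by rewrite mulr0 subr0.
  by rewrite mulr1 subrr.
have le j : `|th' 0 j| <= `|th 0 j| by rewrite E; case: ifP; rewrite ?normr0.
have H1 : \sum_j C j * `|th' 0 j| <= \sum_j C j * `|th 0 j| - C i * `|th 0 i|.
  rewrite (bigD1 i)//= [in leRHS](bigD1 i)//= E eqxx normr0 mulr0 add0r [leRHS]addrAC subrr add0r.
  by apply: ler_sum => j _; rewrite ler_wpM2l.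
have H2 : \sum_k Eg k * l2norm (G k) th' <= \sum_k Eg k * l2norm (G k) th.
  by apply: ler_sum => k _; rewrite ler_wpM2l// l2norm_mono.
by move: H H1 H2; rewrite /penalized; set a := \sum_j _; set b := \sum_k _; lra.
Qed.

Hypothesis grG : is_grouping G.

(** Only the term of [i] and the one group containing [i] change, and this group is active, so
    [pen_rate] covers both. *)
Lemma penalized_shift i (h : R) : i \in supp theta0 ->
  penalized th <= penalized (th + h *: e_ i) ->
  - (pen_rate * `|h|) <= L (th + h *: e_ i) - L th.
Proof.
move=> iA; set th' := th + _ => H.
have E j : (th' - th) 0 j = if j == i then h else 0.
  rewrite addrC addKr !mxE eqxx /=.
  by case: eqP => _; rewrite ?mulr1 ?mulr0.
have H1 : \sum_j C j * `|th' 0 j| - \sum_j C j * `|th 0 j| <= (\sum_(j in supp theta0) C j) * `|h|.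
  rewrite -sumrB (bigD1 i)//= big1 ?addr0; last first.
    move=> j ji; have := E j; rewrite (negbTE ji) !mxE => /eqP; rewrite subr_eq0 => /eqP ->.
    by rewrite subrr.
  rewrite -mulrBr (bigD1 i iA) /= mulrDl.
  apply: le_trans (_ : C i * `|h| <= _); last first.
    by rewrite lerDl mulr_ge0// sumr_ge0.
  rewrite ler_wpM2l//; apply: le_trans (lerB_dist _ _) _.
  by have := E i; rewrite eqxx !mxE => ->.
have [_ uniqG exG] := grG.
have [k0 ik0] := exG i.
have k0S : k0 \in active_groups G theta0.
  by rewrite inE; apply/existsP; exists i; rewrite ik0 /=; rewrite inE in iA.
have H2 : \sum_k Eg k * l2norm (G k) th' - \sum_k Eg k * l2norm (G k) th
   <= (d%:R * \sum_(k in active_groups G theta0) Eg k) * `|h|.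
  rewrite -sumrB (bigD1 k0)//= big1 ?addr0; last first.
    move=> k kk0; have ik : i \notin G k.
      by apply: contra kk0 => ik; apply/eqP; exact: uniqG ik ik0.
    rewrite (_ : l2norm (G k) th' = l2norm (G k) th) ?subrr//.
    congr (Num.sqrt _); apply: eq_bigr => j jk; congr (_ ^+ 2).
    have ji : j != i by apply: contraNneq ik => <-.
    by have := E j; rewrite (negbTE ji) !mxE => /eqP; rewrite subr_eq0 => /eqP.
  rewrite -mulrBr; apply: le_trans (_ : Eg k0 * `|h| <= _).
    rewrite ler_wpM2l// lerBlDl; apply: le_trans (l2norm_lipschitz _ _ th) _.
    rewrite lerD2l (bigD1 i)//= E eqxx big1 ?addr0// => j /andP[_ ji].
    by rewrite E (negbTE ji) normr0.
  rewrite ler_wpM2r// (bigD1 k0 k0S) /=.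
  have d1 : 1 <= d%:R :> R by rewrite ler1n (leq_ltn_trans (leq0n i) (ltn_ord i)).
  apply: le_trans (_ : 1 * (Eg k0 + \sum_(j in active_groups G theta0 | j != k0) Eg j) <= _).
    by rewrite mul1r lerDl sumr_ge0.
  by rewrite ler_wpM2r// addr_ge0// sumr_ge0.
by move: H H1 H2; rewrite /penalized /pen_rate mulrDl; set a := \sum_j _; set b := \sum_k _; lra.
Qed.

End PenalizedArgmin.

(** * Deterministic analysis of a convex, locally almost quadratic loss *)

Section LocalQuadratic.
Context {R : realType} {d : nat}.
Variables (L : 'rV[R]_d -> R) (DL : 'I_d -> 'rV[R]_d -> R).
Variables (theta0 th : 'rV[R]_d) (Theta : set 'rV[R]_d).
Variables (s : 'I_d -> R) (h H : 'M[R]_d) (n R0 del Ks c pr : R).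
Local Notation e_ i := (delta_mx 0 i : 'rV[R]_d).

Hypotheses (n0 : 0 < n) (R00 : 0 < R0) (del0 : 0 < del) (pr0 : 0 <= pr).
Hypothesis cvxL : forall (x y : 'rV[R]_d) (t : R), Theta x -> Theta y -> 0 < t < 1 ->
  L (t *: y + (1 - t) *: x) <= t * L y + (1 - t) * L x.
Hypothesis gradL : forall x y : 'rV[R]_d, `|x - theta0| <= R0 / n -> Theta y ->
  \sum_j (y - x) 0 j * DL j x <= L y - L x.
Hypothesis ballT : forall x : 'rV[R]_d, `|x - theta0| <= R0 / n -> Theta x.
Hypothesis expL : forall i (v : 'rV[R]_d), `|v| <= R0 ->
  `|n * DL i (theta0 + n^-1 *: v) - (s i + \sum_k v 0 k * h k i)| <= del.
Hypothesis sK : forall i, `|s i| <= Ks.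
Hypothesis hH : forall k i, `|h k i - H k i| <= del.
Hypothesis Hc : forall v : 'rV[R]_d, c * `|v| ^+ 2 <= (v *m H *m v^T) 0 0.

Let ball_scaled (v : 'rV[R]_d) : `|v| <= R0 -> `|theta0 + n^-1 *: v - theta0| <= R0 / n.
Proof.
by move=> vR; rewrite addrC addKr normrZ gtr0_norm ?invr_gt0// mulrC ler_pM2r ?invr_gt0.
Qed.

Let mxE_le (A : 'M[R]_d) i j : `|A i j| <= `|A|.
Proof.
rewrite [leRHS]/Num.Def.normr /= mx_normrE.
exact: (@le_bigmax _ _ _ 0 (fun ij : 'I_d * 'I_d => `|A ij.1 ij.2|) (i, j)).
Qed.

Lemma quad_near (v : 'rV[R]_d) : c * `|v| ^+ 2 - d%:R ^+ 2 * del * `|v| ^+ 2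
  <= \sum_i v 0 i * \sum_k v 0 k * h k i.
Proof.
have E : (v *m H *m v^T) 0 0 = \sum_i v 0 i * \sum_k v 0 k * H k i.
  by rewrite mxE; apply: eq_bigr => i _; rewrite [v^T _ _]mxE mulrC mxE.
have B : `|\sum_i v 0 i * \sum_k v 0 k * (h k i - H k i)| <= d%:R * (`|v| * (d%:R * (`|v| * del))).
  apply: mvt_sum_bound => // i; first exact: coord_le_norm.
  by apply: mvt_sum_bound => // k; exact: coord_le_norm.
have D : \sum_i v 0 i * \sum_k v 0 k * (h k i - H k i) =
   \sum_i v 0 i * (\sum_k v 0 k * h k i) - \sum_i v 0 i * (\sum_k v 0 k * H k i).
  rewrite -sumrB; apply: eq_bigr => i _; rewrite -mulrBr -sumrB; congr (_ * _).
  by apply: eq_bigr => k _; rewrite mulrBr.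
have := Hc v; rewrite E; move: B; rewrite D ler_norml => /andP[b1 _] b2.
have -> : d%:R ^+ 2 * del * `|v| ^+ 2 = d%:R * (`|v| * (d%:R * (`|v| * del))) by ring.
lra.
Qed.

(* Two gradient inequalities, at [theta0] and half-way, replace a second-order
   Taylor expansion of [L]. *)
Lemma loss_lower (v : 'rV[R]_d) : `|v| <= R0 ->
  (c - d%:R ^+ 2 * del) * `|v| ^+ 2 / 4 - d%:R * Ks * `|v| - d%:R * del * `|v|
  <= n ^+ 2 * (L (theta0 + n^-1 *: v) - L theta0).
Proof.
move=> vR; pose v2 := (1/2) *: v.
have v2R : `|v2| <= R0.
  rewrite normrZ gtr0_norm ?divr_gt0//; have := normr_ge0 v; lra.
have z0 : `|theta0 - theta0| <= R0 / n by rewrite subrr normr0 divr_ge0// ltW.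
have g1 := gradL z0 (ballT (ball_scaled v2R)).
have g2 := gradL (ball_scaled v2R) (ballT (ball_scaled vR)).
have E1 : theta0 + n^-1 *: v2 - theta0 = (n^-1 / 2) *: v.
  by rewrite addrC addKr scalerA mulrA mulr1.
have E2 : theta0 + n^-1 *: v - (theta0 + n^-1 *: v2) = (n^-1 / 2) *: v.
  rewrite opprD addrACA subrr add0r -scalerBr /v2 -{1}[v]scale1r -scalerBl scalerA.
  by congr (_ *: _); field; rewrite gt_eqF.
pose S1 := \sum_j v 0 j * (n * DL j theta0).
pose S2 := \sum_j v 0 j * (n * DL j (theta0 + n^-1 *: v2)).
have G1 : \sum_j (theta0 + n^-1 *: v2 - theta0) 0 j * DL j theta0 = S1 / 2 / n ^+ 2.
  rewrite /S1 E1 !mulr_suml; apply: eq_bigr => j _; rewrite mxE.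
  by field; rewrite gt_eqF.
have G2 : \sum_j (theta0 + n^-1 *: v - (theta0 + n^-1 *: v2)) 0 j * DL j (theta0 + n^-1 *: v2)
    = S2 / 2 / n ^+ 2.
  rewrite /S2 E2 !mulr_suml; apply: eq_bigr => j _; rewrite mxE.
  by field; rewrite gt_eqF.
rewrite G1 in g1; rewrite G2 in g2.
have n20 : 0 < n ^+ 2 by rewrite exprn_gt0.
have low : (S1 + S2) / 2 <= n ^+ 2 * (L (theta0 + n^-1 *: v) - L theta0).
  rewrite [leRHS]mulrC -ler_pdivrMr//.
  have -> : (S1 + S2) / 2 / n ^+ 2 = S1 / 2 / n ^+ 2 + S2 / 2 / n ^+ 2 by rewrite !mulrDl.
  by move: g1 g2; lra.
apply: le_trans low.
have e0 : `|S1 - \sum_j v 0 j * s j| <= d%:R * (`|v| * del).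
  rewrite /S1 -sumrB; under eq_bigr do rewrite -mulrBr.
  apply: mvt_sum_bound => // j; first exact: coord_le_norm.
  have := expL j (v := 0); rewrite normr0 (ltW R00) => /(_ isT).
  rewrite scaler0 addr0 big1 ?addr0// => k _; rewrite mxE mul0r //.
have e2 : `|S2 - \sum_j v 0 j * (s j + \sum_k v2 0 k * h k j)| <= d%:R * (`|v| * del).
  rewrite /S2 -sumrB; under eq_bigr do rewrite -mulrBr.
  apply: mvt_sum_bound => // j; first exact: coord_le_norm.
  exact: expL.
have es : `|\sum_j v 0 j * s j| <= d%:R * (`|v| * Ks).
  by apply: mvt_sum_bound => // j; exact: coord_le_norm.
have eq2 : \sum_j v 0 j * (s j + \sum_k v2 0 k * h k j) =
   \sum_j v 0 j * s j + (\sum_j v 0 j * \sum_k v 0 k * h k j) / 2.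
  rewrite mulr_suml -big_split; apply: eq_bigr => j _; rewrite mulrDr; congr (_ + _).
  rewrite -mulrA; congr (_ * _); rewrite mulr_suml; apply: eq_bigr => k _.
  by rewrite mxE; field.
have q := quad_near v.
rewrite eq2 in e2; move: e0 e2 es q.
set A := \sum_j _ * s j; set B := \sum_j _ * \sum_k _.
rewrite !ler_norml => /andP[? ?] /andP[? ?] /andP[? ?] q.
have -> : (c - d%:R ^+ 2 * del) * `|v| ^+ 2 / 4 = (c * `|v| ^+ 2 - d%:R ^+ 2 * del * `|v| ^+ 2) / 4.
  by ring.
have -> : d%:R * Ks * `|v| = d%:R * (`|v| * Ks) by ring.
have -> : d%:R * del * `|v| = d%:R * (`|v| * del) by ring.
lra.
Qed.

Hypothesis Tth : Theta th.
Hypothesis upL : L th - L theta0 <= pr * `|th - theta0|.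
Hypothesis npr : n * pr <= del.

(** If [th] were farther away, the point of the segment from [theta0] to [th] at distance [rho / n]
    would, by convexity, have a scaled loss increase of at most [del * rho], against the growth
    given by [loss_lower]. *)
Lemma rate_bound rho : 0 < rho <= R0 ->
  d%:R * Ks + d%:R * del + del < (c - d%:R ^+ 2 * del) * rho / 4 ->
  n * `|th - theta0| <= rho.
Proof.
move=> /andP[rho0 rhoR] big; rewrite leNgt; apply/negP => far.
pose D := n * `|th - theta0|.
have D0 : 0 < D by apply: lt_trans far.
pose t := rho / D.
have t01 : 0 < t < 1 by rewrite divr_gt0//= ltr_pdivrMr// mul1r.
pose v := (t * n) *: (th - theta0).
have nv : `|v| = rho.
  have t0 : 0 < t by case/andP: t01.
  rewrite /v normrZ (gtr0_norm (mulr_gt0 t0 n0)) -mulrA -/D /t divfK// gt_eqF//.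
have vE : theta0 + n^-1 *: v = t *: th + (1 - t) *: theta0.
  rewrite /v scalerA (_ : n^-1 * (t * n) = t); last by field; rewrite gt_eqF.
  by rewrite scalerBr scalerBl scale1r addrCA.
have T0 : Theta theta0 by apply: ballT; rewrite subrr normr0 divr_ge0// ltW.
have := cvxL T0 Tth t01; rewrite -vE => c1.
have vR : `|v| <= R0 by rewrite nv.
have := loss_lower vR; rewrite nv => low.
have up : n ^+ 2 * (L (theta0 + n^-1 *: v) - L theta0) <= del * rho.
  apply: le_trans (_ : n ^+ 2 * (t * (pr * `|th - theta0|)) <= _).
    rewrite ler_wpM2l ?sqr_ge0//; case/andP: t01 => t0 _.
    apply: le_trans (_ : t * (L th - L theta0) <= _); last by rewrite ler_pM2l.
    by move: c1; lra.
  have -> : n ^+ 2 * (t * (pr * `|th - theta0|)) = (n * pr) * (t * D) by rewrite /D; ring.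
  by rewrite /t divfK ?gt_eqF// ler_wpM2r// ltW.
have := le_trans low up.
have -> : (c - d%:R ^+ 2 * del) * rho ^+ 2 / 4 - d%:R * Ks * rho - d%:R * del * rho =
   ((c - d%:R ^+ 2 * del) * rho / 4 - d%:R * Ks - d%:R * del) * rho by ring.
rewrite ler_pM2r//; lra.
Qed.

Variable rho : R.
Hypotheses (rho0 : 0 < rho) (rhoR : rho + del <= R0).
Hypothesis th_near : n * `|th - theta0| <= rho.

Let u : 'rV[R]_d := n *: (th - theta0).

Let u_le : `|u| <= rho. Proof. by rewrite normrZ gtr0_norm. Qed.

Let thE : th = theta0 + n^-1 *: u.
Proof. by rewrite scalerA mulVf ?gt_eqF// scale1r addrC subrK. Qed.

Let h_le k i : `|h k i| <= `|H| + del.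
Proof.
rewrite -(subrK (H k i) (h k i)); apply: le_trans (ler_normD _ _) _.
by rewrite addrC; apply: lerD; [exact: mxE_le|exact: hH].
Qed.

(** The gradient inequality is taken at the zeroed point, where it bounds the loss saved by a
    nonzero [th 0 i] by [|th 0 i|] times the partial derivative; dividing leaves [Ci] below the
    gradient, which is bounded on the ball. *)
Lemma sparsity_bound (Ci : R) i : theta0 0 i = 0 -> th 0 i != 0 ->
  Ci * `|th 0 i| <= L (th - th 0 i *: e_ i) - L th ->
  n * Ci <= Ks + d%:R * (rho * (`|H| + del)) + del.
Proof.
move=> t0i thi up; set th' := th - _ in up.
pose u' : 'rV[R]_d := u - u 0 i *: e_ i.
have u'E j : u' 0 j = if j == i then 0 else u 0 j.
  rewrite !mxE eqxx /=; case: eqP => [->|_]; last by rewrite mulr0 subr0.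
  by rewrite mulr1 subrr.
have u'_le : `|u'| <= rho.
  apply: rv_norm_le => [|j]; first exact: ltW.
  rewrite u'E; case: ifP => _; first by rewrite normr0 ltW.
  by apply: le_trans u_le; exact: coord_le_norm.
have th'E : th' = theta0 + n^-1 *: u'.
  apply/rowP => j.
  have thj : th 0 j = theta0 0 j + n^-1 * u 0 j by rewrite {1}thE !mxE.
  have -> : (theta0 + n^-1 *: u') 0 j = theta0 0 j + n^-1 * u' 0 j.
    by rewrite mxE; congr (_ + _); rewrite mxE.
  rewrite u'E; move: thj; set uj := u 0 j => thj.
  rewrite /th' !mxE eqxx /=; case: eqP => [->|_].
    by rewrite mulr1 subrr mulr0 t0i addr0.
  by rewrite mulr0 subr0.
have u'R : `|u'| <= R0 by apply: le_trans u'_le _; move: rhoR del0; lra.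
have near' : `|th' - theta0| <= R0 / n by rewrite th'E; exact: ball_scaled.
have := gradL near' Tth.
have -> : \sum_j (th - th') 0 j * DL j th' = th 0 i * DL i th'.
  rewrite (bigD1 i)//= big1 ?addr0 => [|j ji].
    by rewrite /th' opprB addrC subrK !mxE !eqxx mulr1.
  by rewrite /th' opprB addrC subrK !mxE (negbTE ji) andbF mulr0 mul0r.
move=> gr.
have tp : 0 < `|th 0 i| by rewrite normr_gt0.
have CD : Ci <= `|DL i th'|.
  rewrite -(ler_pM2r tp); apply: le_trans up _.
  have : - (`|DL i th'| * `|th 0 i|) <= th 0 i * DL i th'.
    by rewrite lerNl -mulNr mulrC; apply: le_trans (ler_norm _) _; rewrite normrM normrN.
  lra.
have := expL i u'R; rewrite -th'E => ex.
have sb : `|\sum_k u' 0 k * h k i| <= d%:R * (rho * (`|H| + del)).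
  apply: mvt_sum_bound => //; first exact: ltW.
  by move=> k; apply: le_trans (coord_le_norm _ _) u'_le.
have : n * `|DL i th'| <= Ks + d%:R * (rho * (`|H| + del)) + del.
  rewrite -(gtr0_norm n0) -normrM -(subrK (s i + \sum_k u' 0 k * h k i) (n * DL i th')).
  apply: le_trans (ler_normD _ _) _; rewrite addrC; apply: lerD => //.
  by apply: le_trans (ler_normD _ _) _; apply: lerD.
by apply: le_trans; rewrite ler_pM2l.
Qed.

(** Approximate stationarity on the active set: moving [th] by [del / n] cannot lower the loss by
    more than the penalty can gain, and the gradient at the moved point is almost affine. *)
Lemma score_bound i :
  (forall a, `|a| <= del / n -> - (pr * `|a|) <= L (th + a *: e_ i) - L th) ->
  `|s i + \sum_k u 0 k * H k i| <= del * (3 + `|H| + d%:R * rho + del).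
Proof.
move=> low.
(* One direction per sign, each giving one side of the bound. One [del] comes from [n * pr], one
   from [expL], and [del * (|H| + del)] from the displacement of the point. *)
have key (sg : R) : `|sg| = 1 ->
    - (2 * del + del * (`|H| + del)) <= sg * (s i + \sum_k u 0 k * h k i).
  move=> sg1.
  have sg2 : sg * sg = 1 by rewrite -[LHS]ger0_norm -?expr2 ?sqr_ge0// normrX sg1 expr1n.
  pose u' := u + (sg * del) *: e_ i.
  have ne : `|(sg * del) *: e_ i| <= del.
    by apply: le_trans (norm_e_le _ _) _; rewrite normrM sg1 mul1r gtr0_norm.
  have u'R : `|u'| <= R0.
    apply: le_trans (ler_normD _ _) (le_trans (lerD u_le ne) rhoR).
  pose a := n^-1 * (sg * del).
  have yE : th + a *: e_ i = theta0 + n^-1 *: u'.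
    by rewrite {1}thE -addrA; congr (_ + _); rewrite /u' scalerDr; congr (_ + _); rewrite scalerA.
  have near' : `|th + a *: e_ i - theta0| <= R0 / n by rewrite yE; exact: ball_scaled.
  have := gradL near' Tth.
  have -> : \sum_j (th - (th + a *: e_ i)) 0 j * DL j (th + a *: e_ i) = - a * DL i (th + a *: e_ i).
    rewrite opprD addNKr (bigD1 i)//= big1 ?addr0 => [|j ji].
      by rewrite !mxE !eqxx mulr1.
    by rewrite !mxE (negbTE ji) andbF mulr0 oppr0 mul0r.
  have na : `|a| = n^-1 * del.
    by rewrite !normrM sg1 mul1r !gtr0_norm ?invr_gt0.
  move=> gr; have lw : - (pr * `|a|) <= L (th + a *: e_ i) - L th.
    by apply: low; rewrite na mulrC.
  rewrite na in lw; rewrite yE in gr lw.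
  have ex := expL i u'R.
  set X := DL i _ in gr ex.
  have D1 : - (pr * (n^-1 * del)) <= a * X by lra.
  have D2 : - (n * pr) <= sg * (n * X).
    have p : 0 < n^-1 * del * n^-1 by rewrite !mulr_gt0 ?invr_gt0.
    rewrite -(ler_pM2l p).
    have -> : n^-1 * del * n^-1 * - (n * pr) = - (pr * (n^-1 * del)) by field; rewrite gt_eqF.
    have -> : n^-1 * del * n^-1 * (sg * (n * X)) = a * X by rewrite /a; field; rewrite gt_eqF.
    exact: D1.
  have E : \sum_k u' 0 k * h k i = \sum_k u 0 k * h k i + sg * del * h i i.
    have u'E k : u' 0 k = u 0 k + sg * del * (k == i)%:R.
      by rewrite mxE; congr (_ + _); rewrite !mxE eqxx.
    rewrite (bigD1 i)//= [in RHS](bigD1 i)//= u'E eqxx mulr1.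
    rewrite mulrDl addrAC; congr (_ + _ + _); apply: eq_bigr => k ki; congr (_ * _).
    by rewrite u'E (negbTE ki) mulr0 addr0.
  rewrite E in ex.
  have ex2 : `|sg * (n * X) - sg * (s i + (\sum_k u 0 k * h k i + sg * del * h i i))| <= del.
    by rewrite -mulrBr normrM sg1 mul1r.
  move: ex2; rewrite mulrDr [sg * (_ + sg * del * _)]mulrDr !mulrA sg2 mul1r ler_norml => /andP[_ ex2].
  have hii : `|del * h i i| <= del * (`|H| + del) by rewrite normrM gtr0_norm// ler_pM2l.
  move: hii; rewrite ler_norml mulrDr => /andP[_ hii].
  move: npr; lra.
have k1 := key 1 (normr1 R); have k2 := key (-1) (etrans (normrN 1) (normr1 R)).
rewrite mul1r in k1; rewrite mulN1r in k2.
have dH : `|\sum_k u 0 k * h k i - \sum_k u 0 k * H k i| <= d%:R * (rho * del).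
  rewrite -sumrB; under eq_bigr do rewrite -mulrBr.
  apply: mvt_sum_bound => //; first exact: ltW.
  by move=> k; apply: le_trans (coord_le_norm _ _) u_le.
have -> : del * (3 + `|H| + d%:R * rho + del) = 2 * del + del * (`|H| + del) + d%:R * (rho * del) + del.
  by ring.
move: dH k1 k2; set A := \sum_k _ * h k i; set B := \sum_k _ * H k i.
rewrite !ler_norml => /andP[? ?] ? ?; move: del0 => ?; apply/andP; split; lra.
Qed.

End LocalQuadratic.

(** * From the extended-real objective to a real penalized loss *)

Section RealObjective.
Context {R : realType} {E : Type} {d m : nat}.
Variables (G : 'I_m -> {set 'I_d}) (loss : E -> 'rV[R]_d -> R).
Variables (eta mu : R) (lambda gamma : nat -> R).
Variables (T : nat) (x : nat -> E) (tt : 'rV[R]_d).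
Hypotheses (grG : is_grouping G).
Hypotheses (lambda0 : forall T, 0 <= lambda T) (gamma0 : forall T, 0 <= gamma T).

Definition coord_weight i : \bar R := ((lambda T / T%:R)%:E * alpha eta tt i)%E.
Definition group_weight k : \bar R := ((gamma T / T%:R)%:E * xi G mu tt k)%E.

Lemma inve_powR_ge0 (a r : R) : (0 <= ((a `^ r)%:E)^-1)%E.
Proof. by rewrite inver; case: ifP => // _; rewrite lee_fin invr_ge0 powR_ge0. Qed.

Lemma coord_weight_ge0 i : (0 <= coord_weight i)%E.
Proof. by rewrite mule_ge0 ?inve_powR_ge0// lee_fin divr_ge0. Qed.

Lemma group_weight_ge0 k : (0 <= group_weight k)%E.
Proof. by rewrite mule_ge0 ?inve_powR_ge0// lee_fin divr_ge0. Qed.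

Lemma coord_weightE i : tt 0 i != 0 ->
  coord_weight i = (lambda T / T%:R * (`|tt 0 i| `^ eta)^-1)%:E.
Proof.
move=> ti; rewrite /coord_weight /alpha inver ifF -?EFinM//.
by apply/negbTE; rewrite gt_eqF// powR_gt0// normr_gt0.
Qed.

Lemma group_weightE k : 0 < l2norm (G k) tt ->
  group_weight k = (gamma T / T%:R * (l2norm (G k) tt `^ mu)^-1)%:E.
Proof.
move=> ti; rewrite /group_weight /xi inver ifF -?EFinM//.
by apply/negbTE; rewrite gt_eqF// powR_gt0.
Qed.

(** A zero first-step coordinate gives the weight [+oo]; positivity of [lambda T] excludes the
    product [0 * +oo = 0]. *)
Lemma coord_weight_infty i : 0 < eta -> 0 < lambda T -> (0 < T)%N ->
  coord_weight i != +oo%E -> tt 0 i != 0.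
Proof.
move=> e0 l0 T0; apply: contra_neq => ti.
rewrite /coord_weight /alpha ti normr0 powR0 ?gt_eqF// inve0 gt0_muley// lte_fin.
by rewrite divr_gt0// ltr0n.
Qed.

Lemma sgl_objectiveE theta : sgl_objective G loss eta mu lambda gamma T x tt theta =
  ((empirical_loss loss T x theta)%:E + \sum_i coord_weight i * `|theta 0 i|%:E
   + \sum_k group_weight k * (l2norm (G k) theta)%:E)%E.
Proof.
rewrite /sgl_objective; congr (_ + _ + _)%E.
  have -> : (\sum_(k < m) \sum_(i in G k) alpha eta tt i * `|theta 0 i|%:E =
      \sum_i alpha eta tt i * `|theta 0 i|%:E)%E.
    rewrite (exchange_big_dep predT)//=; apply: eq_bigr => i _.
    have [_ uniqG exG] := grG; have [k ik] := exG i.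
    rewrite (big_pred1 k)// => l /=; apply/idP/eqP => [il|->//].
    exact: uniqG il ik.
  rewrite ge0_sume_distrr => [|i _]; last by rewrite mule_ge0 ?inve_powR_ge0// lee_fin.
  by apply: eq_bigr => i _; rewrite muleA.
rewrite ge0_sume_distrr => [|k _]; last first.
  by rewrite mule_ge0 ?inve_powR_ge0// lee_fin l2norm_ge0.
by apply: eq_bigr => i _; rewrite muleA.
Qed.

(* The points at which every coordinate or group carrying an infinite weight
   vanishes, i.e. at which the objective is finite. *)
Definition compatible (theta : 'rV[R]_d) : Prop :=
  (forall i, coord_weight i = +oo%E -> theta 0 i = 0) /\
  (forall k, group_weight k = +oo%E -> l2norm (G k) theta = 0).

Local Notation pen := (penalized G (empirical_loss loss T x)
  (fun i => fine (coord_weight i)) (fun k => fine (group_weight k))).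

(** [fine] sends an infinite weight to 0, which is harmless because such a weight multiplies 0. *)
Lemma weighted_termE (c : \bar R) (r : R) : (0 <= c)%E -> (c = +oo%E -> r = 0) ->
  (c * r%:E = (fine c * r)%:E)%E.
Proof.
by case: c => [c| |]//= _ H; rewrite H// mule0 mul0r.
Qed.

Lemma sgl_objective_compatible theta : compatible theta ->
  sgl_objective G loss eta mu lambda gamma T x tt theta = (pen theta)%:E.
Proof.
move=> [ci ck]; rewrite sgl_objectiveE /penalized !EFinD -!sumEFin; congr (_ + _ + _)%E.
  by apply: eq_bigr => i _; rewrite weighted_termE ?coord_weight_ge0// => /ci ->; rewrite normr0.
by apply: eq_bigr => k _; rewrite weighted_termE ?group_weight_ge0// => /ck ->.
Qed.

Lemma finite_compatible theta :
  (sgl_objective G loss eta mu lambda gamma T x tt theta < +oo)%E -> compatible theta.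
Proof.
rewrite sgl_objectiveE => H.
have c0 i : (0 <= coord_weight i * `|theta 0 i|%:E)%E.
  by rewrite mule_ge0 ?coord_weight_ge0// lee_fin.
have e0 k : (0 <= group_weight k * (l2norm (G k) theta)%:E)%E.
  by rewrite mule_ge0 ?group_weight_ge0// lee_fin l2norm_ge0.
have S1 : (0 <= \sum_i coord_weight i * `|theta 0 i|%:E)%E by apply: sume_ge0.
have S2 : (0 <= \sum_k group_weight k * (l2norm (G k) theta)%:E)%E by apply: sume_ge0.
split=> [i ci|k ck].
  apply: contraPP H => /eqP ti; apply/negP; rewrite -leNgt leye_eq.
  suff -> : (\sum_i coord_weight i * `|theta 0 i|%:E = +oo)%E by rewrite addey// addye// gt_eqF// (lt_le_trans _ S2).
  rewrite (bigD1 i)//= ci gt0_mulye ?lte_fin ?normr_gt0// addye// gt_eqF//.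
  by rewrite (lt_le_trans ltNy0)// sume_ge0.
apply: contraPP H => /eqP ti; apply/negP; rewrite -leNgt leye_eq.
suff -> : (\sum_k group_weight k * (l2norm (G k) theta)%:E = +oo)%E.
  rewrite addey// gt_eqF// (lt_le_trans (ltNyr (empirical_loss loss T x theta)))//.
  by rewrite leeDl.
rewrite (bigD1 k)//= ck gt0_mulye ?lte_fin ?lt_neqAle ?l2norm_ge0 1?eq_sym ?ti//.
by rewrite addye// gt_eqF// (lt_le_trans ltNy0)// sume_ge0.
Qed.

Section Argmin.
Variables (Theta : set 'rV[R]_d) (theta0 th : 'rV[R]_d).
Hypothesis thmin : is_argmin_on Theta (sgl_objective G loss eta mu lambda gamma T x tt) th.
Hypothesis Theta0 : Theta theta0.
Hypothesis cA : forall i, i \in supp theta0 -> coord_weight i != +oo%E.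
Hypothesis eS : forall k, k \in active_groups G theta0 -> group_weight k != +oo%E.

(** Thus [theta0] has a finite objective, and so has the minimizer. The competitors used later stay
    compatible too, since zeroing enlarges nothing and active shifts touch finite weights only. *)
Lemma compatible_true : compatible theta0.
Proof.
split=> [i ci|k ck].
  apply/eqP; apply: contraPT ci => ti; apply/eqP/cA.
  by rewrite inE.
by apply: inactive_group; apply/negP => /eS /eqP.
Qed.

Lemma compatible_argmin : compatible th.
Proof.
apply: finite_compatible; apply: le_lt_trans (thmin.2 _ Theta0) _.
by rewrite sgl_objective_compatible ?ltry//; exact: compatible_true.
Qed.

Lemma penalized_argmin y : Theta y -> compatible y -> pen th <= pen y.
Proof.
move=> Ty cy; have := thmin.2 _ Ty.
by rewrite !sgl_objective_compatible// ?lee_fin//; exact: compatible_argmin.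
Qed.

Lemma compatible_zeroed i : compatible (th - th 0 i *: delta_mx 0 i).
Proof.
have [c1 c2] := compatible_argmin.
have Ej j : (th - th 0 i *: delta_mx 0 i : 'rV[R]_d) 0 j = if j == i then 0 else th 0 j.
  rewrite !mxE eqxx /=; case: eqP => [->|_]; last by rewrite mulr0 subr0.
  by rewrite mulr1 subrr.
split=> [j /c1 tj|k /c2 tk]; first by rewrite Ej tj; case: ifP.
apply/eqP; rewrite eq_le l2norm_ge0 andbT -tk; apply: l2norm_mono => j.
by rewrite Ej; case: ifP; rewrite ?normr0.
Qed.

Lemma compatible_shift i (a : R) : i \in supp theta0 -> compatible (th + a *: delta_mx 0 i).
Proof.
move=> iA; have [c1 c2] := compatible_argmin.
have Ej j : j != i -> (th + a *: delta_mx 0 i : 'rV[R]_d) 0 j = th 0 j.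
  by move=> /negbTE ji; rewrite !mxE ji andbF mulr0 addr0.
split=> [j cj|k ck].
  rewrite Ej ?c1//; apply: contra_eq_neq cj => ->; exact: cA.
rewrite -(c2 _ ck); congr (Num.sqrt _); apply: eq_bigr => j jk; rewrite Ej//.
apply: contra_eq_neq ck => ji; apply: eS.
by rewrite inE; apply/existsP; exists j; rewrite jk ji; move: iA; rewrite inE.
Qed.

End Argmin.

End RealObjective.

(** * Measurability and third derivatives of the loss *)

Section SmoothFamily.
Context {R : realType} {d : nat} {dE : measure_display} {E : measurableType dE}.
Variables (f : E -> 'rV[R]_d -> R) (W : set 'rV[R]_d).
Local Notation e_ i := (delta_mx 0 i : 'rV[R]_d).
Hypothesis openW : open W.
Hypothesis smW : forall e s x, W x -> {for x, continuous (partials (f e) s)} /\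
  forall i, derivable (partials (f e) s) x (e_ i).
Hypothesis measW : forall x, W x -> measurable_fun setT (fun e => f e x).

Lemma open_ball (x : 'rV[R]_d) : W x -> exists2 r : R, 0 < r &
  forall y, `|y - x| <= r -> W y.
Proof.
move=> Wx; have /nbhs_ballP[r /= r0 H] := open_nbhs_nbhs (conj openW Wx).
exists (r / 2) => [|y yx]; first by rewrite divr_gt0.
apply: H; rewrite -ball_normE /= distrC; apply: le_lt_trans yx _.
by rewrite ltr_pdivrMr// ltr_pMr// ltr1n.
Qed.

Lemma second_partials_commute e i j x : W x ->
  partials (f e) [:: i; j] x = partials (f e) [:: j; i] x.
Proof.
move=> Wx; have [r r0 ball] := open_ball Wx.
have d1 (y : 'rV[R]_d) k : `|y - x| <= r -> derivable (f e) y (e_ k).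
  by move=> yr; have [_] := smW e [::] (ball y yr); apply.
have d2 (y : 'rV[R]_d) k l : `|y - x| <= r -> derivable ('D_(e_ k) (f e)) y (e_ l).
  by move=> yr; have [_] := smW e [:: k] (ball y yr); apply.
have c1 := (smW e [:: i; j] Wx).1; have c2 := (smW e [:: j; i] Wx).1.
exact: (mixed_partials_commute r0 d1 d2 c1 c2).
Qed.

(** A partial derivative is the limit of difference quotients along a fixed sequence of steps
    staying in [W], so measurability propagates along [s]. *)
Lemma partials_measurable s x : W x -> measurable_fun setT (fun e => partials (f e) s x).
Proof.
elim: s x => [|i s IH] x Wx; first exact: measW.
have [r r0 ball] := open_ball Wx.
pose a n : R := r / n.+1%:R.
have a0 n : 0 < a n by rewrite divr_gt0.
have ar n : `|a n *: e_ i + x - x| <= r.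
  rewrite addrK; apply: le_trans (norm_e_le _ _) _.
  by rewrite gtr0_norm// ler_pdivrMr// ler_peMr ?ler1n// ltW.
apply: (@measurable_fun_cvg _ _ _ _
   (fun n e => (a n)^-1 * (partials (f e) s (a n *: e_ i + x) - partials (f e) s x))) => [n|e _].
  apply: measurable_funM; first exact: measurable_cst.
  by apply: measurable_funB; apply: IH => //; exact: ball.
have [_ /(_ i) dv] := smW e s Wx.
have a_cvg : a n @[n --> \oo] --> (0 : R).
  rewrite -[X in _ --> X](mulr0 r); apply: cvgM; first exact: cvg_cst.
  exact: cvg_harmonic.
have {}dv : (h^-1 * (partials (f e) s (h *: e_ i + x) - partials (f e) s x))
    @[h --> (0 : R)^'] --> 'D_(e_ i) (partials (f e) s) x by exact: dv.
have /cvgr_dnbhsP := dv; apply; split => // n; exact: lt0r_neq0.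
Qed.

Lemma rational_dense (v : 'rV[R]_d) (a : R) : 0 < a ->
  exists q : 'rV[rat]_d, `|map_mx ratr q - v| < a.
Proof.
move=> a0.
have H i : exists q : rat, `|ratr q - v 0 i| < a.
  have va : v 0 i - a < v 0 i + a by rewrite ltrD2l gtrN.
  have [q] := rat_in_itvoo va.
  by rewrite in_itv /= => qv; exists q; rewrite ltr_distl.
have [q qP] := choice H.
exists (\row_i q i); apply: rv_norm_lt => // i.
by rewrite !mxE; exact: qP.
Qed.

Section RationalSup.
Variables (theta0 : 'rV[R]_d) (rho : R).
Hypotheses (rho0 : 0 < rho) (ballW : forall y, `|y - theta0| <= 2 * rho -> W y).

Let pt (q : 'rV[rat]_d) : 'rV[R]_d := theta0 + rho *: map_mx ratr q.

Let pt_dist q : `|map_mx ratr q : 'rV[R]_d| <= 2 -> `|pt q - theta0| <= 2 * rho.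
Proof. by move=> q2; rewrite /pt addrC addKr normrZ gtr0_norm// mulrC ler_pM2r. Qed.

Let term (e : E) (n : nat) : \bar R :=
  if (unpickle n : option (3.-tuple 'I_d * 'rV[rat]_d)) is Some (s, q) then
    if `|map_mx ratr q : 'rV[R]_d| <= 2 then (`|partials (f e) s (pt q)|)%:E else 0%E
  else 0%E.

(* A measurable substitute for the supremum over the closed ball. *)
Definition ratsup (e : E) : \bar R := esups (term e) 0%N.

Let term_le e n : (term e n <= ratsup e)%E.
Proof. by apply: ereal_sup_ubound; exists n. Qed.

Lemma ratsup_measurable : measurable_fun setT ratsup.
Proof.
apply: measurable_fun_esups => n; rewrite /term; case: (unpickle n) => [[s q]|]; last exact: measurable_cst.
case: (boolP (`|map_mx ratr q : 'rV[R]_d| <= 2)) => [q2|_]; last exact: measurable_cst.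
apply/measurable_EFinP/measurableT_comp => //; apply: partials_measurable.
exact/ballW/pt_dist.
Qed.

Lemma ratsup_ge0 e : (0 <= ratsup e)%E.
Proof.
apply: le_trans (term_le e 0).
by rewrite /term; case: (unpickle 0) => [[s q]|//]; case: ifP; rewrite ?lee_fin.
Qed.

Lemma ratsup_le e (B : \bar R) : (0 <= B)%E ->
  (forall (s : 3.-tuple 'I_d) theta, `|theta - theta0| <= 2 * rho ->
    ((`|partials (f e) s theta|)%:E <= B)%E) -> (ratsup e <= B)%E.
Proof.
move=> B0 H; apply: ge_ereal_sup => _ [n _ <-] /=.
rewrite /term; case: (unpickle n) => [[s q]|//]; case: ifPn => // q2.
exact/H/pt_dist.
Qed.

Lemma ratsup_ge e (s : 3.-tuple 'I_d) theta : `|theta - theta0| <= rho ->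
  ((`|partials (f e) s theta|)%:E <= ratsup e)%E.
Proof.
move=> tr; pose v := rho^-1 *: (theta - theta0).
have v1 : `|v| <= 1.
  by rewrite normrZ gtr0_norm ?invr_gt0// mulrC ler_pdivrMr// mul1r.
have tE : theta = theta0 + rho *: v by rewrite scalerA mulfV ?gt_eqF// scale1r addrC subrK.
have Wt : W theta by apply: ballW; apply: le_trans tr _; rewrite ler_peMl ?ler1n// ltW.
have [cont _] := smW e s Wt.
apply/lee_addgt0Pr => a a0.
have [del del0 near] := continuous_for_dist cont a0.
have m0 : 0 < Order.min 1 (del / rho) by rewrite lt_min ltr01 divr_gt0.
have [q] := rational_dense v m0; rewrite lt_min => /andP[q1 qd].
have q2 : `|map_mx ratr q : 'rV[R]_d| <= 2.
  rewrite -(subrK v (map_mx _ _)); apply: le_trans (ler_normD _ _) _.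
  by rewrite -[2]/(1 + 1); apply: lerD => //; exact: ltW.
have pd : `|pt q - theta| < del.
  rewrite {1}tE /pt opprD addrACA subrr add0r -scalerBr normrZ gtr0_norm//.
  by rewrite mulrC -ltr_pdivlMr.
apply: le_trans (_ : ((`|partials (f e) s (pt q)|)%:E + a%:E <= _)%E).
  have := near _ pd; rewrite -EFinD lee_fin distrC => /ltW H.
  by rewrite -lerBlDl; apply: le_trans H; exact: lerB_dist.
rewrite leeD2r//; apply: le_trans (term_le e (pickle (s, q))).
by rewrite /term pickleK q2.
Qed.

End RationalSup.

End SmoothFamily.

Section SecondMoment.
Context {dO : measure_display} {Omega : measurableType dO} {R : realType}.
Variable P : probability Omega R.

(* The larger function need not be measurable: its integral is then a lower
   integral. *)
Lemma le_lower_integral (f g : Omega -> \bar R) : (forall w, (0 <= f w)%E) ->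
  (forall w, (f w <= g w)%E) -> (\int[P]_w f w <= \int[P]_w g w)%E.
Proof.
move=> f0 fg; rewrite !ge0_integralE//; last by move=> w _; exact: le_trans (fg w).
apply: le_ereal_sup => _ [h hf <-]; exists h => // w; apply: le_trans (hf w) _.
by rewrite !patch_setT.
Qed.

(** Chebyshev's inequality for the sum, whose second moment expands into the double sum of the
    hypothesis. *)
Lemma second_moment_average (y : nat -> Omega -> \bar R) (T : nat) (K Lb : R) :
  (forall t, measurable_fun setT (y t)) -> (forall t w, (0 <= y t w)%E) ->
  (0 < T)%N -> 0 < Lb ->
  (((T%:R ^+ 2)^-1)%:E * (\sum_(1 <= t < T.+1) \sum_(1 <= t' < T.+1)
     \int[P]_w (y t w * y t' w)) <= K%:E)%E ->
  (P [set w | ((T%:R * Lb)%:E <= \sum_(1 <= t < T.+1) y t w)%E] <= (K / Lb ^+ 2)%:E)%E.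
Proof.
move=> my y0 T0 Lb0; have TR : 0 < T%:R :> R by rewrite ltr0n.
pose S w := (\sum_(1 <= t < T.+1) y t w)%E.
have S0 w : (0 <= S w)%E by apply: sume_ge0.
have mS : measurable_fun setT S by apply: emeasurable_sum.
have SS w : (S w * S w = \sum_(1 <= t < T.+1) \sum_(1 <= t' < T.+1) y t w * y t' w)%E.
  rewrite {1}/S ge0_sume_distrl//; apply: eq_bigr => t _.
  by rewrite ge0_sume_distrr.
have IS : (\int[P]_w (S w * S w) = \sum_(1 <= t < T.+1) \sum_(1 <= t' < T.+1)
     \int[P]_w (y t w * y t' w))%E.
  under eq_integral do rewrite SS.
  rewrite ge0_integral_sum//; first last.
  - by move=> t w _; apply: sume_ge0 => t' _; exact: mule_ge0.
  - by move=> t; apply: emeasurable_sum => t' ; apply: emeasurable_funM.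
  apply: eq_bigr => t _; rewrite ge0_integral_sum//; first last.
  - by move=> t' w _; exact: mule_ge0.
  - by move=> t'; apply: emeasurable_funM.
rewrite -IS => HK.
pose a := (T%:R * Lb) ^+ 2.
have a0 : 0 < a by rewrite exprn_gt0// mulr_gt0.
have mSS : measurable_fun setT (fun w => S w * S w)%E by apply: emeasurable_funM.
have := @le_integral_comp_abse _ _ _ P _ measurableT _ a id (@measurable_id _ _ _) (fun r h => h)
  (fun x y _ _ h => h) mSS a0.
rewrite setTI => mk.
have sub : (P [set w | ((T%:R * Lb)%:E <= S w)%E] <= P [set w | (a%:E <= `|S w * S w|)%E])%E.
  apply: le_measure; rewrite ?inE.
  - rewrite -[X in measurable X]setTI; exact: emeasurable_fun_c_infty.
  - rewrite -[X in measurable X]setTI; apply: emeasurable_fun_c_infty => //.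
    exact: measurableT_comp.
  - move=> w /= H; rewrite gee0_abs ?mule_ge0// /a expr2 EFinM.
    by apply: lee_pmul => //; rewrite lee_fin mulr_ge0// ltW.
apply: le_trans sub _.
rewrite -(@lee_pmul2l _ a%:E)// ?lte_fin//; apply: le_trans mk _.
under eq_integral do rewrite gee0_abs ?mule_ge0//.
rewrite -(@lee_pmul2l _ ((T%:R ^+ 2)^-1)%:E)// ?lte_fin ?invr_gt0 ?exprn_gt0//.
apply: le_trans HK _; rewrite -!EFinM lee_fin /a.
have -> : (T%:R ^+ 2)^-1 * ((T%:R * Lb) ^+ 2 * (K / Lb ^+ 2)) = K.
  by field; rewrite (gt_eqF TR) gt_eqF.
by [].
Qed.

End SecondMoment.

Section ThirdDerivatives.
Context {dO : measure_display} {Omega : measurableType dO} {R : realType}.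
Variable P : probability Omega R.
Context {d m : nat} {dE : measure_display} {E : measurableType dE}.
Variables (X : nat -> Omega -> E) (loss : E -> 'rV[R]_d -> R).
Variables (G : 'I_m -> {set 'I_d}) (eta mu : R) (lambda gamma : nat -> R).
Variables (Theta W : set 'rV[R]_d) (theta0 : 'rV[R]_d) (ttheta : nat -> Omega -> 'rV[R]_d).
Hypotheses (lambda0 : forall T, 0 <= lambda T) (gamma0 : forall T, 0 <= gamma T).
Hypothesis mX : forall t, measurable_fun setT (X t).
Hypotheses (openW : open W) (Wtheta0 : W theta0) (WTheta : W `<=` Theta).
Hypothesis smW : forall e s x, W x -> {for x, continuous (partials (loss e) s)} /\
  forall i, derivable (partials (loss e) s) x (delta_mx 0 i).
Hypothesis measW : forall x, W x -> measurable_fun setT (fun e => loss e x).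

Lemma nu_ge (T : nat) (tt : 'rV[R]_d) :
  (((Num.sqrt T%:R)^-1)%:E <= nu G eta mu lambda gamma T theta0 tt)%E.
Proof.
have w0 S : (0 <= lambda S / S%:R)%R by rewrite divr_ge0.
have w1 S : (0 <= gamma S / S%:R)%R by rewrite divr_ge0.
rewrite /nu -addeA leeDl// adde_ge0// mule_ge0 ?lee_fin// mule_ge0 ?lee_fin//;
exact: bigmax_ge_id.
Qed.

(** [nu] is at least [1 / sqrt T], so with this constant the Euclidean ball of [upsilon] contains
    the sup-norm ball of radius [2 R0 / sqrt T]. The [+ 1] keeps the constant positive when
    [d = 0]. *)
Lemma ratsup_le_upsilon (R0 : R) T (tt : 'rV[R]_d) e : 0 < R0 -> (0 < T)%N ->
  (forall y, `|y - theta0| <= 2 * (R0 / Num.sqrt T%:R) -> W y) ->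
  (ratsup loss theta0 (R0 / Num.sqrt T%:R) e <=
    upsilon G loss eta mu lambda gamma Theta theta0 (d%:R * (2 * R0) + 1) T tt e)%E.
Proof.
move=> R00 T0 ball; have n0 : 0 < Num.sqrt (T%:R : R) by rewrite sqrtr_gt0 ltr0n.
have rho0 : 0 < R0 / Num.sqrt (T%:R : R) by rewrite divr_gt0.
apply: ratsup_le => [||s theta near]; [exact: rho0|by rewrite /upsilon; exact: bigmax_ge_id|].
apply: le_trans (le_bigmax _ _ s); apply: ereal_sup_ubound; exists theta => //; split.
  exact/WTheta/ball.
have C0 : 0 <= d%:R * (2 * R0) + 1 by rewrite addr_ge0// !mulr_ge0// ltW.
apply: le_trans (_ : (((Num.sqrt T%:R)^-1)%:E * (d%:R * (2 * R0) + 1)%:E <= _)%E); last first.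
  by apply: lee_wpmul2r; [rewrite lee_fin|exact: nu_ge].
rewrite -EFinM lee_fin; apply: le_trans (l2normT_le _) _.
apply: le_trans (_ : d%:R * (2 * (R0 / Num.sqrt T%:R)) <= _); first by rewrite ler_wpM2l.
have -> : d%:R * (2 * (R0 / Num.sqrt T%:R)) = (Num.sqrt T%:R)^-1 * (d%:R * (2 * R0)) :> R by ring.
by rewrite ler_wpM2l ?invr_ge0 ?sqrtr_ge0// lerDl.
Qed.

Hypothesis A6 : forall C : R, 0 < C -> exists K : R, forall T : nat, (0 < T)%N ->
  let ups (t : nat) (w : Omega) : \bar R :=
    upsilon G loss eta mu lambda gamma Theta theta0 C T (ttheta T w) (X t w) in
  (((T%:R ^+ 2)^-1)%:E * (\sum_(1 <= t < T.+1) \sum_(1 <= t' < T.+1)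
     \int[P]_w (ups t w * ups t' w)) <= K%:E)%E.

(** [ratsup] is measurable, which Chebyshev's inequality requires, and lies below [upsilon], so it
    inherits [A6]. Its real value at time [t] serves as [B t]. *)
Lemma third_derivatives_bounded (R0 e : R) : 0 < R0 -> 0 < e -> exists Lb : R,
  mostly P e (fun T => [set w | exists2 B : nat -> R,
    forall t (s : 3.-tuple 'I_d) theta, (1 <= t < T.+1)%N ->
      `|theta - theta0| <= R0 / Num.sqrt T%:R -> `|partials (loss (X t w)) s theta| <= B t &
    T%:R^-1 * \sum_(1 <= t < T.+1) B t <= Lb]).
Proof.
move=> R00 e0.
have C0 : 0 < d%:R * (2 * R0) + 1 by rewrite ltr_wpDl// !mulr_ge0// ltW.
have [K KP] := A6 C0.
pose K1 : R := `|K| + 1.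
have K10 : 0 < K1 by rewrite ltr_wpDl.
(* At this level the bound [K1 / Lb ^ 2] equals [e]. *)
pose Lb : R := Num.sqrt (K1 / e); have Lb0 : 0 < Lb by rewrite sqrtr_gt0 divr_gt0.
exists Lb; have [r r0 ballW] := open_ball openW Wtheta0.
near=> T.
have T0 : (0 < T)%N by near: T; exact: nbhs_infty_gt.
have TR : 0 < (T%:R : R) by rewrite ltr0n.
have n0 : 0 < Num.sqrt (T%:R : R) by rewrite sqrtr_gt0.
pose rho := R0 / Num.sqrt (T%:R : R).
have rho0 : 0 < rho by rewrite divr_gt0.
have rr : 2 * rho <= r.
  rewrite /rho mulrA ler_pdivrMr// -ler_pdivrMl//.
  have q0 : 0 <= r^-1 * (2 * R0) by rewrite !mulr_ge0 ?invr_ge0 ?(ltW r0) ?(ltW R00).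
  rewrite -(ger0_norm q0) -sqrtr_sqr ler_wsqrtr//.
  by near: T; exact: nbhs_infty_ger.
have ball y : `|y - theta0| <= 2 * rho -> W y by move=> h; apply: ballW; exact: le_trans rr.
pose y t w := ratsup loss theta0 rho (X t w).
have my t : measurable_fun setT (y t).
  apply: measurableT_comp; [exact: (ratsup_measurable openW smW measW rho0 ball)|exact: mX].
have y0 t w : (0 <= y t w)%E by exact: ratsup_ge0.
have HK : (((T%:R ^+ 2)^-1)%:E * (\sum_(1 <= t < T.+1) \sum_(1 <= t' < T.+1)
     \int[P]_w (y t w * y t' w)) <= K1%:E)%E.
  apply: le_trans (_ : (K%:E <= _)%E); last first.
    by rewrite lee_fin (le_trans (ler_norm _))// lerDl.
  apply: le_trans (KP T T0); apply: lee_wpmul2l; first by rewrite lee_fin invr_ge0 sqr_ge0.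
  apply: lee_sum => t _; apply: lee_sum => t' _; apply: le_lower_integral => w.
    exact: mule_ge0.
  by apply: lee_pmul => //; exact: ratsup_le_upsilon.
exists [set w | ((T%:R * Lb)%:E <= \sum_(1 <= t < T.+1) y t w)%E]; split.
- rewrite -[X in measurable X]setTI; apply: emeasurable_fun_c_infty => //.
  exact: emeasurable_sum.
- apply: le_trans (second_moment_average my y0 T0 Lb0 HK) _.
  rewrite lee_fin /Lb sqr_sqrtr ?divr_ge0 ?(ltW K10) ?(ltW e0)//.
  have -> : K1 / (K1 / e) = e by field; rewrite (gt_eqF K10) (gt_eqF e0).
  exact: lexx.
move=> w /= /negP; rewrite -ltNge => lt.
have fin t : (1 <= t < T.+1)%N -> y t w \is a fin_num.
  move=> tT; rewrite ge0_fin_numE//; apply: le_lt_trans (lt_trans lt (ltry _)).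
  rewrite (bigD1_seq t)/= ?mem_index_iota ?iota_uniq//.
  by rewrite leeDl// sume_ge0.
exists (fun t => fine (y t w)) => [t s theta tT near|].
  by rewrite -lee_fin fineK ?fin//; exact: (ratsup_ge smW rho0 ball).
rewrite ler_pdivrMl// -lee_fin; apply: le_trans (ltW lt).
rewrite -sumEFin [leLHS]big_nat [leRHS]big_nat; apply: lee_sum => t tT.
by rewrite fineK ?fin.
Unshelve. all: by end_near.
Qed.

End ThirdDerivatives.

(** * Boundedness in probability of the normalized score *)

Section ScoreTightness.
Context {dO : measure_display} {Omega : measurableType dO} {R : realType}.
Variable P : probability Omega R.
Variable F : nat -> set (set Omega).
Hypothesis filtF : filtration F.
Variable X : nat -> Omega -> R.
Hypothesis mdX : martingale_difference P F X.
Hypothesis X2 : forall t, L1 P (fun w => X t w ^+ 2).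
Variable s2 : R.
Hypothesis EX2 : forall t, Ex P (fun w => X t w ^+ 2) = s2.

Lemma md_sum_Fm T : Fm F T (fun w => \sum_(1 <= t < T.+1) X t w).
Proof.
rewrite (_ : (fun w => _) = (fun w => \sum_(t < T) X t.+1 w)); last first.
  by apply/funext => w; rewrite big_add1 big_mkord.
have H (t : 'I_T) : Fm F T (X t.+1) by apply: (Fm_le filtF (ltn_ord t)); exact: (md_Fm filtF mdX).
rewrite /Fm; apply: measurable_sum => t; exact: H.
Qed.

(** The cross term of each new summand with the past sum is integrable, both being square
    integrable, and vanishes by [md_orth_L1]. *)
Lemma md_sum_second_moment T :
  L1 P (fun w => (\sum_(1 <= t < T.+1) X t w) ^+ 2) /\
  Ex P (fun w => (\sum_(1 <= t < T.+1) X t w) ^+ 2) = T%:R * s2.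
Proof.
elim: T => [|T [hS ES]].
  have E w : (\sum_(1 <= t < 1) X t w) ^+ 2 = 0 by rewrite big_geq// expr0n.
  by split; [under eq_fun do rewrite E; exact: L1_cst|rewrite (Ex_ext P E) Ex_cst mul0r].
pose S w := \sum_(1 <= t < T.+1) X t w.
have E w : (\sum_(1 <= t < T.+2) X t w) ^+ 2 = S w ^+ 2 + (2 * (S w * X T.+1 w) + X T.+1 w ^+ 2).
  by rewrite big_nat_recr//= -/(S w); ring.
have hSX : L1 P (fun w => S w * X T.+1 w).
  apply: L1_le (L1D hS (X2 T.+1)) => [|w].
    apply: measurable_funM; last exact: (L1_meas (md_L1 mdX _)).
    by apply: (@Fm_meas _ _ _ F filtF T S); exact: md_sum_Fm.
  rewrite normrM -[S w ^+ 2]real_normK ?num_real// -[X _ _ ^+ 2]real_normK ?num_real//.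
  set a := `|S w|; set b := `|X _ _|.
  have : 0 <= (a - b) ^+ 2 by exact: sqr_ge0.
  have : 0 <= a * b by apply: mulr_ge0; exact: normr_ge0.
  by rewrite sqrrB; lra.
have h2 : L1 P (fun w => 2 * (S w * X T.+1 w)) by exact: L1Z.
split; first by under eq_fun do rewrite E; apply: L1D => //; exact: L1D.
rewrite (Ex_ext P E) ExD//; last exact: L1D.
have E0 : Ex P (fun w => S w * X T.+1 w) = 0.
  by apply: (md_orth_L1 filtF mdX) hSX; exact: md_sum_Fm.
rewrite ExD// ExZ// E0 EX2 ES.
by rewrite -natr1; ring.
Qed.

Lemma score_tight (e : R) : 0 < e -> exists K : R, mostly P e (fun T => [set w |
  `|(Num.sqrt T%:R)^-1 * (\sum_(1 <= t < T.+1) X t w)| <= K]).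
Proof.
move=> e0.
have s20 : 0 <= s2 by rewrite -(EX2 0); apply: Ex_ge0 => w; exact: sqr_ge0.
pose c : R := (s2 + 1) / e; have c0 : 0 < c by rewrite divr_gt0// ltr_wpDl.
exists (Num.sqrt c); near=> T.
have T0 : (0 < T)%N by near: T; exact: nbhs_infty_gt.
have TR : 0 < (T%:R : R) by rewrite ltr0n.
have [hS ES] := md_sum_second_moment T.
pose Y w := T%:R^-1 * (\sum_(1 <= t < T.+1) X t w) ^+ 2.
have hY : L1 P Y by exact: L1Z.
exists [set w | c <= Y w]; split.
- exact: meas_le (measurable_cst _) (L1_meas hY).
- have Y0 w : 0 <= Y w by rewrite mulr_ge0// sqr_ge0.
  apply: le_trans (markov_real hY Y0 c0) _.
  rewrite lee_fin ExZ// ES mulrA mulVf ?gt_eqF// mul1r ler_pdivrMr// /c mulrC divfK ?gt_eqF//.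
  by rewrite lerDl.
move=> w /= /negP; rewrite -ltNge => lt.
rewrite -sqrtr_sqr ler_wsqrtr// exprMn exprVn sqr_sqrtr ?ltW//.
Unshelve. all: by end_near.
Qed.

End ScoreTightness.

Section EmpiricalLoss.
Context {R : realType} {d : nat} {dE : measure_display} {E : measurableType dE}.
Variables (loss : E -> 'rV[R]_d -> R) (Theta W : set 'rV[R]_d) (theta0 : 'rV[R]_d).
Variables (T : nat) (x : nat -> E).
Local Notation e_ i := (delta_mx 0 i : 'rV[R]_d).
Hypotheses (openW : open W) (WTheta : W `<=` Theta).
Hypothesis smW : forall e s x, W x -> {for x, continuous (partials (loss e) s)} /\
  forall i, derivable (partials (loss e) s) x (e_ i).
Hypothesis cvx : forall e, strictly_convex_on Theta (loss e).
Hypothesis T0 : (0 < T)%N.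

Definition empirical_partial (s : seq 'I_d) (y : 'rV[R]_d) : R :=
  T%:R^-1 * \sum_(1 <= t < T.+1) partials (loss (x t)) s y.

Definition score (i : 'I_d) : R :=
  (Num.sqrt T%:R)^-1 * \sum_(1 <= t < T.+1) partials (loss (x t)) [:: i] theta0.

Lemma loss_convex e (y z : 'rV[R]_d) t : Theta y -> Theta z -> 0 < t < 1 ->
  loss e (t *: z + (1 - t) *: y) <= t * loss e z + (1 - t) * loss e y.
Proof.
move=> Ty Tz t01; have [->|zy] := eqVneq z y.
  by rewrite -scalerDl -mulrDl subrKC scale1r mul1r.
exact/ltW/cvx.
Qed.

Lemma empirical_loss_convex (y z : 'rV[R]_d) t : Theta y -> Theta z -> 0 < t < 1 ->
  empirical_loss loss T x (t *: z + (1 - t) *: y) <=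
  t * empirical_loss loss T x z + (1 - t) * empirical_loss loss T x y.
Proof.
move=> Ty Tz t01; rewrite /empirical_loss ![_ * (T%:R^-1 * _)]mulrCA -mulrDr.
rewrite ler_wpM2l ?invr_ge0// !mulr_sumr -big_split /=.
by apply: ler_sum => u _; exact: loss_convex.
Qed.

Lemma empirical_gradient_ineq (y z : 'rV[R]_d) : W y -> Theta z ->
  \sum_j (z - y) 0 j * empirical_partial [:: j] y <=
  empirical_loss loss T x z - empirical_loss loss T x y.
Proof.
move=> Wy Tz; have [r r0 ball] := open_ball openW Wy.
rewrite /empirical_loss -mulrBr -sumrB.
have -> : \sum_j (z - y) 0 j * empirical_partial [:: j] y = T%:R^-1 *
    \sum_(1 <= t < T.+1) \sum_j (z - y) 0 j * partials (loss (x t)) [:: j] y.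
  rewrite exchange_big /= mulr_sumr; apply: eq_bigr => j _.
  by rewrite /empirical_partial mulrCA mulr_sumr.
rewrite ler_wpM2l ?invr_ge0//; apply: ler_sum => t _.
apply: (@convex_gradient_ineq _ _ (loss (x t)) y z r r0).
- by move=> u u01; apply: loss_convex => //; exact: WTheta.
- by move=> v i yv; have [_] := smW (x t) [::] (ball v yv); apply.
- by move=> i; have [] := smW (x t) [:: i] Wy.
Qed.

(** Each summand has a Taylor remainder of order [(R0 / n) ^ 2 * B t]; averaging and multiplying by
    [n] leaves one factor [1 / n]. *)
Lemma gradient_expansion (R0 Lb : R) (B : nat -> R) i (v : 'rV[R]_d) : 0 < R0 ->
  (forall y, `|y - theta0| <= R0 / Num.sqrt T%:R -> W y) ->
  (forall t (s : 3.-tuple 'I_d) theta, (1 <= t < T.+1)%N ->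
     `|theta - theta0| <= R0 / Num.sqrt T%:R -> `|partials (loss (x t)) s theta| <= B t) ->
  T%:R^-1 * \sum_(1 <= t < T.+1) B t <= Lb -> `|v| <= R0 ->
  `|Num.sqrt T%:R * empirical_partial [:: i] (theta0 + (Num.sqrt T%:R)^-1 *: v)
    - (score i + \sum_k v 0 k * empirical_partial [:: k; i] theta0)|
  <= d%:R ^+ 2 * R0 ^+ 2 * Lb / Num.sqrt T%:R.
Proof.
move=> R00 ball HB HL vR.
have TR : 0 < (T%:R : R) by rewrite ltr0n.
set n := Num.sqrt T%:R in ball HB *; have n0 : 0 < n by rewrite sqrtr_gt0.
have n2 : T%:R = n ^+ 2 by rewrite sqr_sqrtr// ltW.
pose v' := n^-1 *: v.
have v'E k : v' 0 k = n^-1 * v 0 k by rewrite mxE.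
have v'R : `|v'| <= R0 / n by rewrite normrZ gtr0_norm ?invr_gt0// mulrC ler_pM2r ?invr_gt0.
pose rem t := partials (loss (x t)) [:: i] (theta0 + v') - partials (loss (x t)) [:: i] theta0
  - \sum_k v' 0 k * partials (loss (x t)) [:: k; i] theta0.
have Hrem t : (1 <= t < T.+1)%N -> `|rem t| <= d%:R ^+ 2 * (R0 / n) ^+ 2 * B t.
  move=> tT.
  have B0 : 0 <= B t.
    apply: le_trans (HB t [tuple i; i; i] theta0 tT _); first exact: normr_ge0.
    by rewrite subrr normr0 divr_ge0// ltW.
  apply: le_trans (_ : d%:R ^+ 2 * `|v'| ^+ 2 * B t <= _); last first.
    rewrite ler_wpM2r// ler_wpM2l ?sqr_ge0// ler_sqr ?nnegrE//.
    by rewrite divr_ge0// ltW.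
  apply: (@taylor1_bound _ _ (partials (loss (x t)) [:: i]) theta0 v' (R0 / n) (B t) v'R).
  - by move=> y k yr; have [_] := smW (x t) [:: i] (ball y yr); apply.
  - by move=> y k l yr; have [_] := smW (x t) [:: k; i] (ball y yr); apply.
  - by move=> y k l yr; exact: (HB t [tuple l; k; i] y tT yr).
have -> : n * empirical_partial [:: i] (theta0 + n^-1 *: v)
    - (score i + \sum_k v 0 k * empirical_partial [:: k; i] theta0) =
    n^-1 * \sum_(1 <= t < T.+1) rem t.
  rewrite /rem !sumrB !mulrBr opprD addrA; congr (_ - _ - _).
  - rewrite /empirical_partial n2 mulrA; congr (_ * _).
    by field; rewrite gt_eqF.
  - rewrite exchange_big /= mulr_sumr; apply: eq_bigr => k _.
    rewrite /empirical_partial -mulr_sumr v'E n2 !mulrA; congr (_ * _).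
    by field; rewrite gt_eqF.
rewrite normrM gtr0_norm ?invr_gt0// mulrC ler_pM2r ?invr_gt0//.
apply: le_trans (ler_norm_sum _ _ _) _.
apply: le_trans (_ : \sum_(1 <= t < T.+1) d%:R ^+ 2 * (R0 / n) ^+ 2 * B t <= _).
  by rewrite big_nat [leRHS]big_nat; apply: ler_sum.
rewrite -mulr_sumr; move: HL; rewrite n2 => HL.
have -> : d%:R ^+ 2 * (R0 / n) ^+ 2 * \sum_(1 <= t < T.+1) B t =
   d%:R ^+ 2 * R0 ^+ 2 * ((n ^+ 2)^-1 * \sum_(1 <= t < T.+1) B t).
  by field; rewrite gt_eqF.
by rewrite ler_wpM2l// mulr_ge0// sqr_ge0.
Qed.

End EmpiricalLoss.

(** * Rates and selection consistency *)

Section PathEstimates.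
Context {R : realType} {d m : nat} {dE : measure_display} {E : measurableType dE}.
Variables (G : 'I_m -> {set 'I_d}) (loss : E -> 'rV[R]_d -> R).
Variables (eta mu : R) (lambda gamma : nat -> R).
Variables (Theta W : set 'rV[R]_d) (theta0 : 'rV[R]_d) (H : 'M[R]_d).
Variables (T : nat) (x : nat -> E) (tt th : 'rV[R]_d).
Variables (R0 rho del Ks c Lb : R) (B : nat -> R).
Local Notation e_ i := (delta_mx 0 i : 'rV[R]_d).
Local Notation n := (Num.sqrt T%:R : R).
Local Notation Cw := (fun i => fine (coord_weight eta lambda T tt i)).
Local Notation Ew := (fun k => fine (group_weight G mu gamma T tt k)).

Hypothesis grG : is_grouping G.
Hypotheses (lambda0 : forall T, 0 <= lambda T) (gamma0 : forall T, 0 <= gamma T).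
Hypotheses (openW : open W) (WTheta : W `<=` Theta).
Hypothesis smW : forall e s x, W x -> {for x, continuous (partials (loss e) s)} /\
  forall i, derivable (partials (loss e) s) x (e_ i).
Hypothesis cvx : forall e, strictly_convex_on Theta (loss e).
Hypotheses (T0 : (0 < T)%N) (eta0 : 0 < eta) (lambdaT : 0 < lambda T).
Hypotheses (rho0 : 0 < rho) (del0 : 0 < del) (rhoR : rho + del <= R0).
Hypothesis thmin : is_argmin_on Theta (sgl_objective G loss eta mu lambda gamma T x tt) th.
Hypothesis ball : forall y, `|y - theta0| <= R0 / n -> W y.
Hypothesis sK : forall i, `|score loss theta0 T x i| <= Ks.
Hypothesis hH : forall k i,
  `|empirical_partial loss T x [:: k; i] theta0 - H k i| <= del.
Hypothesis HB : forall t (s : 3.-tuple 'I_d) theta, (1 <= t < T.+1)%N ->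
  `|theta - theta0| <= R0 / n -> `|partials (loss (x t)) s theta| <= B t.
Hypothesis HL : T%:R^-1 * \sum_(1 <= t < T.+1) B t <= Lb.
Hypothesis Lbdel : d%:R ^+ 2 * R0 ^+ 2 * Lb / n <= del.
Hypothesis Hc : forall v : 'rV[R]_d, c * `|v| ^+ 2 <= (v *m H *m v^T) 0 0.
Hypothesis big : d%:R * Ks + d%:R * del + del < (c - d%:R ^+ 2 * del) * rho / 4.
Hypothesis cA : forall i, i \in supp theta0 -> coord_weight eta lambda T tt i != +oo%E.
Hypothesis eS : forall k, k \in active_groups G theta0 ->
  group_weight G mu gamma T tt k != +oo%E.
Hypothesis small : n * pen_rate G Cw Ew theta0 <= del.
Hypothesis large : forall i, i \notin supp theta0 -> tt 0 i != 0 ->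
  Ks + d%:R * (rho * (`|H| + del)) + del < n * Cw i.

(** Combines the deterministic bounds on a single path; randomness enters only through the
    hypotheses on the score, Hessian, third derivatives and weights. *)
Lemma path_estimates :
  [/\ n * `|th - theta0| <= rho, forall i, i \notin supp theta0 -> th 0 i = 0 &
    forall i, i \in supp theta0 -> `|score loss theta0 T x i
       + \sum_k (n *: (th - theta0)) 0 k * H k i|
      <= del * (3 + `|H| + d%:R * rho + del)].
Proof.
have n0 : 0 < n by rewrite sqrtr_gt0 ltr0n.
have R00 : 0 < R0 by apply: lt_le_trans rhoR; rewrite addr_gt0.
have Wt0 : W theta0 by apply: ball; rewrite subrr normr0 divr_ge0 ?(ltW R00) ?(ltW n0).
have Tt0 := WTheta Wt0; have Tth := thmin.1.
pose h := \matrix_(k, i) empirical_partial loss T x [:: k; i] theta0.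
have C0 i : 0 <= Cw i by rewrite fine_ge0// coord_weight_ge0.
have E0 k : 0 <= Ew k by rewrite fine_ge0// group_weight_ge0.
pose pr := pen_rate G Cw Ew theta0.
have pr0 : 0 <= pr by exact: pen_rate_ge0.
pose L := empirical_loss loss T x.
have cvxL (y z : 'rV[R]_d) (t : R) : Theta y -> Theta z -> 0 < t < 1 ->
    L (t *: z + (1 - t) *: y) <= t * L z + (1 - t) * L y.
  exact: empirical_loss_convex.
pose DL j := empirical_partial loss T x [:: j].
have gradL (y z : 'rV[R]_d) : `|y - theta0| <= R0 / n -> Theta z ->
    \sum_j (z - y) 0 j * DL j y <= L z - L y.
  move=> yr Tz; apply: (empirical_gradient_ineq T x openW WTheta smW cvx) => //.
  exact: ball.
have ballT (y : 'rV[R]_d) : `|y - theta0| <= R0 / n -> Theta y by move=> yr; exact/WTheta/ball.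
have expL i (v : 'rV[R]_d) : `|v| <= R0 ->
    `|n * DL i (theta0 + n^-1 *: v) - (score loss theta0 T x i + \sum_k v 0 k * h k i)| <= del.
  move=> vR; apply: le_trans Lbdel; 
  rewrite (eq_bigr (fun k => v 0 k * empirical_partial loss T x [:: k; i] theta0)); last first.
    by move=> k _; rewrite mxE.
  have := gradient_expansion smW T0 i R00 ball HB HL vR. by [].
have hH' k i : `|h k i - H k i| <= del by rewrite mxE; exact: hH.
have pmin := penalized_argmin grG lambda0 gamma0 thmin Tt0 cA eS.
have upL : L th - L theta0 <= pr * `|th - theta0|.
  apply: (penalized_le_loss C0 E0); apply: pmin => //.
  exact: (compatible_true cA eS).
have rr : 0 < rho <= R0 by rewrite rho0 (le_trans _ rhoR)// lerDl ltW.
have near := rate_bound n0 R00 cvxL gradL ballT expL sK hH' Hc Tth upL small rr big.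
split => // i.
- rewrite inE negbK => /eqP t0i; apply/eqP; apply: contraT => thi.
  have iA : i \notin supp theta0 by rewrite inE negbK t0i.
  (* Otherwise the weight is infinite, and compatibility already gives [th 0 i = 0]. *)
  have tti : tt 0 i != 0.
    have [c1 _] := compatible_argmin grG lambda0 gamma0 thmin Tt0 cA eS.
    apply: (coord_weight_infty eta0 lambdaT T0).
    by apply: contraNneq thi => /c1 ->.
  (* The competitor is feasible: zeroing moves the coordinate to its true value, so the distance to
     [theta0] does not grow. *)
  have Tz : Theta (th - th 0 i *: e_ i).
    apply: ballT; apply: le_trans (_ : rho / n <= _); last first.
      by rewrite ler_pM2r ?invr_gt0//; case/andP: rr.
    apply: rv_norm_le => [|j]; first by rewrite divr_ge0 ?(ltW rho0) ?(ltW n0).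
    apply: le_trans (_ : `|(th - theta0) 0 j| <= _); last first.
      by apply: le_trans (coord_le_norm _ _) _; rewrite ler_pdivlMr// mulrC.
    rewrite !mxE eqxx /=; case: eqP => [->|_]; last by rewrite mulr0 subr0.
    by rewrite mulr1 subrr t0i subrr normr0.
  have pz := pmin _ Tz (compatible_zeroed grG lambda0 gamma0 thmin Tt0 cA eS i).
  have := sparsity_bound n0 del0 gradL expL sK hH' Tth rho0 rhoR near t0i thi
    (penalized_zeroed C0 E0 pz).
  by move=> /(lt_le_trans (large iA tti)); rewrite ltxx.
- move=> iA.
  apply: (score_bound n0 del0 gradL expL hH' Tth small rho0 rhoR near) => a an.
  apply: (penalized_shift C0 E0 grG iA); apply: pmin.
    apply: ballT; rewrite addrAC; apply: le_trans (ler_normD _ _) _.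
    apply: le_trans (_ : rho / n + del / n <= _); last by rewrite -mulrDl ler_pM2r ?invr_gt0.
    apply: lerD; first by rewrite ler_pdivlMr// mulrC.
    by apply: le_trans (norm_e_le _ _) _.
  exact: (compatible_shift grG lambda0 gamma0 thmin Tt0 cA eS).
Qed.

End PathEstimates.

Section WeightRates.
Context {R : realType} {d m : nat}.
Variables (G : 'I_m -> {set 'I_d}) (eta mu : R) (lambda gamma : nat -> R).
Variables (T : nat) (theta0 tt : 'rV[R]_d).
Local Notation n := (Num.sqrt T%:R : R).
Local Notation Cw := (fun i => fine (coord_weight eta lambda T tt i)).
Local Notation Ew := (fun k => fine (group_weight G mu gamma T tt k)).
Hypotheses (lambda0 : forall T, 0 <= lambda T) (gamma0 : forall T, 0 <= gamma T).
Hypotheses (eta0 : 0 < eta) (mu0 : 0 < mu) (T0 : (0 < T)%N).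

Let n0 : 0 < n. Proof. by rewrite sqrtr_gt0 ltr0n. Qed.
Let scale (y z : R) : n * (y / T%:R * z) = y / n * z.
Proof.
have -> : (T%:R : R)^-1 = n^-1 * n^-1 by rewrite -invfM -expr2 sqr_sqrtr.
by move: n0; set q := n => q0; rewrite !mulrA; congr (_ * _); field; rewrite gt_eqF.
Qed.

Section Active.
Variable a : R.
Hypotheses (a0 : 0 < a) (att : forall i, i \in supp theta0 -> a <= `|tt 0 i|).

Let tt_neq0 i : i \in supp theta0 -> tt 0 i != 0.
Proof. by move=> /att h; rewrite -normr_gt0 (lt_le_trans a0). Qed.

Let group_ge k : k \in active_groups G theta0 -> a <= l2norm (G k) tt.
Proof.
rewrite inE => /existsP[i /andP[ik i0]]; apply: le_trans (coord_le_l2norm tt ik).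
by apply: att; rewrite inE.
Qed.

Lemma coord_weight_fin i : i \in supp theta0 -> coord_weight eta lambda T tt i != +oo%E.
Proof. by move=> iA; rewrite coord_weightE// tt_neq0. Qed.

Lemma group_weight_fin k : k \in active_groups G theta0 ->
  group_weight G mu gamma T tt k != +oo%E.
Proof. by move=> kS; rewrite group_weightE// (lt_le_trans a0)// group_ge. Qed.

Lemma pen_rate_le : n * pen_rate G Cw Ew theta0 <=
  lambda T / n * (d%:R * (a `^ eta)^-1) + gamma T / n * (d%:R * (m%:R * (a `^ mu)^-1)).
Proof.
have C_le i : i \in supp theta0 -> n * Cw i <= lambda T / n * (a `^ eta)^-1.
  move=> iA; rewrite coord_weightE ?tt_neq0//= scale.
  rewrite ler_wpM2l ?divr_ge0 ?(ltW n0)// lef_pV2 ?posrE ?powR_gt0 ?normr_gt0 ?tt_neq0//.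
  by rewrite ge0_ler_powR ?nnegrE ?(ltW eta0) ?(ltW a0)//; exact: att.
have E_le k : k \in active_groups G theta0 -> n * Ew k <= gamma T / n * (a `^ mu)^-1.
  move=> kS; have l0 : 0 < l2norm (G k) tt by rewrite (lt_le_trans a0)// group_ge.
  rewrite group_weightE//= scale.
  rewrite ler_wpM2l ?divr_ge0 ?(ltW n0)// lef_pV2 ?posrE ?powR_gt0//.
  by rewrite ge0_ler_powR ?nnegrE ?(ltW mu0) ?(ltW a0) ?(ltW l0)//; exact: group_ge.
have sum_le (I : finType) (S : {set I}) (f : I -> R) (b : R) : 0 <= b ->
    (forall i, i \in S -> f i <= b) -> \sum_(i in S) f i <= #|I|%:R * b.
  move=> b0 h; apply: le_trans (_ : \sum_(i : I) b <= _); last by rewrite sumr_const mulr_natl.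
  rewrite big_mkcond; apply: ler_sum => i _; case: ifP => // iS; exact: h.
rewrite /pen_rate mulrDr; apply: lerD.
  rewrite mulr_sumr.
  apply: le_trans (sum_le _ _ _ (lambda T / n * (a `^ eta)^-1) _ C_le) _.
    by rewrite !mulr_ge0 ?invr_ge0 ?powR_ge0// ltW.
  by rewrite card_ord mulrCA.
rewrite [gamma T / n * _]mulrCA [n * _]mulrCA ler_wpM2l// mulr_sumr.
apply: le_trans (sum_le _ _ _ (gamma T / n * (a `^ mu)^-1) _ E_le) _.
  by rewrite !mulr_ge0 ?invr_ge0 ?powR_ge0// ltW.
by rewrite card_ord mulrCA.
Qed.

End Active.

(** The scaled weight is at least [(lambda / n) (n / b) ^ eta], and
    [n ^ (eta - 1) = T ^ ((eta - 1) / 2)]. *)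
Lemma coord_weight_large (b : R) i : 0 < b -> tt 0 i != 0 -> `|tt 0 i| <= b / n ->
  (T%:R `^ ((eta - 1) / 2) * lambda T) * (b `^ eta)^-1 <= n * Cw i.
Proof.
move=> b0 t0 tb; rewrite /= coord_weightE//=.
have TR : 0 < (T%:R : R) by rewrite ltr0n.
have nE : n = T%:R `^ (2^-1) by rewrite powR12_sqrt.
have E : T%:R `^ ((eta - 1) / 2) = n `^ eta / n.
  rewrite {1}nE -powRrM -[in RHS](powR12_sqrt (ltW TR)) -powRB; last by rewrite (gt_eqF TR) implybT.
  by congr (_ `^ _); field.
have le : n `^ eta * (b `^ eta)^-1 <= (`|tt 0 i| `^ eta)^-1.
  have -> : n `^ eta * (b `^ eta)^-1 = ((b / n) `^ eta)^-1.
    rewrite powRM ?invr_ge0 ?(ltW b0) ?(ltW n0)// invfM mulrC; congr (_ * _).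
    by rewrite -powR_inv1 ?(ltW n0)// -powRrM mulN1r powRN invrK.
  rewrite lef_pV2 ?posrE ?powR_gt0 ?normr_gt0 ?divr_gt0//.
  by rewrite ge0_ler_powR ?nnegrE ?(ltW eta0)// divr_ge0 ?(ltW b0) ?(ltW n0).
rewrite E scale.
have -> : n `^ eta / n * lambda T / b `^ eta = lambda T / n * (n `^ eta * (b `^ eta)^-1) by ring.
by rewrite ler_wpM2l// divr_ge0// ltW.
Qed.

End WeightRates.

Section LassoRates.
Context {R : realType} {dO : measure_display} {Omega : measurableType dO}.
Variable P : probability Omega R.
Context {d m : nat} {dE : measure_display} {E : measurableType dE}.
Variables (X : nat -> Omega -> E) (loss : E -> 'rV[R]_d -> R).
Variables (Theta W : set 'rV[R]_d) (theta0 : 'rV[R]_d) (G : 'I_m -> {set 'I_d}).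
Variables (F : nat -> set (set Omega)) (H M : 'M[R]_d).
Variables (eta mu : R) (lambda gamma : nat -> R).
Variables (tt th : nat -> Omega -> 'rV[R]_d).
Hypothesis grG : is_grouping G.
Hypothesis mX : forall t, measurable_fun setT (X t).
Hypotheses (statX : strictly_stationary P X) (ergX : ergodic P X).
Hypothesis filtF : filtration F.
Hypothesis cvx : forall e, strictly_convex_on Theta (loss e).
Hypotheses (openW : open W) (Wtheta0 : W theta0) (WTheta : W `<=` Theta).
Hypothesis smW : forall e s x, W x -> {for x, continuous (partials (loss e) s)} /\
  forall i, derivable (partials (loss e) s) x (delta_mx 0 i).
Hypothesis measW : forall x, W x -> measurable_fun setT (fun e => loss e x).
Hypothesis mds : forall i, martingale_difference P F
  (fun t w => partials (loss (X t w)) [:: i] theta0).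
Hypothesis sq1 : forall t i, L1 P (fun w => partials (loss (X t w)) [:: i] theta0 ^+ 2).
Hypothesis hess1 : forall i j, L1 P (fun w => partials (loss (X 0%N w)) [:: i; j] theta0).
Hypothesis hessE : forall i j, Ex P (fun w => partials (loss (X 0%N w)) [:: i; j] theta0) = H i j.
Hypothesis sqE : forall t i, Ex P (fun w => partials (loss (X t w)) [:: i] theta0 ^+ 2) = M i i.
Hypotheses (symH : H^T = H) (pdH : posdefmx H).
Hypothesis A6 : forall C : R, 0 < C -> exists K : R, forall T : nat, (0 < T)%N ->
  let ups (t : nat) (w : Omega) : \bar R :=
    upsilon G loss eta mu lambda gamma Theta theta0 C T (tt T w) (X t w) in
  (((T%:R ^+ 2)^-1)%:E * (\sum_(1 <= t < T.+1) \sum_(1 <= t' < T.+1)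
     \int[P]_w (ups t w * ups t' w)) <= K%:E)%E.
Hypotheses (eta0 : 0 < eta) (mu0 : 0 < mu).
Hypotheses (lambda0 : forall T, 0 <= lambda T) (gamma0 : forall T, 0 <= gamma T).
Hypothesis mtt : forall T, random_vector (tt T).
Hypothesis rc : root_consistent P tt theta0.
Hypothesis thmin : forall T, (0 < T)%N -> {ae P, forall w, is_argmin_on Theta
  (sgl_objective G loss eta mu lambda gamma T (fun t => X t w) (tt T w)) (th T w)}.
Hypothesis lambda_small : lambda T / Num.sqrt T%:R @[T --> \oo] --> 0.
Hypothesis gamma_small : gamma T / Num.sqrt T%:R @[T --> \oo] --> 0.
Hypothesis lambda_large : T%:R `^ ((eta - 1) / 2) * lambda T @[T --> \oo] --> +oo.

Lemma near_div_sqrt (K del : R) : 0 < del ->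
  \forall T \near \oo, K / Num.sqrt T%:R <= del.
Proof.
move=> del0; near=> T.
have T0 : (0 < T)%N by near: T; exact: nbhs_infty_gt.
have n0 : 0 < Num.sqrt (T%:R : R) by rewrite sqrtr_gt0 ltr0n.
rewrite ler_pdivrMr// -ler_pdivrMl//.
apply: le_trans (ler_norm _) _; rewrite -sqrtr_sqr ler_wsqrtr//.
by near: T; exact: nbhs_infty_ger.
Unshelve. all: by end_near.
Qed.

Lemma scores_tight (e : R) : 0 < e -> exists Ks : R, mostly P e (fun T => [set w |
  forall i, `|score loss theta0 T (fun t => X t w) i| <= Ks]).
Proof.
(* Union bound over the coordinates; [d.+1] avoids division by zero. *)
move=> e0; pose e1 := e / d.+1%:R; have e10 : 0 < e1 by rewrite divr_gt0.
have H1 i := score_tight filtF (mds i) (sq1 ^~ i) (sqE ^~ i) e10.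
have [K KP] := choice H1.
exists (\sum_i `|K i|).
apply: mostly_le (mostlyS _ (mostly_forall (ltW e10) KP)).
  rewrite card_ord /e1 mulrA ler_pdivrMr// mulrC ler_wpM2l ?(ltW e0)// ler_nat//.
apply: nearW => T w Hw i; apply: le_trans (Hw i) _.
by rewrite (bigD1 i)//= (le_trans (ler_norm _))// lerDl sumr_ge0.
Qed.

Lemma hessians_cvg (del : R) : 0 < del -> whp P (fun T => [set w | forall ki : 'I_d * 'I_d,
  `|empirical_partial loss T (fun t => X t w) [:: ki.1; ki.2] theta0 - H ki.1 ki.2| <= del]).
Proof.
move=> del0; apply: whp_forall => -[k i] /=.
have mg : measurable_fun setT (fun e => partials (loss e) [:: k; i] theta0).
  exact: (partials_measurable openW smW measW).
have := lln1 mX statX ergX mg (hess1 k i) del0.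
apply: whpS; apply: nearW => T w /=.
by rewrite [Ex P _]hessE.
Qed.

Lemma first_step_close (e : R) : 0 < e -> exists2 Mc : R, 0 < Mc & mostly P e (fun T =>
  [set w | forall i, `|tt T w 0 i - theta0 0 i| <= Mc / Num.sqrt T%:R]).
Proof.
move=> e0; have [K KP] := rc e0; exists (`|K| + 1); first by rewrite ltr_wpDl.
have mA T : measurable [set w | K < Num.sqrt T%:R * l2norm finset.setT (tt T w - theta0)].
  apply: meas_lt; first exact: measurable_cst.
  apply: measurable_funM; first exact: measurable_cst.
  apply: (measurableT_comp (continuous_measurable_fun (@sqrt_continuous R))).
  rewrite (_ : (fun w => _) = (fun w => \sum_i (tt T w 0 i - theta0 0 i) ^+ 2)).
    apply: measurable_sum => i; apply: measurable_funX.
    by apply: measurable_funB; [exact: mtt|exact: measurable_cst].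
  apply/funext => w; apply: eq_big => [i|i _]; first by rewrite inE.
  by rewrite !mxE.
apply: mostlyS (cvg_prob0_mostly mA KP); near=> T => w /= /negP; rewrite -leNgt => le i.
have T0 : (0 < T)%N by near: T; exact: nbhs_infty_gt.
have n0 : 0 < Num.sqrt (T%:R : R) by rewrite sqrtr_gt0 ltr0n.
rewrite ler_pdivlMr// mulrC; apply: le_trans (_ : K <= _); last first.
  by rewrite (le_trans (ler_norm _))// lerDl.
apply: le_trans le; rewrite ler_pM2l//.
by have := coord_le_l2norm (tt T w - theta0) (finset.in_setT i); rewrite !mxE.
Unshelve. all: by end_near.
Qed.

Lemma argmin_whp : whp P (fun T => [set w | is_argmin_on Theta
  (sgl_objective G loss eta mu lambda gamma T (fun t => X t w) (tt T w)) (th T w)]).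
Proof.
move=> e e0; near=> T.
have T0 : (0 < T)%N by near: T; exact: nbhs_infty_gt.
have [N [mN N0 sub]] := thmin T0.
exists N; split => //; first by rewrite N0 lee_fin ltW.
by move=> w nN; apply: contrapT => h; apply: nN; exact: sub.
Unshelve. all: by end_near.
Qed.

Lemma support_gap : exists2 a : R, 0 < a & forall i, i \in supp theta0 -> a + a <= `|theta0 0 i|.
Proof.
exists (\big[Order.min/1]_(i in supp theta0) (`|theta0 0 i| / 2)).
  by apply/bigmin_gtP; split => // i; rewrite inE => t0; rewrite divr_gt0// normr_gt0.
move=> i iA; have := bigmin_le_cond 1 (fun i => `|theta0 0 i| / 2) iA.
by set b := \big[_/_]_(_ in _) _; lra.
Qed.

(* The radius [rho] has to be chosen before [eps]. *)
Lemma main_estimates (e : R) : 0 < e -> exists2 rho : R, 0 < rho &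
  forall eps : R, 0 < eps -> mostly P e (fun T => [set w |
    [/\ Num.sqrt T%:R * `|th T w - theta0| <= rho,
        forall i, i \notin supp theta0 -> th T w 0 i = 0 &
        forall i, i \in supp theta0 -> `|score loss theta0 T (fun t => X t w) i
          + \sum_k (Num.sqrt T%:R *: (th T w - theta0)) 0 k * H k i| <= eps]]).
Proof.
(* Four events are combined: three tightness events and the joint event of Hessian and argmin. *)
move=> e0; pose e5 := e / 5; have e50 : 0 < e5 by rewrite divr_gt0.
have [Ks KsP] := scores_tight e50.
have [Mc Mc0 McP] := first_step_close e50.
have [a a0 gap] := support_gap.
have [c c0 Hc] := posdef_coercive symH pdH.
(* With half of the coercivity left, [(c / 2) * rho / 4] is [d Ks1 + d + 2], which beats the linear
   terms for every [del <= 1]. *)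
pose Ks1 := `|Ks|; pose rho : R := 8 * (d%:R * Ks1 + d%:R + 2) / c.
have Ks10 : 0 <= Ks1 by exact: normr_ge0.
have rho0 : 0 < rho.
  by rewrite divr_gt0// mulr_gt0// ltr_wpDl// addr_ge0// mulr_ge0.
exists rho => // eps eps0.
pose D : R := 4 + `|H| + d%:R * rho.
have D0 : 0 < D.
  have dr0 : 0 <= d%:R * rho by rewrite mulr_ge0// ltW.
  by have := normr_ge0 H; rewrite /D; lra.
(* The second bound preserves half of the coercivity, the third brings the score error below
   [eps]. *)
pose del : R := Order.min 1 (Order.min (c / (2 * (d%:R ^+ 2 + 1))) (eps / D)).
have dd0 : 0 < d%:R ^+ 2 + 1 :> R by rewrite ltr_wpDl// sqr_ge0.
have del0 : 0 < del by rewrite !lt_min ltr01 !divr_gt0// mulr_gt0.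
have del1 : del <= 1 by rewrite ge_min lexx.
have del2 : d%:R ^+ 2 * del <= c / 2.
  have : del <= c / (2 * (d%:R ^+ 2 + 1)) by rewrite !ge_min lexx orbT.
  rewrite ler_pdivlMr ?mulr_gt0// => h.
  have : 0 <= del by exact: ltW.
  by move: h; lra.
have del3 : del * D <= eps.
  have : del <= eps / D by rewrite !ge_min lexx !orbT.
  by rewrite ler_pdivlMr.
have big : d%:R * Ks1 + d%:R * del + del < (c - d%:R ^+ 2 * del) * rho / 4.
  have d0 : 0 <= d%:R :> R by [].
  have : d%:R * del <= d%:R by rewrite ler_piMr.
  have : c / 2 * rho / 4 <= (c - d%:R ^+ 2 * del) * rho / 4.
    by rewrite ler_pM2r ?invr_gt0// ler_pM2r//; lra.
  have -> : c / 2 * rho / 4 = d%:R * Ks1 + d%:R + 2 by rewrite /rho; field; rewrite gt_eqF.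
  by move: del1; lra.
(* Leaves room for the displacement by [del <= 1] in [score_bound]. *)
pose R0 := rho + 1.
have R00 : 0 < R0 by rewrite addr_gt0.
have rhoR : rho + del <= R0 by rewrite lerD2l.
have [Lb LbP] := third_derivatives_bounded lambda0 gamma0 mX openW Wtheta0 WTheta smW measW A6 R00 e50.
have [r r0 ballW] := open_ball openW Wtheta0.
pose KK := Ks1 + d%:R * (rho * (`|H| + del)) + del.
have KK0 : 0 < KK.
  have h0 : 0 <= d%:R * (rho * (`|H| + del)).
    by rewrite mulr_ge0// mulr_ge0 ?(ltW rho0)// addr_ge0 ?normr_ge0 ?(ltW del0).
  by rewrite /KK; move: Ks10 del0; lra.
have ball_near : \forall T \near \oo, R0 / Num.sqrt T%:R <= r by exact: near_div_sqrt.
have Lb_near : \forall T \near \oo, d%:R ^+ 2 * R0 ^+ 2 * Lb / Num.sqrt T%:R <= del.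
  exact: near_div_sqrt.
have Mc_near : \forall T \near \oo, Mc / Num.sqrt T%:R <= a by exact: near_div_sqrt.
have lam_near : \forall T \near \oo, (KK + 1) * Mc `^ eta <= T%:R `^ ((eta - 1) / 2) * lambda T.
  by move/cvgryPge: lambda_large; apply.
have small_near : \forall T \near \oo, lambda T / Num.sqrt T%:R * (d%:R * (a `^ eta)^-1)
    + gamma T / Num.sqrt T%:R * (d%:R * (m%:R * (a `^ mu)^-1)) <= del.
  have : lambda T / Num.sqrt T%:R * (d%:R * (a `^ eta)^-1)
      + gamma T / Num.sqrt T%:R * (d%:R * (m%:R * (a `^ mu)^-1)) @[T --> \oo] -->
      0 * (d%:R * (a `^ eta)^-1) + 0 * (d%:R * (m%:R * (a `^ mu)^-1)).
    by apply: cvgD; apply: cvgM => //; exact: cvg_cst.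
  rewrite !mul0r addr0 => /cvgrPdist_le /(_ del del0); apply: filterS => T.
  by rewrite sub0r normrN => /(le_trans (ler_norm _)).
have all_events := mostlyI (mostlyI (mostlyI KsP LbP) McP)
  (whpI (hessians_cvg del0) argmin_whp e50).
apply: mostly_le (mostlyS _ all_events); first by rewrite /e5; lra.
near=> T => w /= [[[sK [B HB HL]] tt_near] [hH wmin]].
have T0 : (0 < T)%N by near: T; exact: nbhs_infty_gt.
have n0 : 0 < Num.sqrt (T%:R : R) by rewrite sqrtr_gt0 ltr0n.
have att i : i \in supp theta0 -> a <= `|tt T w 0 i|.
  move=> /gap g.
  have : Mc / Num.sqrt T%:R <= a by near: T.
  have := tt_near i; have := lerB_dist (theta0 0 i) (tt T w 0 i).
  by rewrite distrC; move: g; lra.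
have large : (KK + 1) * Mc `^ eta <= T%:R `^ ((eta - 1) / 2) * lambda T by near: T.
(* Only [lambda T >= 0] is assumed; strict positivity follows from the growth condition for large
   [T]. *)
have lamT : 0 < lambda T.
  rewrite lt_neqAle lambda0 andbT; apply/eqP => l0; move: large.
  by rewrite -l0 mulr0 leNgt mulr_gt0 ?powR_gt0// addr_gt0.
have ball y : `|y - theta0| <= R0 / Num.sqrt T%:R -> W y.
  move=> yr; apply: ballW; apply: le_trans yr _.
  by near: T.
have sK1 i : `|score loss theta0 T (fun t => X t w) i| <= Ks1.
  by apply: le_trans (sK i) _; exact: ler_norm.
have hH1 k i : `|empirical_partial loss T (fun t => X t w) [:: k; i] theta0 - H k i| <= del.
  exact: (hH (k, i)).
have Lbd : d%:R ^+ 2 * R0 ^+ 2 * Lb / Num.sqrt T%:R <= del by near: T.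
have small : Num.sqrt T%:R * pen_rate G (fun i => fine (coord_weight eta lambda T (tt T w) i))
    (fun k => fine (group_weight G mu gamma T (tt T w) k)) theta0 <= del.
  apply: le_trans (pen_rate_le G lambda0 gamma0 eta0 mu0 T0 a0 att) _.
  by near: T.
have big_weight i : i \notin supp theta0 -> tt T w 0 i != 0 ->
    KK < Num.sqrt T%:R * fine (coord_weight eta lambda T (tt T w) i).
  rewrite inE negbK => /eqP t0i tti.
  have tb : `|tt T w 0 i| <= Mc / Num.sqrt T%:R by have := tt_near i; rewrite t0i subr0.
  apply: lt_le_trans (coord_weight_large lambda0 eta0 T0 Mc0 tti tb).
  rewrite ltr_pdivlMr ?powR_gt0//; apply: lt_le_trans large.
  by rewrite ltr_pM2r ?powR_gt0// ltrDl.
have [] := path_estimates grG lambda0 gamma0 openW WTheta smW cvx T0 eta0 lamT rho0 del0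
  rhoR wmin ball sK1 hH1 HB HL Lbd Hc big (coord_weight_fin eta lambda T a0 att)
  (group_weight_fin mu gamma T a0 att) small big_weight.
move=> c1 c2 c3; split => // i iA; apply: le_trans (c3 i iA) (le_trans _ del3).
by rewrite ler_pM2l// /D; move: del1; lra.
Unshelve. all: by end_near.
Qed.

End LassoRates.

(** * Asymptotic normality *)

Section OracleProperty.
Context {dO : measure_display} {Omega : measurableType dO} {R : realType} {d : nat}.
Variable P : probability Omega R.
Variables (theta0 : 'rV[R]_d) (th : nat -> Omega -> 'rV[R]_d).
Variables (s : nat -> Omega -> 'rV[R]_d) (H M : 'M[R]_d).
Local Notation A := (supp theta0).
Local Notation u T w := (Num.sqrt T%:R *: (th T w - theta0)).
Hypotheses (mth : forall T, random_vector (th T)) (ms : forall T, random_vector (s T)).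
Hypotheses (symH : H^T = H) (pdH : posdefmx H) (symM : M^T = M) (pdM : posdefmx M).
Hypothesis estimates : forall e : R, 0 < e -> exists2 rho : R, 0 < rho &
  forall eps : R, 0 < eps -> mostly P e (fun T => [set w |
    [/\ Num.sqrt T%:R * `|th T w - theta0| <= rho,
        forall i, i \notin A -> th T w 0 i = 0 &
        forall i, i \in A -> `|s T w 0 i + \sum_k u T w 0 k * H k i| <= eps]]).
Hypothesis score_clt : forall b phi,
  Ex P (fun w => cos (dotv b (s T w) + phi)) @[T --> \oo]
    --> expR (- ((b *m M *m b^T) 0 0) / 2) * cos phi.
Hypothesis gap : exists2 a : R, 0 < a & forall i, i \in A -> a <= `|theta0 0 i|.
Hypothesis div_sqrt : forall K del : R, 0 < del ->
  \forall T \near \oo, K / Num.sqrt T%:R <= del.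

(** Inactive coordinates vanish by the estimates; an active one cannot, since [rho / sqrt T] is
    eventually below the gap [a]. *)
Lemma support_consistent : P [set w | supp (th T w) = A] @[T --> \oo] --> 1%E.
Proof.
apply: whp_cvg_prob => [T|e e0].
  have -> : [set w | supp (th T w) = A] = \bigcap_(i in setT) [set w | (th T w 0 i != 0) = (i \in A)].
    apply/seteqP; split => w /=.
      by move=> E i _ /=; rewrite -E inE.
    by move=> h; apply/setP => i; rewrite inE; exact: h.
  apply: fin_bigcap_measurable; first exact: finite_finset.
  move=> i _.
  have mE : measurable [set w | th T w 0 i = 0].
    rewrite -[X in measurable X]setTI; exact: (mth T i measurableT (measurable_set1 0)).
  case: (i \in A).
    rewrite (_ : mkset _ = ~` [set w | th T w 0 i = 0]); first exact: measurableC.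
    by apply/seteqP; split => w /= => [/eqP|/eqP].
  rewrite (_ : mkset _ = [set w | th T w 0 i = 0])//.
  by apply/seteqP; split => w /= => [/negbT/negPn/eqP|->] //; rewrite eqxx.
have [rho rho0 est] := estimates e0.
have [a a0 ga] := gap.
apply: mostlyS (est 1 ltr01); near=> T => w /= [near out _].
have T0 : (0 < T)%N by near: T; exact: nbhs_infty_gt.
have n0 : 0 < Num.sqrt (T%:R : R) by rewrite sqrtr_gt0 ltr0n.
apply/setP => i; rewrite inE; have [iA|iA] := boolP (i \in A); last by rewrite out// eqxx.
apply/eqP => thi; have := ga i iA; apply/negP; rewrite -ltNge.
apply: le_lt_trans (_ : rho / Num.sqrt T%:R < a).
  rewrite ler_pdivlMr// mulrC; apply: le_trans near; rewrite ler_pM2l//.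
  by have := coord_le_norm (th T w - theta0) i; rewrite !mxE thi sub0r normrN.
apply: le_lt_trans (_ : a / 2 < a); last by rewrite ltr_pdivrMr// ltr_pMr// ltr1n.
by near: T; apply: div_sqrt; rewrite divr_gt0.
Unshelve. all: by end_near.
Qed.

Local Notation HA := (submx_on A H).
Local Notation MA := (submx_on A M).
Local Notation X := (fun T w => Num.sqrt T%:R *: subvec A (th T w - theta0)).

Let uHA : HA \in unitmx. Proof. exact/posdef_unitmx/posdef_sub. Qed.
Let symHA : HA^T = HA. Proof. exact: sub_sym. Qed.
Let symIHA : (invmx HA)^T = invmx HA. Proof. by rewrite trmx_inv symHA. Qed.

(** The estimates say that [X H_AA] is nearly [- s_A]. Since [H_AA] is symmetric,
    [<a, X> = <a H_AA^-1, X H_AA>], which becomes a linear form of the score. *)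
Lemma score_linearization (a : 'rV[R]_#|A|) (eps : R) T w : 0 <= eps ->
  (forall i, i \notin A -> th T w 0 i = 0) ->
  (forall i, i \in A -> `|s T w 0 i + \sum_k u T w 0 k * H k i| <= eps) ->
  `|dotv a (X T w) - dotv (- embed (a *m invmx HA)) (s T w)|
    <= #|A|%:R * (`|a *m invmx HA| * eps).
Proof.
move=> eps0 out close; set g := a *m invmx HA.
pose r (k : 'I_#|A|) := s T w 0 (enum_val k) + \sum_j u T w 0 j * H j (enum_val k).
have sub (k : 'I_#|A|) : \sum_j u T w 0 j * H j (enum_val k) = (X T w *m HA) 0 k.
  rewrite [RHS]mxE (bigID (mem A)) /= [Y in _ + Y]big1 ?addr0 => [|j jA]; last first.
    have -> : u T w 0 j = 0; last by rewrite mul0r.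
    rewrite !mxE out//; move: jA; rewrite inE negbK => /eqP ->.
    by rewrite subrr mulr0.
  rewrite -(sum_enum_val A (fun j => u T w 0 j * H j (enum_val k))).
  by apply: eq_bigr => j _; rewrite !mxE.
have E : dotv a (X T w) - dotv (- embed g) (s T w) = \sum_k g 0 k * r k.
  have -> : dotv (- embed g) (s T w) = - \sum_k g 0 k * s T w 0 (enum_val k).
    rewrite -(sum_embed g (fun i => s T w 0 i)) /dotv -sumrN.
    by apply: eq_bigr => i _; rewrite mxE mulNr.
  have -> : dotv a (X T w) = \sum_k g 0 k * (X T w *m HA) 0 k.
    have -> : dotv a (X T w) = (a *m (X T w)^T) 0 0.
      by rewrite mxE; apply: eq_bigr => k _; rewrite [(X T w)^T _ _]mxE.
    have -> : a *m (X T w)^T = g *m (X T w *m HA)^T.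
      by rewrite trmx_mul symHA mulmxA /g mulmxKV.
    by rewrite mxE; apply: eq_bigr => k _; rewrite [(_ *m HA)^T _ _]mxE.
  by rewrite opprK addrC -big_split; apply: eq_bigr => k _; rewrite /r sub mulrDr.
rewrite E; apply: mvt_sum_bound => // k; first exact: coord_le_norm.
exact/close/enum_valP.
Qed.

Lemma sub_random T : random_vector (X T).
Proof.
move=> k; rewrite (_ : (fun w => _) = (fun w => Num.sqrt T%:R * (th T w 0 (enum_val k) - theta0 0 (enum_val k)))).
  apply: measurable_funM; first exact: measurable_cst.
  by apply: measurable_funB; [exact: mth|exact: measurable_cst].
by apply/funext => w; rewrite !mxE.
Qed.

Local Notation V := (invmx HA *m MA *m invmx HA).

Lemma char_cvg (a : 'rV[R]_#|A|) (phi : R) :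
  Ex P (fun w => cos (dotv a (X T w) + phi)) @[T --> \oo]
    --> expR (- ((a *m V *m a^T) 0 0 / 2)) * cos phi.
Proof.
pose g := a *m invmx HA.
have VE : (a *m V *m a^T) 0 0 = ((- embed g) *m M *m (- embed g)^T) 0 0.
  rewrite mulNmx linearN mulmxN mulNmx opprK embed_quad; congr (_ 0 0).
  by rewrite /g trmx_mul symIHA !mulmxA.
rewrite VE -mulNr; apply/cvgrPdist_le => e e0.
have := @score_clt (- embed g) phi => /cvgrPdist_le /(_ (e / 2)).
rewrite divr_gt0// => /(_ isT) clt.
pose e4 := e / 8; have e40 : 0 < e4 by rewrite divr_gt0.
have [rho rho0 est] := estimates e40.
(* With [eps = e4 / K] the linearization error is at most [e4]. *)
pose K := #|A|%:R * `|g| + 1.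
have K0 : 0 < K by rewrite ltr_wpDl// mulr_ge0.
pose eps := e4 / K; have eps0 : 0 < eps by rewrite divr_gt0.
have mcos (Y : Omega -> R) : measurable_fun setT Y ->
    measurable_fun setT (fun w => cos (Y w + phi)).
  move=> mY; apply: (measurableT_comp (continuous_measurable_fun (@continuous_cos R))).
  by apply: measurable_funD => //; exact: measurable_cst.
have bcos (Y : Omega -> R) : measurable_fun setT Y -> L1 P (fun w => cos (Y w + phi)).
  move=> mY; apply: (@L1_bounded _ _ _ _ _ 1) => [|w]; first exact: mcos.
  by rewrite ler_norml cos_geN1 cos_le1.
near=> T.
have [N [mN Ne good]] : exists N, [/\ measurable N, (P N <= e4%:E)%E & forall w, ~ N w ->
    [/\ Num.sqrt T%:R * `|th T w - theta0| <= rho,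
        forall i, i \notin A -> th T w 0 i = 0 &
        forall i, i \in A -> `|s T w 0 i + \sum_k u T w 0 k * H k i| <= eps]].
  by near: T; exact: est.
have mX : measurable_fun setT (fun w => dotv a (X T w)).
  exact: (random_vector_dotv a (sub_random T)).
have mS : measurable_fun setT (fun w => dotv (- embed g) (s T w)) by exact: random_vector_dotv.
have D : `|Ex P (fun w => cos (dotv a (X T w) + phi) - cos (dotv (- embed g) (s T w) + phi))|
    <= e4 + 2 * e4.
  apply: (@Ex_small _ _ _ P _ N) => //.
  - by apply: measurable_funB; exact: mcos.
  - exact: ltW.
  - move=> w; apply: le_trans (ler_normB _ _) _; rewrite -[2]/(1 + 1).
    by apply: lerD; rewrite ler_norml cos_geN1 cos_le1.
  - move=> w /good [_ out close].
    have [cl _] := cos_sin_lipschitz (dotv a (X T w) + phi) (dotv (- embed g) (s T w) + phi).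
    apply: le_trans cl _; rewrite opprD addrACA subrr addr0.
    apply: le_trans (score_linearization a (ltW eps0) out close) _.
    rewrite mulrA /eps mulrCA ler_piMr ?(ltW e40)//.
    by rewrite ler_pdivrMr// mul1r lerDl.
rewrite ExB in D; [|exact: bcos|exact: bcos].
have cl : `|expR (- ((- embed g *m M *m (- embed g)^T) 0 0) / 2) * cos phi -
    Ex P (fun w => cos (dotv (- embed g) (s T w) + phi))| <= e / 2 by near: T.
move: D cl; set x := Ex P _; set y := Ex P _; set z := expR _ * _.
rewrite !ler_norml /e4 => /andP[? ?] /andP[? ?]; apply/andP; split; lra.
Unshelve. all: by end_near.
Qed.

(** Factoring [M_AA] exhibits the sandwich covariance as a square, hence a Gaussian limit exists;
    tightness comes from the rate and the characteristic functions from [char_cvg]. *)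
Lemma asymptotically_normal : cvg_in_law_to_normal P X V.
Proof.
have [L _ ME] := posdef_cholesky (sub_sym A symM) (@posdef_sub _ _ A _ pdM).
have VE : V = (invmx HA *m L) *m (invmx HA *m L)^T.
  by rewrite trmx_mul symIHA ME !mulmxA.
have [Q [charQ gaussQ]] := gaussian_exists VE.
exists Q; split => // f cf [B fB].
have tight e : 0 < e -> exists C : R, mostly P e (fun T => [set w | forall i, `|X T w 0 i| <= C]).
  move=> e0; have [rho rho0 est] := estimates e0.
  exists rho; apply: mostlyS (est 1 ltr01); near=> T => w /= [near _ _] i.
  apply: le_trans near; rewrite !mxE normrM ger0_norm// ler_wpM2l//.
  by have := coord_le_norm (th T w - theta0) (enum_val i); rewrite !mxE.
have chr a b : Ex P (fun w => cos (dotv a (X T w) + b)) @[T --> \oo] -->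
    Ex Q (fun x => cos (dotv a (rv_of_tuple x) + b)).
  by rewrite charQ; exact: char_cvg.
have wc := weak_cvg sub_random (rv_of_tuple_random (k := #|A|)) tight chr cf fB.
have L1f d' (Om : measurableType d') (mu : probability Om R) (Y : Om -> 'rV[R]_#|A|) :
    random_vector Y -> L1 mu (f \o Y).
  by move=> rY; apply: (@L1_bounded _ _ _ _ _ B) => [|w]; [exact: continuous_random_vector rY cf fB|exact: fB].
have -> : (\int[Q]_x (f (rv_of_tuple x))%:E)%E = (Ex Q (f \o rv_of_tuple (k := #|A|)))%:E.
  by apply: ExE; apply: L1f; exact: rv_of_tuple_random.
rewrite (_ : (fun T => _) = (fun T => (Ex P (f \o X T))%:E)); last first.
  by apply/funext => T; apply: (ExE (X := f \o X T)); apply: L1f; exact: sub_random.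
by apply: cvg_EFin => //; apply: nearW.
Unshelve. all: by end_near.
Qed.

End OracleProperty.

Section LinearCombination.
Context {dO dE : measure_display} {Omega : measurableType dO} {E : measurableType dE}
  {R : realType} {d : nat}.
Variables (P : probability Omega R) (F : nat -> set (set Omega)).
Variables (X : nat -> Omega -> E) (g : 'I_d -> E -> R) (M : 'M[R]_d) (b : 'rV[R]_d).
Hypothesis mX : forall t, measurable_fun setT (X t).
Hypotheses (statX : strictly_stationary P X) (ergX : ergodic P X).
Hypotheses (filtF : filtration F) (adX : adapted F X).
Hypothesis mg : forall i, measurable_fun setT (g i).
Hypothesis mds : forall i, martingale_difference P F (fun t w => g i (X t w)).
Hypothesis prod1 : forall t i j, L1 P (fun w => g i (X t w) * g j (X t w)).
Hypothesis prodE : forall t i j, Ex P (fun w => g i (X t w) * g j (X t w)) = M i j.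

Let h e := \sum_i b 0 i * g i e.

Let mh : measurable_fun setT h.
Proof. by apply: measurable_sum => i; apply: measurable_funM. Qed.

Lemma linear_martingale_difference : martingale_difference P F (fun t w => h (X t w)).
Proof.
have g1 t i : L1 P (fun w => g i (X t w)) by exact: (md_L1 (mds i) t).
have h1 t : L1 P (fun w => h (X t w)) by apply: L1_sum => i _; exact: L1Z.
split => [t A mA|t|t B FB].
- have mhA : measurable (h @^-1` A) by rewrite -[X in measurable X]setTI; exact: mh.
  exact: (adX t mhA).
- exact: h1.
have [_ sub _] := filtF; have mB := sub t B FB.
have c1 (f : Omega -> R) : L1 P f -> L1 P (fun w => \1_B w * f w).
  move=> hf; apply: L1_le (L1_norm hf).
    by apply: measurable_funM; [exact: measurable_indic|exact: (L1_meas hf)].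
  move=> w; rewrite normrM indicE; case: (_ \in _); rewrite ?normr1 ?mul1r// normr0 mul0r//.
transitivity (\int[P]_w (\1_B w * h (X t.+1 w))%:E)%E.
  rewrite integral_mkcond; apply: eq_integral => w _.
  by rewrite patchE indicE; case: (w \in B); rewrite ?mul1r// mul0r.
rewrite ExE; last exact: c1.
have E1 w : \1_B w * h (X t.+1 w) = \sum_i b 0 i * (\1_B w * g i (X t.+1 w)).
  by rewrite /h mulr_sumr; apply: eq_bigr => i _; rewrite mulrCA.
rewrite (Ex_ext P E1) Ex_sum => [|i _]; last by apply: L1Z; exact: c1.
rewrite big1// => i _; rewrite ExZ; last exact: c1.
by rewrite (md_indic filtF (mds i) FB) mulr0.
Qed.

Let quadE t w : h (X t w) ^+ 2 = \sum_i \sum_j (b 0 i * b 0 j) * (g i (X t w) * g j (X t w)).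
Proof.
rewrite expr2 /h mulr_suml; apply: eq_bigr => i _.
by rewrite mulr_sumr; apply: eq_bigr => j _; rewrite mulrACA.
Qed.

Let row1 t i : L1 P (fun w => \sum_j (b 0 i * b 0 j) * (g i (X t w) * g j (X t w))).
Proof. by apply: L1_sum => j _; exact: L1Z. Qed.

Lemma linear_sq_L1 t : L1 P (fun w => h (X t w) ^+ 2).
Proof. by under eq_fun do rewrite quadE; apply: L1_sum => i _; exact: row1. Qed.

Lemma linear_sqE t : Ex P (fun w => h (X t w) ^+ 2) = (b *m M *m b^T) 0 0.
Proof.
rewrite (Ex_ext P (quadE t)) Ex_sum => [|i _]; last exact: row1.
transitivity (\sum_i \sum_j b 0 i * b 0 j * M i j).
  apply: eq_bigr => i _; rewrite Ex_sum => [|j _]; last exact: L1Z.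
  by apply: eq_bigr => j _; rewrite ExZ// prodE.
rewrite exchange_big mxE; apply: eq_bigr => j _ /=.
rewrite !mxE mulr_suml; apply: eq_bigr => i _; ring.
Qed.

Lemma linear_clt phi : Ex P (fun w => cos (\sum_i b 0 i *
    ((Num.sqrt T%:R)^-1 * \sum_(1 <= t < T.+1) g i (X t w)) + phi)) @[T --> \oo]
  --> expR (- ((b *m M *m b^T) 0 0) / 2) * cos phi.
Proof.
have clt := @martingale_clt _ _ _ P F filtF _ linear_martingale_difference
  linear_sq_L1 _ linear_sqE.
rewrite (_ : (fun T => _) = fun T => Ex P (fun w =>
  cos ((Num.sqrt T%:R)^-1 * (\sum_(1 <= t < T.+1) h (X t w)) + phi))); last first.
  apply/funext => T; apply: Ex_ext => w; congr (cos (_ + _)).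
  rewrite /h exchange_big mulr_sumr; apply: eq_bigr => i _ /=.
  by rewrite mulrCA mulr_sumr.
apply: clt => [c t|del del0].
  pose k e : R := if c < `|h e| then h e ^+ 2 else 0.
  have mk : measurable_fun setT k.
    apply: measurable_fun_ifT => //.
      by apply: measurable_fun_ltr => //; apply: measurableT_comp.
    exact: measurable_funX.
  have k1 : L1 P (k \o X 0%N).
    apply: L1_le (linear_sq_L1 0) => [|w /=]; first exact: measurableT_comp.
    by rewrite /k; case: ifP => _; rewrite ?normr0 ?sqr_ge0// ger0_norm ?sqr_ge0.
  by have [_] := stationary_marginal mX statX t mk k1.
have mh2 : measurable_fun setT (fun e => h e ^+ 2) by exact: measurable_funX.
have := lln1 mX statX ergX mh2 (linear_sq_L1 0) del0.
by rewrite [Ex P _](linear_sqE 0).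
Qed.

End LinearCombination.

Theorem theorem4p10
  (R : realType) (dO : measure_display) (Omega : measurableType dO)
  (P : probability Omega R)
  (N d m : nat)
  (eps : nat -> {RV P >-> N.-tuple (measurableTypeR R)})
  (Theta : set 'rV[R]_d) (theta0 : 'rV[R]_d)
  (G : 'I_m -> {set 'I_d})
  (loss : N.-tuple (measurableTypeR R) -> 'rV[R]_d -> R)
  (F : nat -> set (set Omega))
  (H M : 'M[R]_d)
  (eta mu : R) (lambda gamma : nat -> R)
  (ttheta htheta : nat -> Omega -> 'rV[R]_d) :
  is_grouping G ->
  (forall theta, Theta theta -> measurable_fun setT (fun x => loss x theta)) ->
  (* (A1) *)
  strictly_stationary P (fun t w => eps t w) ->
  ergodic P (fun t w => eps t w) ->
  filtration F -> adapted F (fun t w => eps t w) ->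
  (* (A2) *)
  convex_set Theta ->
  Theta° theta0 ->
  (* (A3) *)
  (forall x, strictly_convex_on Theta (loss x) /\ smooth_on Theta (loss x)) ->
  (* (A4) *)
  (forall t theta, Theta theta ->
     P.-integrable setT (fun w => (loss (eps t w) theta)%:E)) ->
  (forall t theta, Theta theta -> theta != theta0 ->
     ('E_P[fun w => loss (eps t w) theta0] <
      'E_P[fun w => loss (eps t w) theta])%E) ->
  (forall i, martingale_difference P F
     (fun t w => partials (loss (eps t w)) [:: i] theta0)) ->
  (forall t i, square_integrable P
     (fun w => partials (loss (eps t w)) [:: i] theta0)) ->
  (* (A5) *)
  (forall t i j,
     P.-integrable setT
       (fun w => (partials (loss (eps t w)) [:: i; j] theta0)%:E) /\
     ('E_P[fun w => partials (loss (eps t w)) [:: i; j] theta0]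
       = (H i j)%:E)%E) ->
  (forall t i j,
     P.-integrable setT
       (fun w => (partials (loss (eps t w)) [:: i] theta0
                  * partials (loss (eps t w)) [:: j] theta0)%:E) /\
     ('E_P[fun w => (partials (loss (eps t w)) [:: i] theta0
                   * partials (loss (eps t w)) [:: j] theta0)%R]
       = (M i j)%:E)%E) ->
  posdefmx H -> posdefmx M ->
  (* (A6) *)
  (forall C : R, 0 < C -> exists K : R, forall T : nat, (0 < T)%N ->
     let ups (t : nat) (w : Omega) : \bar R :=
       upsilon G loss eta mu lambda gamma Theta theta0 C T
         (ttheta T w) (eps t w) in
     (((T%:R ^+ 2)^-1)%:E
        * (\sum_(1 <= t < T.+1) \sum_(1 <= t' < T.+1)
             \int[P]_w (ups t w * ups t' w)) <= K%:E)%E) ->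
  (* tuning parameters, first-step estimator and adaptive estimator *)
  0 < eta -> 0 < mu ->
  (forall T, 0 <= lambda T) -> (forall T, 0 <= gamma T) ->
  (forall T, random_vector (ttheta T)) ->
  root_consistent P ttheta theta0 ->
  (forall T, random_vector (htheta T)) ->
  (forall T, (0 < T)%N -> {ae P, forall w, is_argmin_on Theta
     (sgl_objective G loss eta mu lambda gamma T (fun t => eps t w)
        (ttheta T w))
     (htheta T w)}) ->
  (* rates *)
  lambda T / Num.sqrt T%:R @[T --> \oo] --> 0 ->
  gamma T / Num.sqrt T%:R @[T --> \oo] --> 0 ->
  T%:R `^ ((eta - 1) / 2) * lambda T @[T --> \oo] --> +oo ->
  T%:R `^ ((mu - 1) / 2) * gamma T @[T --> \oo] --> +oo ->
  let A := supp theta0 in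
  P [set w | supp (htheta T w) = A] @[T --> \oo] --> 1%E /\
  cvg_in_law_to_normal P
    (fun T w => Num.sqrt T%:R *: subvec A (htheta T w - theta0))
    (invmx (submx_on A H) *m submx_on A M *m invmx (submx_on A H)).
Proof.
move=> grG mloss stat erg filtF adF cvxT intT A3 _ _ mds sq hess prods pdH pdM A6 eta0 mu0
  lambda0 gamma0 mtt rc mth thmin lam0 gam0 lamL _ A.
pose X t w := eps t w.
have mX t : measurable_fun setT (X t) by exact: measurable_funPT.
(* Derivatives are used on this open set, which contains [theta0] and every small ball around it;
   points of these balls are feasible. *)
pose W := Theta°.
have openW : open W by exact: open_interior.
have WTheta : W `<=` Theta by exact: interior_subset.
have cvx e : strictly_convex_on Theta (loss e) by have [] := A3 e.
have smW e s x : W x -> {for x, continuous (partials (loss e) s)} /\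
    forall i, derivable (partials (loss e) s) x (delta_mx 0 i).
  by move=> Wx; have [_ [U [_ TU smU]]] := A3 e; apply: smU; exact/TU/WTheta.
have measW x : W x -> measurable_fun setT (fun e => loss e x) by move=> /WTheta; exact: mloss.
pose g i e := partials (loss e) [:: i] theta0.
have mg i : measurable_fun setT (g i) by apply: (partials_measurable openW smW measW).
have prod1 t i j : L1 P (fun w => g i (X t w) * g j (X t w)) by have [] := prods t i j.
have prodE t i j : Ex P (fun w => g i (X t w) * g j (X t w)) = M i j.
  by have [_ h] := prods t i j; apply: EFin_inj; rewrite -h unlock (ExE (prod1 t i j)).
have symM : M^T = M.
  apply/matrixP => i j; rewrite mxE -(prodE 0%N) -(prodE 0%N i).
  by apply: Ex_ext => w; rewrite mulrC.
have sqE t i : Ex P (fun w => partials (loss (X t w)) [:: i] theta0 ^+ 2) = M i i.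
  by rewrite -(prodE t); apply: Ex_ext => w; rewrite expr2.
have sq1 t i : L1 P (fun w => partials (loss (X t w)) [:: i] theta0 ^+ 2).
  by have [_] := sq t i.
have hess1 i j : L1 P (fun w => partials (loss (X 0%N w)) [:: i; j] theta0).
  by have [] := hess 0%N i j.
have hessE i j : Ex P (fun w => partials (loss (X 0%N w)) [:: i; j] theta0) = H i j.
  by have [_ h] := hess 0%N i j; apply: EFin_inj; rewrite -h unlock (ExE (hess1 i j)).
(* Mixed partial derivatives commute for each value of the observation, hence also in
   expectation. *)
have symH : H^T = H.
  apply/matrixP => i j; rewrite mxE -(hessE i j) -(hessE j i); apply: Ex_ext => w.
  exact: (second_partials_commute openW smW).
have est e (e0 : 0 < e) := main_estimates grG mX stat erg filtF cvx openW intT WTheta smW measW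
  mds sq1 hess1 hessE sqE symH pdH A6 eta0 mu0 lambda0 gamma0 mtt rc thmin lam0 gam0 lamL e0.
pose s T w : 'rV[R]_d := \row_i score loss theta0 T (fun t => X t w) i.
have ms T : random_vector (s T).
  move=> i; under eq_fun do rewrite mxE; apply: measurable_funM; first exact: measurable_cst.
  by apply: measurable_sum => t; apply: measurableT_comp (mg i) (mX t).
have est' e : 0 < e -> exists2 rho : R, 0 < rho &
    forall del : R, 0 < del -> mostly P e (fun T => [set w |
    [/\ Num.sqrt T%:R * `|htheta T w - theta0| <= rho,
        forall i, i \notin A -> htheta T w 0 i = 0 &
        forall i, i \in A -> `|s T w 0 i
          + \sum_k (Num.sqrt T%:R *: (htheta T w - theta0)) 0 k * H k i| <= del]]).
  move=> e0; have [rho rho0 h] := est e e0; exists rho => // del del0.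
  apply: mostlyS (h del del0); apply: nearW => T w [c1 c2 c3]; split => // i iA.
  by rewrite mxE; exact: c3.
have clt b phi : Ex P (fun w => cos (dotv b (s T w) + phi)) @[T --> \oo]
    --> expR (- ((b *m M *m b^T) 0 0) / 2) * cos phi.
  have := @linear_clt _ _ _ _ _ _ P F X g M b mX stat erg filtF adF mg mds prod1 prodE phi.
  rewrite (_ : (fun T => _) = fun T => Ex P (fun w => cos (dotv b (s T w) + phi)))//.
  apply/funext => T; apply: Ex_ext => w; congr (cos (_ + _)).
  by apply: eq_bigr => i _; rewrite mxE.
split.
  have [a a0 gap] := support_gap theta0.
  apply: (@support_consistent _ _ _ _ P theta0 htheta s H mth est') near_div_sqrt.
  exists a => // i iA; apply: le_trans (gap i iA); by rewrite lerDl ltW.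
exact: (asymptotically_normal mth ms symH pdH symM pdM est' clt).
Qed.
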